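(* Let $n\ge 2$ and let $f,g\colon(\mathbb{C}^n,0)\to(\mathbb{C},0)$ be reduced germs of holomorphic functions. Then the multiplicities $\nu_f$ and $\nu_g$ are equal if and only if there exist reduced germs of holomorphic functions $f',g'\colon(\mathbb{C}^n,0)\to(\mathbb{C},0)$, with $f'$ analytically equivalent to $f$ and $g'$ analytically equivalent to $g$, such that $g'$ is a Rouché satellite of $f'$.
   Context: A germ is reduced if it has no repeated irreducible factor in $\mathbb{C}\{z_1,\dots,z_n\}$ (in particular it is nonzero). For a reduced germ $h\colon(\mathbb{C}^n,0)\to(\mathbb{C},0)$: - $V_h$ is the germ at $0$ of the hypersurface $h^{-1}(0)$. - The multiplicity $\nu_h$ of $V_h$ at $0$ is the number of points of intersection, near $0$, of $V_h$ with a generic complex line in $\mathbb{C}^n$ passing arbitrarily close to $0$ but not through $0$. Since $h$ is reduced, $\nu_h$ equals the order of $h$ at $0$, i.e. the lowest degree occurring in its power series expansion at $0$. - The tangent cone $C(V_h)$ is the zero set in $\mathbb{C}^n$ of the initial polynomial of $h$ (its homogeneous part of degree $\nu_h$). Analytic equivalence: reduced germs $h,k$ are analytically equivalent if there is a germ of analytic isomorphism (biholomorphism) $\varphi\colon(\mathbb{C}^n,0)\to(\mathbb{C}^n,0)$ with $\varphi(V_k)=V_h$. Good disc: let $L$ be a complex line through $0$ in $\mathbb{C}^n$ not contained in $C(V_h)\cup C(V_k)$. A closed disc $D\subseteq L$ around (centered at) $0$, contained in the domain of representatives of $h$ and $k$, is a good disc for $h$ and for $k$ if for every closed disc $D'\subseteq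 D$ around $0$ one has $D'\cap(V_h\cup V_k)=\{0\}$. Here $V_h,V_k$ denote the zero sets of the representatives. Rouché satellite: $k$ is a Rouché satellite of $h$ if there exists a good disc $D$ for $h$ and for $k$ (in some such line $L$) such that $|h(z)-k(z)|<|h(z)|$ for all $z\in\dot D$, where $\dot D$ is the boundary circle of $D$ in $L$. *)

(* Defs.v *)
From HB Require Import structures.
From mathcomp Require Import all_boot all_order all_algebra.
From mathcomp Require Import finmap.
From mathcomp.analysis.showcase Require Import summability.
From mathcomp Require Import all_classical all_reals all_analysis.
From mathcomp.real_closed Require Export complex.

Set Implicit Arguments.
Unset Strict Implicit.
Unset Printing Implicit Defensive.

Import Order.TTheory GRing.Theory Num.Theory.
Import numFieldNormedType.Exports.

Local Open Scope classical_set_scope.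
Local Open Scope ring_scope.

(* A germ at 0 is given by a total function on C^n, of which only the
   restriction to arbitrarily small neighbourhoods of 0 is meaningful.  The
   scalars C are abstract here, so that C and 'rV[C]_n carry the library's
   norm topology; the intended instance is R[i] with R : realType. *)

Section Germs.
Variables (C : numClosedFieldType) (n : nat).
Implicit Types (h k p q u : 'rV[C]_n -> C) (v z : 'rV[C]_n).

Definition multi_index := {ffun 'I_n -> nat}.

Definition monomial (a : multi_index) z : C := \prod_i z 0 i ^+ a i.

(* Convergence along the filter of finite sets of multi-indices is
   unconditional, that is, absolute, convergence. *)
Definition has_pseries h z0 (c : multi_index -> C) : Prop :=
  \forall z \near z0,
    partial_sum (fun a => c a * monomial a (z - z0)) @ totally --> h z.

(* Holomorphy in several variables, as local expansion in convergent power
   series; at z0 = 0 this says that the germ of h lies in C{z_1, ..., z_n}. *)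
Definition holomorphic_at h z0 : Prop := exists c, has_pseries h z0 c.

Definition germ_eq h k : Prop := \forall z \near (0 : 'rV[C]_n), h z = k z.

Definition germ_unit u : Prop :=
  holomorphic_at u 0 /\
  exists2 q, holomorphic_at q 0 & germ_eq (fun z => u z * q z) (fun=> 1).

Definition germ_dvd p h : Prop :=
  exists2 q, holomorphic_at q 0 & germ_eq h (fun z => p z * q z).

Definition germ_irreducible p : Prop :=
  [/\ holomorphic_at p 0, ~ germ_eq p (fun=> 0), ~ germ_unit p &
      forall q u, holomorphic_at q 0 -> holomorphic_at u 0 ->
        germ_eq p (fun z => q z * u z) -> germ_unit q \/ germ_unit u].

Definition reduced_germ h : Prop :=
  [/\ holomorphic_at h 0, h 0 = 0, ~ germ_eq h (fun=> 0) &
      forall p, germ_irreducible p -> ~ germ_dvd (fun z => p z ^+ 2) h].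

Definition zero_locus h : set 'rV[C]_n := [set z | h z = 0].

Definition line z v : set 'rV[C]_n := [set z + t *: v | t in [set: C]].

Definition generic (P : set 'rV[C]_n) : Prop :=
  exists U : set 'rV[C]_n, [/\ open U, dense U & U `<=` P].

(* For a generic direction v, a small neighbourhood (of size e) of 0 is fixed
   first; the line of direction v through a generic point z, arbitrarily close
   to 0 with respect to e, then meets the zero locus in m points of that
   neighbourhood.  How small e and d must be depends on v. *)
Definition is_multiplicity h (m : nat) : Prop :=
  generic [set v | v != 0 ->
    exists2 e0 : C, 0 < e0 & forall e : C, 0 < e -> e <= e0 ->
      exists2 d : C, 0 < d &
        generic [set z | ball (0 : 'rV[C]_n) d z -> ~ line z v 0 ->
          (line z v `&` zero_locus h `&` ball (0 : 'rV[C]_n) e #= `I_m)%card]].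

(* The default value 0 is irrelevant for reduced germs with n >= 2, which have
   exactly one m such that is_multiplicity h m. *)
Definition multiplicity h : nat := xget 0%N [set m | is_multiplicity h m].

Definition homogeneous_part (c : multi_index -> C) (d : nat) v : C :=
  \sum_(a \in [set a : multi_index | (\sum_i a i)%N = d]) c a * monomial a v.

Definition tangent_cone h : set 'rV[C]_n :=
  [set v | exists2 c, has_pseries h 0 c &
                      homogeneous_part c (multiplicity h) v = 0].

Definition holomorphic_map (U : set 'rV[C]_n) (phi : 'rV[C]_n -> 'rV[C]_n) :=
  forall z, U z -> forall i, holomorphic_at (fun w => phi w 0 i) z.

(* phi : U -> W is a biholomorphism with inverse psi. *)
Definition biholomorphic (U W : set 'rV[C]_n)
    (phi psi : 'rV[C]_n -> 'rV[C]_n) : Prop :=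
  [/\ holomorphic_map U phi /\ holomorphic_map W psi,
      phi @` U `<=` W, psi @` W `<=` U,
      {in U, cancel phi psi} & {in W, cancel psi phi}].

Definition analytically_equivalent h k : Prop :=
  exists (phi psi : 'rV[C]_n -> 'rV[C]_n) (U W : set 'rV[C]_n),
    [/\ open_nbhs (0 : 'rV[C]_n) U, open_nbhs (0 : 'rV[C]_n) W,
        biholomorphic U W phi psi, phi 0 = 0 &
        phi @` (zero_locus k `&` U) = zero_locus h `&` W].

(* The function H on the open set O represents the germ h. *)
Definition representative h (H : 'rV[C]_n -> C) (O : set 'rV[C]_n) : Prop :=
  [/\ open_nbhs (0 : 'rV[C]_n) O,
      forall z, O z -> holomorphic_at H z & germ_eq H h].

(* The closed discs centred at 0 in the line L = line 0 v are the sets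
   closed_disc v r with 0 < r, and circle v r is the boundary in L. *)
Definition closed_disc v (r : C) : set 'rV[C]_n :=
  [set t *: v | t in [set t : C | `|t| <= r]].

Definition circle v (r : C) : set 'rV[C]_n :=
  [set t *: v | t in [set t : C | `|t| = r]].

(* (H, OH) and (K, OK) are representatives of h and k. *)
Definition good_disc h k (H : 'rV[C]_n -> C) (OH : set 'rV[C]_n)
    (K : 'rV[C]_n -> C) (OK : set 'rV[C]_n) v (r : C) : Prop :=
  [/\ v != 0, ~ (line 0 v `<=` tangent_cone h `|` tangent_cone k),
      0 < r, closed_disc v r `<=` OH `&` OK &
      forall s : C, 0 < s -> s <= r ->
        closed_disc v s `&` (zero_locus H `|` zero_locus K) = [set 0]].

(* k is a Rouche satellite of h. *)
Definition rouche_satellite h k : Prop :=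
  exists (H : 'rV[C]_n -> C) (OH : set 'rV[C]_n)
         (K : 'rV[C]_n -> C) (OK : set 'rV[C]_n) v (r : C),
    [/\ representative h H OH, representative k K OK,
        good_disc h k H OH K OK v r &
        forall z, circle v r z -> `|H z - K z| < `|H z|].

End Germs.

(* Main.v *)
(** Write [ord h] for the order of a germ [h] at [0].  For a reduced germ the
    multiplicity, defined by counting points of [h = 0] on a generic nearby line,
    equals [ord h].  Indeed, Weierstrass division (a Neumann series in a weighted
    l1 algebra of power series) turns [h] into a monic polynomial [P] of degree
    [ord h] in the direction of the line.  If the discriminant of [P] vanished
    identically, [gcd (P, P')] would yield a square [H ^ 2] dividing a multiple
    of [P], and removing denominators from [H] would give a square factor of [h];
    denominators are removed by the fact that a quotient of germs which is bounded
    near [0] is holomorphic.  So the discriminant is nonzero on a dense open set,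
    where [P] has [ord h] distinct roots.

    The multiplicity depends only on the zero locus, and the order is invariant
    under biholomorphisms because it measures the growth of [h] at [0], so the
    multiplicity is an analytic invariant.  If [k] is a Rouche satellite of [h],
    then [k / h] has positive real part on the circle; were the two orders on the
    line different, [k / h] or [h / k] would extend by [0] to the centre of the
    disc and its real part would have an interior minimum.  Conversely, if the
    orders agree, a multiple of [g] has the same leading term as [f] on a common
    line, hence is a Rouche satellite of [f]. *)
Require Import Defs.
From HB Require Import structures.
From mathcomp Require Import all_boot all_order all_algebra.
From mathcomp Require Import ring finmap separable.
From mathcomp.analysis.showcase Require Import summability.
From mathcomp Require Import all_classical all_reals all_analysis.
From mathcomp.real_closed Require Import complex.

Set Implicit Arguments.
Unset Strict Implicit.
Unset Printing Implicit Defensive.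

Import Order.TTheory GRing.Theory Num.Theory.
Import numFieldNormedType.Exports.

Local Open Scope classical_set_scope.
Local Open Scope ring_scope.

(** * Unconditional sums *)

#[local] Existing Instance totally_filter.

Section UnconditionalSums.
Variable C : numClosedFieldType.

(** Compactness of closed discs is the only analytic input, so no Cauchy integral, removable
    singularity theorem or argument principle is invoked. Their substitute is the norm
    [sum |c_a| rho^a] on a closed polydisc, which is submultiplicative and survives substitution,
    together with leading terms along lines. The order on the scalars is partial, so suprema are
    replaced by cluster points.

    The hard point is that a reduced germ has a discriminant that is not identically zero. The
    coefficients of the Weierstrass polynomial [P] are kept in a ring of series on one fixed
    polydisc, because there every point gives an evaluation morphism and resultants specialise to
    numerical ones. That ring is used only as an integral domain, so gcds exist up to constants and
    yield [c P = E H^2] where [c] may vanish on a hypersurface through 0. Such a [c] is cancelled by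
    bounded division: the roots of [P] tend to 0 with [z], hence factors of [P] are bounded, and a
    germ dominated by [b] near 0 is divisible by [b]. This plays the role of both Riemann extension
    and Gauss's lemma. *)

Definition sumto (I : choiceType) (x : I -> C) (s : C) : Prop :=
  forall e : C, 0 < e -> exists F0 : {fset I}, forall F : {fset I},
    (F0 `<=` F)%fset -> `|s - \sum_(i <- F) x i| < e.

(** The bound is kept explicit because it becomes the l1 norm that drives the Neumann series and the
    substitution of series. *)
Definition absb (I : choiceType) (x : I -> C) (M : C) : Prop :=
  forall F : {fset I}, \sum_(i <- F) `|x i| <= M.

Lemma sumtoP (I : choiceType) (x : I -> C) (s : C) :
  (partial_sum x @ totally --> s) <-> sumto x s.
Proof.
have E F : partial_sum x F = \sum_(i <- F) x i.
  by rewrite /partial_sum big_seq_fsetE.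
rewrite cvgrPdist_lt; split=> H e e0.
  have [F0 _ HF] := H e e0.
  by exists F0 => F F0F; rewrite -E; exact: HF.
have [F0 HF] := H e e0.
by exists F0 => // F /= F0F; rewrite E; exact: HF.
Qed.

Lemma eq_sumto (I : choiceType) (x y : I -> C) s :
  x =1 y -> sumto x s -> sumto y s.
Proof. by move=> /funext ->. Qed.

Lemma sumto_unique (I : choiceType) (x : I -> C) s t :
  sumto x s -> sumto x t -> s = t.
Proof.
move=> xs xt; apply/eqP; rewrite -subr_eq0 -normr_le0; apply/ler_addgt0Pr => e e0.
have e20 : 0 < e / 2 by rewrite divr_gt0.
have [F1 H1] := xs _ e20; have [F2 H2] := xt _ e20.
set F := (F1 `|` F2)%fset.
have -> : s - t = (s - \sum_(i <- F) x i) - (t - \sum_(i <- F) x i) by ring.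
rewrite add0r (splitr e) (le_trans (ler_normB _ _))// ltW// ltrD//.
- by rewrite H1// fsubsetUl.
- by rewrite H2// fsubsetUr.
Qed.

Lemma sumtoD (I : choiceType) (x y : I -> C) s t :
  sumto x s -> sumto y t -> sumto (fun i => x i + y i) (s + t).
Proof.
move=> xs yt e e0; have e20 : 0 < e / 2 by rewrite divr_gt0.
have [F1 H1] := xs _ e20; have [F2 H2] := yt _ e20.
exists (F1 `|` F2)%fset => F; rewrite fsubUset => /andP[F1F F2F].
rewrite big_split/= opprD addrACA (splitr e) (le_lt_trans (ler_normD _ _))//.
by rewrite ltrD// ?H1// H2.
Qed.

Lemma sumtoZ (I : choiceType) (x : I -> C) s c :
  sumto x s -> sumto (fun i => c * x i) (c * s).
Proof.
move=> xs e e0; have c0 : 0 < `|c| + 1 by rewrite ltr_wpDl.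
have [F1 H1] := xs _ (divr_gt0 e0 c0).
exists F1 => F /H1; rewrite -mulr_sumr -mulrBr normrM ltr_pdivlMr// => h.
by rewrite (le_lt_trans _ h)// mulrC ler_wpM2l// lerDl.
Qed.

Lemma sumto_finite (I : choiceType) (x : I -> C) (F : {fset I}) :
  (forall i, i \notin F -> x i = 0) -> sumto x (\sum_(i <- F) x i).
Proof.
move=> x0 e e0; exists F => G FG.
by rewrite (big_fset_incl _ FG) ?subrr ?normr0// => i _ /x0.
Qed.

Lemma sumto0 (I : choiceType) : sumto (fun _ : I => 0) 0.
Proof.
have := @sumto_finite I (fun=> 0) fset0 (fun _ _ => erefl).
by rewrite big_seq_fset0.
Qed.

Lemma sumto_single (I : choiceType) (x : I -> C) i0 :
  (forall i, i != i0 -> x i = 0) -> sumto x (x i0).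
Proof.
move=> x0; have := @sumto_finite I x [fset i0]%fset; rewrite big_seq_fset1.
by apply=> i; rewrite inE => /x0.
Qed.

Lemma sumto_sum (I : choiceType) (J : Type) (r : seq J) (x : J -> I -> C)
    (y : J -> C) :
  (forall j, sumto (x j) (y j)) ->
  sumto (fun i => \sum_(j <- r) x j i) (\sum_(j <- r) y j).
Proof.
move=> xy; elim: r => [|j r IH].
  by rewrite big_nil; apply: eq_sumto (sumto0 I) => i; rewrite big_nil.
rewrite big_cons; apply: eq_sumto (sumtoD (xy j) IH) => i.
by rewrite big_cons.
Qed.

Lemma absb_ge0 (I : choiceType) (x : I -> C) M : absb x M -> 0 <= M.
Proof. by move=> /(_ fset0); rewrite big_seq_fset0. Qed.

Lemma absb_le (I : choiceType) (x y : I -> C) M :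
  (forall i, `|y i| <= `|x i|) -> absb x M -> absb y M.
Proof. by move=> yx xM F; rewrite (le_trans _ (xM F))// ler_sum. Qed.

Lemma absb_leM (I : choiceType) (x : I -> C) M N :
  M <= N -> absb x M -> absb x N.
Proof. by move=> MN xM F; rewrite (le_trans (xM F)). Qed.

Lemma absbD (I : choiceType) (x y : I -> C) M N :
  absb x M -> absb y N -> absb (fun i => x i + y i) (M + N).
Proof.
move=> xM yN F; apply: le_trans (lerD (xM F) (yN F)).
by rewrite -big_split ler_sum// => i _; rewrite ler_normD.
Qed.

Lemma absbZ (I : choiceType) (x : I -> C) M c :
  absb x M -> absb (fun i => c * x i) (`|c| * M).
Proof.
move=> xM F; under eq_bigr do rewrite normrM.
by rewrite -mulr_sumr ler_wpM2l.
Qed.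

Lemma sumto_norm (I : choiceType) (x : I -> C) s M :
  absb x M -> sumto x s -> `|s| <= M.
Proof.
move=> xM xs; apply/ler_addgt0Pl => e e0; have [F /(_ F (fsubset_refl F)) H] := xs e e0.
rewrite -[s](subrK (\sum_(i <- F) x i)) (le_trans (ler_normD _ _))//.
by rewrite lerD ?(ltW H)// (le_trans (ler_norm_sum _ _ _)).
Qed.

Lemma sum_fset_split (I : choiceType) (x : I -> C) (F0 F : {fset I}) :
  (F0 `<=` F)%fset ->
  \sum_(i <- F) x i = \sum_(i <- F0) x i + \sum_(i <- F | i \notin F0) x i.
Proof.
move=> F0F; rewrite (bigID (mem F0))/=; congr (_ + _).
transitivity (\sum_(i <- F) x i * (i \in F0)%:R).
  by rewrite big_mkcond; apply: eq_bigr => i _; case: ifP => _; rewrite ?mulr1 ?mulr0.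
rewrite -(big_fset_incl _ F0F); last by move=> i _ /negbTE ->; rewrite mulr0.
by rewrite !big_seq; apply: eq_bigr => i ->; rewrite mulr1.
Qed.

Lemma absb_tail_norm (I : choiceType) (x : I -> C) (F0 F G : {fset I}) e :
  (forall F : {fset I}, \sum_(i <- F | i \notin F0) `|x i| <= e) ->
  (F0 `<=` F)%fset -> `|\sum_(i <- F) x i - \sum_(i <- F0) x i| <= e.
Proof.
move=> H F0F; rewrite (sum_fset_split _ F0F) addrC addKr.
exact: le_trans (ler_norm_sum _ _ _) (H F).
Qed.

End UnconditionalSums.

(* The only analytic property of the field of scalars that is used: completeness
   and the existence of minima both follow from it. *)
Definition disc_compact (C : numClosedFieldType) : Prop :=
  forall r : C, compact [set t : C | `|t| <= r].

(** * Completeness deduced from compact discs *)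

Section CompactSums.
Variable C : numClosedFieldType.
Hypothesis cptC : disc_compact C.

(** Compactness of the disc of radius [M] gives a cluster point, not yet a limit: above any [F0]
    some [F], but not every one, is close to [s]. *)
Lemma totally_cluster (I : choiceType) (u : {fset I} -> C) M :
  (forall F, `|u F| <= M) -> exists s, forall e, 0 < e -> forall F0 : {fset I},
    exists2 F : {fset I}, (F0 `<=` F)%fset & `|s - u F| < e.
Proof.
move=> uM; have [|s [_ cl]] := @cptC M (u @ @totally I).
- by apply: filterS (@filterT _ (@totally I) _) => F _ /=; exact: uM.
exists s => e e0 F0.
have [||t [[F F0F <-]]] := cl [set u F | F in [set F | (F0 `<=` F)%fset]] (ball s e).
- by exists F0 => // F /= F0F; exists F.
- exact: nbhsx_ballx.
by rewrite -ball_normE/= => h; exists F.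
Unshelve. all: by end_near. Qed.

(** The finite sums of norms increase, so their cluster point [m] acts as a supremum. A finite set
    whose sum is within [e / 2] of [m] leaves a tail of at most [e]. *)
Lemma absb_tail (I : choiceType) (x : I -> C) M : absb x M ->
  forall e, 0 < e -> exists F0 : {fset I}, forall F : {fset I},
    \sum_(i <- F | i \notin F0) `|x i| <= e.
Proof.
move=> xM e e0.
have [|m Hm] := @totally_cluster I (fun F => \sum_(i <- F) `|x i|) M.
  by move=> F; rewrite ger0_norm ?sumr_ge0.
have e20 : 0 < e / 2 by rewrite divr_gt0.
have [F0 _ H0] := Hm _ e20 fset0.
exists F0 => F; have [F' FF' H'] := Hm _ e20 (F0 `|` F)%fset.
move: FF'; rewrite fsubUset => /andP[F0F' FF'].
have ES := sum_fset_split (fun i => `|x i|) F0F'.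
have le1 : \sum_(i <- F | i \notin F0) `|x i| <= \sum_(i <- F' | i \notin F0) `|x i|.
  rewrite big_mkcond [leRHS]big_mkcond/= (sum_fset_split _ FF') lerDl sumr_ge0// => i _.
  by case: ifP.
apply: le_trans le1 _.
have -> : \sum_(i <- F' | i \notin F0) `|x i| =
   (m - \sum_(i <- F0) `|x i|) - (m - \sum_(i <- F') `|x i|).
  by rewrite ES; ring.
apply: le_trans (real_ler_norm _) _.
  rewrite ES (_ : _ - _ = \sum_(i <- F' | i \notin F0) `|x i|); last by ring.
  by rewrite ger0_real ?sumr_ge0.
by rewrite (le_trans (ler_normB _ _))// (splitr e) ltW// ltrD.
Qed.

Lemma sumto_exists (I : choiceType) (x : I -> C) M :
  absb x M -> exists s, sumto x s.
Proof.
move=> xM.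
have [|s Hs] := @totally_cluster I (fun F => \sum_(i <- F) x i) M.
  by move=> F; exact: le_trans (ler_norm_sum _ _ _) (xM F).
exists s => e e0; have e30 : 0 < e / 3 by rewrite divr_gt0.
have [F0 H0] := absb_tail xM e30; have [F1 F01 H1] := Hs _ e30 F0.
exists F0 => F F0F.
have -> : s - \sum_(i <- F) x i = (s - \sum_(i <- F1) x i)
   + (\sum_(i <- F1) x i - \sum_(i <- F0) x i)
   - (\sum_(i <- F) x i - \sum_(i <- F0) x i) by ring.
have -> : e = e / 3 + e / 3 + e / 3 by field.
rewrite (le_lt_trans (ler_normB _ _))// ltr_leD//; last exact: absb_tail_norm.
rewrite (le_lt_trans (ler_normD _ _))// ltr_leD//; exact: absb_tail_norm.
Qed.

Lemma sumto_absb (I : choiceType) (x : I -> C) s :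
  sumto x s -> exists M, absb x M.
Proof.
(* Convergence bounds the modulus of all finite sums; the absolute values are then
   summed separately over the terms with real (imaginary) part of a given sign. *)
move=> xs; have [F0 H0] := xs 1 ltr01.
pose K : C := `|s| + 1 + \sum_(i <- F0) `|x i|.
have HK (F : {fset I}) : `|\sum_(i <- F) x i| <= K.
  have -> : \sum_(i <- F) x i = s - (s - \sum_(i <- (F0 `|` F)%fset) x i)
      - \sum_(i <- (F0 `|` F)%fset | i \notin F) x i.
    by rewrite (sum_fset_split _ (fsubsetUr F0 F)); ring.
  rewrite (le_trans (ler_normB _ _))// lerD//.
    by rewrite (le_trans (ler_normB _ _))// lerD// ltW// H0// fsubsetUl.
  rewrite (le_trans (ler_norm_sum _ _ _))//.
  rewrite big_fset_condE/= -[leRHS]/(\sum_(i <- F0) `|x i|).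
  have sub : ([fset i in (F0 `|` F)%fset | i \notin F] `<=` F0)%fset.
    by apply/fsubsetP => i; rewrite !inE/= => /andP[/orP[//|->]].
  by rewrite (sum_fset_split _ sub) lerDl sumr_ge0.
have HR (f : C -> C) : (forall u v, f (u + v) = f u + f v) -> (forall u, `|f u| <= `|u|) ->
    (forall u, f u \is Num.real) ->
    forall F : {fset I}, \sum_(i <- F) `|f (x i)| <= K + K.
  move=> fD fN fR F; have f0 : f 0 = 0.
    by have := fD 0 0; rewrite addr0 => /eqP; rewrite -subr_eq0 opprD addNKr oppr_eq0 => /eqP.
  have fS G : \sum_(i <- G) f (x i) = f (\sum_(i <- G) x i).
    by elim/big_rec2: _ => [|i u v _ ->]; rewrite ?f0 ?fD.
  rewrite (big_fsetID _ (fun i => 0 <= f (x i)))/= lerD//.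
    rewrite (_ : \sum_(i <- _) _ = `|\sum_(i <- [fset i in F | 0 <= f (x i)]%fset) f (x i)|).
      by rewrite fS (le_trans (fN _)).
    rewrite ger0_norm; last by rewrite big_seq sumr_ge0// => i; rewrite !inE => /andP[].
    by rewrite !big_seq; apply: eq_bigr => i; rewrite !inE => /andP[_ h]; rewrite ger0_norm.
  rewrite (_ : \sum_(i <- _) _ = `|\sum_(i <- [fset i in F | ~~ (0 <= f (x i))]%fset) f (x i)|).
    by rewrite fS (le_trans (fN _)).
  have neg i : i \in [fset i in F | ~~ (0 <= f (x i))]%fset -> f (x i) <= 0.
    by rewrite !inE => /andP[_]; rewrite -real_ltNge ?real0// => /ltW.
  rewrite ler0_norm; last by rewrite big_seq sumr_le0.
  by rewrite -sumrN !big_seq; apply: eq_bigr => i /neg h; rewrite ler0_norm.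
exists ((K + K) + (K + K)) => F.
apply: le_trans (_ : \sum_(i <- F) (`|'Re (x i)| + `|'Im (x i)|) <= _).
  apply: ler_sum => i _; rewrite {1}[x i]Crect (le_trans (ler_normD _ _))//.
  by rewrite normrM normCi mul1r.
rewrite big_split lerD//.
- apply: (HR (fun z => 'Re z)) => [u v|u|u]; rewrite ?raddfD ?Creal_Re//.
  by rewrite leif_normC_Re_Creal.
- apply: (HR (fun z => 'Im z)) => [u v|u|u]; rewrite ?raddfD ?Creal_Im//.
  by rewrite -(@ler_pXn2r _ 2)// ?nnegrE// [leRHS]normC2_Re_Im real_normK ?Creal_Im// lerDr
    real_exprn_even_ge0// Creal_Re.
Qed.

End CompactSums.

#[local] Existing Instance totally_filter.

(** * Rearrangement of absolutely summable families *)

Section Fubini.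
Variable C : numClosedFieldType.
Hypothesis cptC : disc_compact C.

(** Reindexing, rows and columns, Cauchy products and grouping by degree are all obtained from this
    by a suitable map [p]. *)
Lemma sumto_fibers (I J : choiceType) (x : I -> C) (p : I -> J) (y : J -> C) s M :
  absb x M -> (forall j, sumto (fun i => if p i == j then x i else 0) (y j)) ->
  sumto x s -> sumto y s.
Proof.
move=> xM xy xs e e0.
have e20 : 0 < e / 2 by rewrite divr_gt0.
have e40 : 0 < e / 4 by rewrite divr_gt0.
have [F0 H0] := absb_tail cptC xM e20.
(* Once [G] contains the images of [F0], the indices of [F] whose image misses [G] lie outside [F0]
   and contribute at most [e / 2]. *)
exists [fset p i | i in F0]%fset => G G0G.
have [F1 H1] := xs _ e40.
have [F2 H2] := sumto_sum G xy e40.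
set F := (F0 `|` (F1 `|` F2))%fset.
have -> : s - \sum_(j <- G) y j = (s - \sum_(i <- F) x i)
    - (\sum_(j <- G) y j - \sum_(i <- F) \sum_(j <- G) (if p i == j then x i else 0))
    + \sum_(i <- F) (x i - \sum_(j <- G) (if p i == j then x i else 0)).
  by rewrite sumrB; ring.
have -> : e = e / 4 + e / 4 + e / 2 by field.
rewrite (le_lt_trans (ler_normD _ _))// ltr_leD//.
  rewrite (le_lt_trans (ler_normB _ _))// ltrD//.
  - by rewrite H1// /F fsetUCA fsubsetUl.
  - by rewrite H2// /F fsetUA fsubsetUr.
apply: le_trans (ler_norm_sum _ _ _) _; apply: le_trans (H0 F).
rewrite [leRHS]big_mkcond/=; apply: ler_sum => i _.
have E : \sum_(j <- G) (if p i == j then x i else 0) = if p i \in G then x i else 0.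
  case: ifP => [iG|/negbT iG].
    rewrite (big_fsetD1 _ iG)/= eqxx big1_seq ?addr0// => j.
    by rewrite !inE eq_sym => /andP[_ /andP[/negbTE ->]].
  rewrite big1_seq// => j /andP[_ jG]; case: eqP => // pj.
  by rewrite pj jG in iG.
rewrite E; case: ifP => pG; case: ifP => //= iF; rewrite ?subrr ?subr0 ?normr0//.
move/negbT: pG; rewrite (fsubsetP G0G)//; apply/imfsetP; exists i => //=.
by move/negbFE: iF.
Qed.

(** Rotating each fibre sum by a number [u j] of modulus 1 turns the sum of their norms into the sum
    of one family dominated by [x]. *)
Lemma absb_fibers (I J : choiceType) (x : I -> C) (p : I -> J) (y : J -> C) M :
  absb x M -> (forall j, sumto (fun i => if p i == j then x i else 0) (y j)) ->
  absb y M.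
Proof.
move=> xM xy G.
pose u j := if y j == 0 then 1 else `|y j| / y j.
have uN j : `|u j| = 1.
  by rewrite /u; case: eqP => [_|/eqP y0]; rewrite ?normr1// normrM normfV normr_id divff ?normr_eq0.
have uy j : `|y j| = u j * y j.
  by rewrite /u; case: eqP => [->|/eqP y0]; rewrite ?normr0 ?mulr0// divfK.
have H := sumto_sum G (fun j => sumtoZ (u j) (xy j)).
have -> : \sum_(j <- G) `|y j| = `|\sum_(j <- G) u j * y j|.
  rewrite ger0_norm; last by rewrite sumr_ge0// => j _; rewrite -uy.
  by apply: eq_bigr => j _.
apply: sumto_norm H; apply: absb_le xM => i.
case: (boolP (p i \in G)) => iG.
  rewrite (big_fsetD1 _ iG)/= eqxx big1_seq ?addr0 ?normrM ?uN ?mul1r// => j.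
  by rewrite !inE eq_sym => /andP[_ /andP[/negbTE ->]]; rewrite mulr0.
rewrite big1_seq ?normr0// => j /andP[_ jG]; case: eqP => [pj|]; rewrite ?mulr0//.
by rewrite pj jG in iG.
Qed.

Lemma fiber_inj (I J : choiceType) (x : I -> C) (g : J -> I) :
  injective g -> (forall i, (forall j, g j != i) -> x i = 0) ->
  forall i, sumto (fun j => if g j == i then x (g j) else 0) (x i).
Proof.
move=> ginj x0 i; case: (pselect (exists j, g j = i)) => [[j <-]|nj].
  have := @sumto_single _ _ (fun k => if g k == g j then x (g k) else 0) j.
  rewrite eqxx; apply => k kj; rewrite ifN//; apply: contra kj => /eqP/ginj ->.
  exact: eqxx.
have H j : g j != i by apply/eqP => gj; apply: nj; exists j.
by rewrite (x0 _ H); apply: (eq_sumto _ (@sumto0 C J)) => j; rewrite (negbTE (H j)).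
Qed.

Lemma sumto_inj (I J : choiceType) (x : I -> C) (g : J -> I) s M :
  injective g -> (forall i, (forall j, g j != i) -> x i = 0) ->
  absb (x \o g) M -> sumto (x \o g) s -> sumto x s.
Proof. by move=> gi x0 xM; apply: sumto_fibers xM _; exact: fiber_inj. Qed.

Lemma absb_comp_inj (I J : choiceType) (x : I -> C) (g : J -> I) M :
  injective g -> absb x M -> absb (x \o g) M.
Proof.
move=> gi xM F; have := xM [fset g j | j in F]%fset.
by rewrite big_imfset//= => i j _ _ /gi.
Qed.

Lemma absb_pair (I J : choiceType) (x : I * J -> C) (r : I -> C) M :
  (forall i, absb (fun j => x (i, j)) (r i)) -> absb r M -> absb x M.
Proof.
move=> xr rM F; rewrite (partition_big_imfset _ fst).
apply: le_trans (rM [fset u.1 | u in F]%fset).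
apply: ler_sum => i _; rewrite ger0_norm ?(absb_ge0 (xr i))//.
rewrite big_fset_condE/=; set G := [fset u in F | u.1 == i]%fset.
have := xr i [fset u.2 | u in G]%fset; rewrite big_imfset/=; last first.
  by move=> [a b] [a' b']; rewrite !inE/= => /andP[_ /eqP ->] /andP[_ /eqP ->] ->.
apply: le_trans; rewrite !big_seq; apply: ler_sum => -[a b].
by rewrite !inE/= => /andP[_ /eqP ->].
Qed.

Lemma sumto_rows (I J : choiceType) (x : I * J -> C) (y : I -> C) s M :
  absb x M -> (forall i, sumto (fun j => x (i, j)) (y i)) ->
  sumto x s -> sumto y s.
Proof.
move=> xM xy; apply: (@sumto_fibers _ _ x fst y s M xM) => i.
apply: (@sumto_inj _ _ _ (fun j => (i, j))) _ _ => //.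
- by move=> j k [].
- by move=> [a b]; case: eqP => //= -> /(_ b); rewrite eqxx.
- by move: xM => /(@absb_comp_inj _ _ _ (fun j => (i, j))) H; rewrite /comp/= eqxx; apply: H => j k [].
- by rewrite /comp/= eqxx.
Qed.

Lemma sumto_cols (I J : choiceType) (x : I * J -> C) (y : J -> C) s M :
  absb x M -> (forall j, sumto (fun i => x (i, j)) (y j)) ->
  sumto x s -> sumto y s.
Proof.
move=> xM xy; apply: (@sumto_fibers _ _ x snd y s M xM) => j.
apply: (@sumto_inj _ _ _ (fun i => (i, j))) _ _ => //.
- by move=> i k [].
- by move=> [a b]; case: eqP => //= -> /(_ a); rewrite eqxx.
- by move: xM => /(@absb_comp_inj _ _ _ (fun i => (i, j))) H; rewrite /comp/= eqxx; apply: H => i k [].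
- by rewrite /comp/= eqxx.
Qed.

Lemma sumto_pairM (I J : choiceType) (x : I -> C) (y : J -> C) s t M N :
  absb x M -> absb y N -> sumto x s -> sumto y t ->
  absb (fun u => x u.1 * y u.2) (M * N) /\ sumto (fun u => x u.1 * y u.2) (s * t).
Proof.
move=> xM yN xs yt.
have B : absb (fun u => x u.1 * y u.2) (M * N).
  apply: (@absb_pair _ _ _ (fun i => `|x i| * N)); first by move=> i /=; exact: absbZ.
  move=> F; under eq_bigr do rewrite normrM normr_id (ger0_norm (absb_ge0 yN)).
  by rewrite -mulr_suml ler_wpM2r ?(absb_ge0 yN).
split=> //; have [S HS] := sumto_exists cptC B.
suff <- : S = s * t by [].
apply: sumto_unique (sumto_rows B (fun i => sumtoZ (x i) yt) HS) _.
rewrite mulrC; apply: eq_sumto (sumtoZ t xs) => i; exact: mulrC.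
Qed.

Lemma absb_cols (I J : choiceType) (x : I * J -> C) (y : J -> C) M :
  absb x M -> (forall j, sumto (fun i => x (i, j)) (y j)) -> absb y M.
Proof.
move=> xM xy; apply: (@absb_fibers _ _ x snd y M xM) => j.
apply: (@sumto_inj _ _ _ (fun i => (i, j))) _ _ => //.
- by move=> i k [].
- by move=> [a b]; case: eqP => //= -> /(_ a); rewrite eqxx.
- by move: xM => /(@absb_comp_inj _ _ _ (fun i => (i, j))) H; rewrite /comp/= eqxx; apply: H => i k [].
- by rewrite /comp/= eqxx.
Qed.

End Fubini.

(** * Absolutely convergent power series *)

#[local] Existing Instance totally_filter.

Section MultiIndex.
Variables (C : numClosedFieldType) (n : nat).
Implicit Types (a b : multi_index n) (z : 'rV[C]_n).

Definition madd a b : multi_index n := [ffun i => (a i + b i)%N].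
Definition msub a b : multi_index n := [ffun i => (a i - b i)%N].
Definition mdeg a : nat := (\sum_i a i)%N.
Definition msing (j : 'I_n) (k : nat) : multi_index n :=
  [ffun i => if i == j then k else 0%N].
Definition mle a b : bool := [forall i, a i <= b i]%N.

Definition mbelow a : {fset multi_index n} :=
  seq_fset tt [seq b <- [seq ([ffun i => nat_of_ord (u i)] : multi_index n) |
     u : {ffun 'I_n -> 'I_(mdeg a).+1}] | mle b a].

Lemma leq_mdeg a i : (a i <= mdeg a)%N.
Proof. by rewrite /mdeg (bigD1 i)//= leq_addr. Qed.

Lemma in_mbelow a b : (b \in mbelow a) = mle b a.
Proof.
rewrite seq_fsetE mem_filter; case: (boolP (mle b a)) => ba //=.
apply/mapP; exists [ffun i => inord (b i)]; first by rewrite mem_enum.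
apply/ffunP => i; rewrite !ffunE inordK// ltnS.
by move/forallP: ba => /(_ i) h; rewrite (leq_trans h)// leq_mdeg.
Qed.

Lemma maddBr a b : mle b a -> madd b (msub a b) = a.
Proof. by move=> /forallP ba; apply/ffunP => i; rewrite !ffunE subnKC. Qed.

Lemma msubDl a b : msub (madd a b) a = b.
Proof. by apply/ffunP => i; rewrite !ffunE addKn. Qed.

Lemma mle_addr a b : mle a (madd a b).
Proof. by apply/forallP => i; rewrite ffunE leq_addr. Qed.

Lemma mdeg_sing j k : mdeg (msing j k) = k.
Proof.
rewrite /mdeg (bigD1 j)//= ffunE eqxx big1 ?addn0// => i ij.
by rewrite ffunE (negbTE ij).
Qed.

Lemma mdeg_eq0 a i : mdeg a = 0%N -> a i = 0%N.
Proof. by move=> a0; apply/eqP; rewrite -leqn0 -a0 leq_mdeg. Qed.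

Lemma monomialD a b z : monomial (madd a b) z = monomial a z * monomial b z.
Proof. by rewrite /monomial -big_split; apply: eq_bigr => i _; rewrite ffunE exprD. Qed.

Lemma monomial_sing j k z : monomial (msing j k) z = z 0 j ^+ k.
Proof.
rewrite /monomial (bigD1 j)//= ffunE eqxx big1 ?mulr1// => i ij.
by rewrite ffunE (negbTE ij) expr0.
Qed.

Lemma monomial_scale a (t : C) z : monomial a (t *: z) = t ^+ mdeg a * monomial a z.
Proof.
rewrite /monomial /mdeg -prodrXr -big_split; apply: eq_bigr => i _.
by rewrite mxE exprMn.
Qed.

(** The closed polydisc. Its polyradius is itself a vector, so that [monomial a rho] is the weight
    of the index [a]. *)
Definition pd (rho z : 'rV[C]_n) : Prop := forall i, `|z 0 i| <= rho 0 i.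
Definition pos (rho : 'rV[C]_n) : Prop := forall i, 0 < rho 0 i.

Lemma pos_pd rho : pos rho -> pd rho rho.
Proof. by move=> h i; rewrite gtr0_norm. Qed.

Lemma pos_pd0 rho : pos rho -> pd rho 0.
Proof. by move=> h i; rewrite mxE normr0 ltW. Qed.

Lemma pd_trans z u v : pd u z -> pd v u -> pd v z.
Proof. by move=> uz vu i; apply: le_trans (uz i) (le_trans (real_ler_norm (ger0_real (le_trans (normr_ge0 _) (uz i)))) (vu i)). Qed.

Lemma monomial_norm a rho z : pd rho z -> `|monomial a z| <= monomial a rho.
Proof.
move=> h; rewrite /monomial normr_prod; apply: ler_prod => i _.
by rewrite normr_ge0 normrX lerXn2r ?nnegrE// (le_trans _ (h i)).
Qed.

Lemma monomial_ge0 a rho z : pd rho z -> 0 <= monomial a rho.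
Proof. by move=> h; exact: le_trans (normr_ge0 _) (monomial_norm a h). Qed.

Lemma monomial_gt0 a rho : pos rho -> 0 < monomial a rho.
Proof. by move=> h; rewrite /monomial prodr_gt0// => i _; rewrite exprn_gt0. Qed.

(** Membership in the weighted l1 algebra of the polydisc, with norm at most [M]. This norm
    dominates the sup norm there; [f] is free outside the polydisc. *)
Definition ser (rho : 'rV[C]_n) (c : multi_index n -> C) (M : C) (f : 'rV[C]_n -> C) : Prop :=
  absb (fun a => c a * monomial a rho) M /\
  forall z, pd rho z -> sumto (fun a => c a * monomial a z) (f z).

Lemma ser_ext rho c M f g : (forall z, pd rho z -> f z = g z) ->
  ser rho c M f -> ser rho c M g.
Proof. by move=> fg [cM cf]; split=> // z zr; rewrite -fg//; exact: cf. Qed.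

Lemma ser_absb rho z c M : pd rho z -> absb (fun a => c a * monomial a rho) M ->
  absb (fun a => c a * monomial a z) M.
Proof.
move=> rz; apply: absb_le => a; rewrite !normrM ler_wpM2l//.
by rewrite [leRHS]ger0_norm ?(monomial_ge0 _ rz)// monomial_norm.
Qed.

Lemma ser_norm rho c M f z : pd rho z -> ser rho c M f -> `|f z| <= M.
Proof. by move=> rz [cM /(_ _ rz)]; apply: sumto_norm; exact: ser_absb rz _. Qed.

Lemma ser_shrink rho rho' c M f : pd rho rho' -> ser rho c M f -> ser rho' c M f.
Proof.
move=> rr [cM cf]; split; first exact: ser_absb cM.
by move=> z zr; apply: cf; exact: pd_trans rr.
Qed.

Lemma serD rho c M f d N g : ser rho c M f -> ser rho d N g ->
  ser rho (fun a => c a + d a) (M + N) (fun z => f z + g z).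
Proof.
move=> [cM cf] [dN dg]; split.
  by apply: absb_le (absbD cM dN) => a; rewrite mulrDl.
by move=> z zr; apply: eq_sumto (sumtoD (cf _ zr) (dg _ zr)) => a; rewrite mulrDl.
Qed.

Lemma serZ rho c M f k : ser rho c M f ->
  ser rho (fun a => k * c a) (`|k| * M) (fun z => k * f z).
Proof.
move=> [cM cf]; split.
  by apply: absb_le (absbZ k cM) => a; rewrite mulrA.
by move=> z zr; apply: eq_sumto (sumtoZ k (cf _ zr)) => a; rewrite mulrA.
Qed.

Lemma absb_single (I : choiceType) (x : I -> C) i0 :
  (forall i, i != i0 -> x i = 0) -> absb x `|x i0|.
Proof.
move=> x0 F; case: (boolP (i0 \in F)) => iF.
  rewrite (big_fsetD1 _ iF)/= big1_seq ?addr0// => i.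
  by rewrite !inE => /andP[_ /andP[/x0 ->]]; rewrite normr0.
rewrite big1_seq// => i /andP[_ Fi]; rewrite x0 ?normr0//.
by apply: contraNneq iF => <-.
Qed.

Lemma ser_monomial rho k b : pd rho rho ->
  ser rho (fun a => if a == b then k else 0) (`|k| * monomial b rho)
    (fun z => k * monomial b z).
Proof.
move=> rr; split.
  have := @absb_single _ (fun a => (if a == b then k else 0) * monomial a rho) b.
  rewrite eqxx normrM (ger0_norm (monomial_ge0 _ rr)); apply => a /negbTE ->.
  by rewrite mul0r.
move=> z zr; have := @sumto_single _ _ (fun a => (if a == b then k else 0) * monomial a z) b.
by rewrite eqxx; apply => a /negbTE ->; rewrite mul0r.
Qed.

Definition mconv (c d : multi_index n -> C) a : C :=
  \sum_(b <- mbelow a) c b * d (msub a b).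

Lemma mconv_fiber (x y : multi_index n -> C) a :
  sumto (fun u => if madd u.1 u.2 == a then x u.1 * y u.2 else 0) (mconv x y a).
Proof.
pose g b := (b, msub a b).
have gi : {in mbelow a &, injective g} by move=> b b' _ _ [].
have := @sumto_finite _ _ (fun u => if madd u.1 u.2 == a then x u.1 * y u.2 else 0)
  [fset g b | b in mbelow a]%fset.
rewrite big_imfset//= (_ : \sum_(i <- _) _ = mconv x y a); last first.
  rewrite /mconv !big_seq; apply: eq_bigr => b; rewrite in_mbelow => ba.
  by rewrite maddBr// eqxx.
apply=> -[b b'] /=; case: eqP => // ab /imfsetP[]; exists b => /=.
  by rewrite -ab in_mbelow mle_addr.
by rewrite /g -ab msubDl.
Qed.

End MultiIndex.

Section Series.
Variable C : numClosedFieldType.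
Hypothesis cptC : disc_compact C.

Lemma mconv_weight n (c d : multi_index n -> C) (z : 'rV[C]_n) a :
  mconv (fun a => c a * monomial a z) (fun a => d a * monomial a z) a =
  mconv c d a * monomial a z.
Proof.
rewrite /mconv mulr_suml !big_seq; apply: eq_bigr => b; rewrite in_mbelow => ba.
by rewrite -[in monomial a z](maddBr ba) monomialD; ring.
Qed.

Lemma mconv_absb n (rho : 'rV[C]_n) c d M N :
  absb (fun a => c a * monomial a rho) M -> absb (fun a => d a * monomial a rho) N ->
  absb (fun a => mconv c d a * monomial a rho) (M * N).
Proof.
move=> cM dN.
have [s cs] := sumto_exists cptC cM; have [t dt] := sumto_exists cptC dN.
have [B _] := sumto_pairM cptC cM dN cs dt.
apply: absb_le (absb_fibers B (fun a => @mconv_fiber _ _ (fun a => c a * monomial a rho) (fun a => d a * monomial a rho) a)) => a.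
by rewrite mconv_weight.
Qed.

Lemma serM n (rho : 'rV[C]_n) c M f d N g : ser rho c M f -> ser rho d N g ->
  ser rho (mconv c d) (M * N) (fun z => f z * g z).
Proof.
move=> [cM cf] [dN dg]; split; first exact: mconv_absb.
move=> z zr.
have [B S] := sumto_pairM cptC (ser_absb zr cM) (ser_absb zr dN) (cf _ zr) (dg _ zr).
have := sumto_fibers cptC B (fun a => @mconv_fiber _ _ (fun a => c a * monomial a z) (fun a => d a * monomial a z) a) S.
by apply: eq_sumto => a; rewrite mconv_weight.
Qed.

Lemma ser_exists n (rho : 'rV[C]_n) c M :
  absb (fun a => c a * monomial a rho) M -> exists f, ser rho c M f.
Proof.
move=> cM.
have H z : exists s, pd rho z -> sumto (fun a => c a * monomial a z) s.
  case: (pselect (pd rho z)) => [rz|nz]; last by exists 0 => /nz.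
  by have [s cs] := sumto_exists cptC (ser_absb rz cM); exists s.
by have [f Hf] := choice H; exists f; split.
Qed.

Lemma ser_monomial_comp n m (rho : 'rV[C]_n) (sigma : 'rV[C]_m)
    (phi : 'rV[C]_n -> 'rV[C]_m) a : pd rho rho ->
  (forall i, exists d, ser rho d (sigma 0 i) (fun z => phi z 0 i)) ->
  exists e, ser rho e (monomial a sigma) (fun z => monomial a (phi z)).
Proof.
move=> rr phis.
have one : exists e, ser rho e 1 (fun=> 1).
  have b0 (z : 'rV[C]_n) : monomial [ffun=> 0%N] z = 1.
    by rewrite /monomial big1// => i _; rewrite ffunE.
  exists (fun b => if b == [ffun=> 0%N] then 1 else 0).
  have := ser_monomial 1 [ffun=> 0%N] rr; rewrite b0 normr1 mulr1.
  by apply: ser_ext => z _; rewrite b0 mulr1.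
have pow i k : exists e, ser rho e (sigma 0 i ^+ k) (fun z => phi z 0 i ^+ k).
  elim: k => [|k [e IH]]; first exact: one.
  have [d dP] := phis i; exists (mconv d e).
  by have := serM dP IH; rewrite -exprS; apply: ser_ext => z _; rewrite exprS.
rewrite /monomial; elim: (index_enum _) => [|i r [e IH]].
  have [e eP] := one; exists e; rewrite big_nil.
  by apply: ser_ext eP => z _; rewrite big_nil.
have [d dP] := pow i (a i); exists (mconv d e); rewrite big_cons.
by apply: ser_ext (serM dP IH) => z _; rewrite big_cons.
Qed.

(** Each monomial in the components of [phi] has norm at most [monomial a sigma], so the double
    family [x] is absolutely summable with the same bound [M]. Its rows sum to the composite and its
    columns give the new coefficients. *)
Lemma ser_comp n m (rho : 'rV[C]_n) (sigma : 'rV[C]_m) c M f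
    (phi : 'rV[C]_n -> 'rV[C]_m) : pos rho ->
  ser sigma c M f ->
  (forall i, exists d, ser rho d (sigma 0 i) (fun z => phi z 0 i)) ->
  exists e, ser rho e M (f \o phi).
Proof.
move=> r0 [cM cf] phis; have rr := pos_pd r0.
have pdphi z : pd rho z -> pd sigma (phi z).
  by move=> rz i; have [d] := phis i; exact: ser_norm.
have sigma0 a : 0 <= monomial a sigma.
  by apply: (@monomial_ge0 _ _ a sigma (phi 0)); apply: pdphi; exact: pos_pd0.
have [E EP] := choice (fun a => ser_monomial_comp a rr phis).
pose x z (u : multi_index m * multi_index n) := c u.1 * (E u.1 u.2 * monomial u.2 z).
have xB z : pd rho z -> absb (x z) M.
  move=> rz; apply: (@absb_pair _ _ _ _ (fun a => `|c a| * monomial a sigma)).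
    by move=> a; rewrite /x/=; apply: absbZ; have [] := EP a; move=> + _; exact: ser_absb.
  apply: absb_le cM => a; rewrite !normrM normr_id//.
have Hex b : exists s, sumto (fun a => x rho (a, b)) s.
  apply: (@sumto_exists _ cptC _ _ M).
  apply: (@absb_comp_inj _ _ _ (x rho) (fun a => (a, b))) (xB _ rr).
  by move=> a a' [].
have [y Hy] := choice Hex.
have w0 b : monomial b rho != 0 by rewrite gt_eqF ?monomial_gt0.
(* Column sums are taken at the corner [rho], where no monomial vanishes; other points follow by
   rescaling. *)
exists (fun b => y b / monomial b rho); split.
  apply: absb_le (absb_cols cptC (xB _ rr) Hy) => b; by rewrite divfK.
move=> z rz; have [S HS] := sumto_exists cptC (xB _ rz).
have S1 : sumto (fun a => c a * monomial a (phi z)) S.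
  apply: (sumto_rows cptC (xB _ rz) _ HS) => a; apply: sumtoZ.
  by have [_] := EP a; apply.
rewrite /= (sumto_unique (cf _ (pdphi _ rz)) S1).
apply: (sumto_cols cptC (xB _ rz) _ HS) => b.
have := sumtoZ (monomial b z / monomial b rho) (Hy b).
rewrite (_ : _ * y b = y b / monomial b rho * monomial b z); last by ring.
apply: eq_sumto => a; rewrite /x/=; field; exact: w0.
Qed.

End Series.

(** * Holomorphic germs *)

#[local] Existing Instance totally_filter.

Section Neighbourhoods.
Variable C : numClosedFieldType.

(** The inverse of [r^-1 + s^-1] lies below both numbers without a case distinction on a partial
    order. *)
Lemma pos_min (r s : C) : 0 < r -> 0 < s -> exists t : C, [/\ 0 < t, t <= r & t <= s].
Proof.
move=> r0 s0; exists (r^-1 + s^-1)^-1.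
have p : 0 < r^-1 + s^-1 by rewrite addr_gt0 ?invr_gt0.
split; first by rewrite invr_gt0.
- by rewrite -[leRHS]invrK lef_pV2 ?posrE ?invr_gt0// lerDl invr_ge0 ltW.
- by rewrite -[leRHS]invrK lef_pV2 ?posrE ?invr_gt0// lerDr invr_ge0 ltW.
Qed.

Lemma pos_lower n (rho : 'rV[C]_n) : pos rho ->
  exists r : C, 0 < r /\ forall i, r <= rho 0 i.
Proof.
move=> h; exists (1 + \sum_i (rho 0 i)^-1)^-1.
have p : 0 < 1 + \sum_i (rho 0 i)^-1.
  by rewrite ltr_pwDl// sumr_ge0// => i _; rewrite invr_ge0 ltW.
split=> [|i]; first by rewrite invr_gt0.
rewrite -[leRHS]invrK lef_pV2 ?posrE ?invr_gt0// (bigD1 i)//= addrCA lerDl.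
by rewrite addr_ge0// sumr_ge0// => j _; rewrite invr_ge0 ltW.
Qed.

Definition cvec n (r : C) : 'rV[C]_n := const_mx r.

Lemma pos_cst n r : 0 < r -> pos (cvec n r).
Proof. by move=> r0 i; rewrite mxE. Qed.

Lemma pd_cst_le n r s : 0 <= s -> s <= r -> pd (cvec n r) (cvec n s).
Proof. by move=> s0 sr i; rewrite !mxE ger0_norm. Qed.

Lemma pd_le n (r s : C) (z : 'rV[C]_n) : s <= r -> pd (cvec n s) z -> pd (cvec n r) z.
Proof. by move=> sr h i; move: (h i); rewrite !mxE => /le_trans; apply. Qed.

Lemma pd_cst0 n r : 0 <= r -> pd (cvec n r) 0.
Proof. by move=> r0 i; rewrite !mxE normr0. Qed.

Lemma monomial_cst n (a : multi_index n) (r : C) : monomial a (cvec n r) = r ^+ mdeg a.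
Proof.
by rewrite /monomial /mdeg -prodrXr; apply: eq_bigr => i _; rewrite mxE.
Qed.

Lemma ball_pdP n (z w : 'rV[C]_n) (e : C) : 0 < e ->
  ball z e w <-> forall i, `|w 0 i - z 0 i| < e.
Proof.
move=> e0; split.
  by move=> [_ h] i; have := h 0 i; rewrite -ball_normE/= distrC.
move=> h; split=> // i j; rewrite ord1 -ball_normE/= distrC; exact: h.
Qed.

Lemma pd_ball n (z w : 'rV[C]_n) (r e : C) : 0 < r -> r < e ->
  pd (cvec n r) (w - z) -> ball z e w.
Proof.
move=> r0 re h; apply/ball_pdP; first exact: lt_trans re.
by move=> i; have := h i; rewrite !mxE => /le_lt_trans; apply.
Qed.

Lemma ball_pd n (z w : 'rV[C]_n) (e : C) : 0 < e -> ball z e w -> pd (cvec n e) (w - z).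
Proof. by move=> e0 /(ball_pdP _ _ e0) h i; rewrite !mxE ltW. Qed.

Lemma nbhs_pdP n (z0 : 'rV[C]_n) (P : set 'rV[C]_n) :
  nbhs z0 P <-> exists2 r : C, 0 < r & forall z, pd (cvec n r) z -> P (z0 + z).
Proof.
split.
  move=> /nbhs_ballP[e /= e0 H]; exists (e / 2); first by rewrite divr_gt0.
  move=> z zr; apply: H; apply: (@pd_ball _ _ _ (e / 2)).
  - by rewrite divr_gt0.
  - by rewrite ltr_pdivrMr// ltr_pMr// ltr1n.
  - by rewrite addrC addKr.
move=> [r r0 H]; apply/nbhs_ballP; exists r => //= z /(ball_pd r0) zr.
by rewrite -(subrKC z0 z); exact: H.
Qed.

End Neighbourhoods.

Arguments pos_cst {C} n {r} _ _.
Arguments pd_cst_le {C} n {r s} _ _ _.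

(** * Algebra, substitution and continuity of holomorphic functions *)

Section Holomorphic.
Variable C : numClosedFieldType.
Hypothesis cptC : disc_compact C.

(** Convergence at the corner [(r, ..., r)] is already absolute by [sumto_absb], and this one bound
    serves the whole polydisc. *)
Lemma has_pseriesP n (h : 'rV[C]_n -> C) z0 c :
  has_pseries h z0 c <->
  exists r M, 0 < r /\ ser (cvec n r) c M (fun z => h (z0 + z)).
Proof.
rewrite /has_pseries; split=> [/nbhs_pdP[r r0 H]|[r [M [r0 [cM cf]]]]].
  have H' z : pd (cvec n r) z -> sumto (fun a => c a * monomial a z) (h (z0 + z)).
    by move=> /H/sumtoP; rewrite (addrC z0) addrK.
  have [M MP] := sumto_absb (H' _ (pos_pd (pos_cst n r0))).
  by exists r, M; split.
apply/nbhs_pdP; exists r => // z zr; apply/sumtoP; rewrite (addrC z0) addrK addrC.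
exact: cf.
Qed.

(** A Schwarz-type estimate: every surviving term has degree at least [m], so it shrinks by at least
    [(s / r) ^ m]. *)
Lemma ser_scale n (r s : C) m c M f : 0 < s -> s <= r ->
  (forall a : multi_index n, (mdeg a < m)%N -> c a = 0) ->
  ser (cvec n r) c M f -> ser (cvec n s) c ((s / r) ^+ m * M) f.
Proof.
move=> s0 sr c0 cf; have r0 := lt_le_trans s0 sr.
have [_ fs] := ser_shrink (pd_cst_le n (ltW s0) sr) cf.
split=> //; have sr1 : s / r <= 1 by rewrite ler_pdivrMr// mul1r.
have sr0 : 0 <= s / r by rewrite divr_ge0// ltW.
have := absbZ ((s / r) ^+ m) cf.1; rewrite ger0_norm ?exprn_ge0//.
apply: absb_le => a; rewrite !monomial_cst.
case: (ltnP (mdeg a) m) => [/c0 ->|ma]; first by rewrite !mul0r mulr0 normr0.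
have -> : c a * s ^+ mdeg a = (s / r) ^+ (mdeg a) * (c a * r ^+ mdeg a).
  by rewrite expr_div_n; field; rewrite expf_neq0// gt_eqF.
rewrite normrM [leRHS]normrM ler_wpM2r// !normrX (ger0_norm sr0).
exact: ler_wiXn2l.
Qed.

Lemma ser_coef0 n (rho : 'rV[C]_n) c M f : pos rho -> ser rho c M f ->
  f 0 = c [ffun=> 0%N].
Proof.
move=> r0 [_ /(_ 0 (pos_pd0 r0)) H]; apply: sumto_unique H _.
have := @sumto_single _ _ (fun a : multi_index n => c a * monomial a 0) [ffun=> 0%N].
rewrite (_ : monomial [ffun=> 0%N] 0 = 1) ?mulr1; last first.
  by rewrite /monomial big1// => i _; rewrite ffunE.
apply=> a a0; have [i ai] : exists i, a i != 0%N.
  apply/existsP; apply: contraNT a0; rewrite negb_exists => /forallP H.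
  by apply/eqP/ffunP => i; rewrite ffunE; apply/eqP; rewrite -[_ == _]negbK.
by rewrite /monomial (bigD1 i)//= mxE expr0n (negbTE ai) mul0r mulr0.
Qed.

Lemma mdeg_eq0P n (a : multi_index n) : (mdeg a < 1)%N -> a = [ffun=> 0%N].
Proof.
by rewrite ltnS leqn0 => /eqP h; apply/ffunP => i; rewrite ffunE (mdeg_eq0 _ h).
Qed.

Lemma small_radius (r M e : C) : 0 < r -> 0 <= M -> 0 < e ->
  exists s, [/\ 0 < s, s <= r & s / r * M <= e].
Proof.
move=> r0 M0 e0; have [|s [s0 sr sM]] := pos_min r0 (_ : 0 < e * r / (M + 1)).
  by rewrite divr_gt0 ?mulr_gt0// ltr_wpDl.
exists s; split=> //; rewrite mulrAC ler_pdivrMr//.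
rewrite ler_pdivlMr ?ltr_wpDl// in sM; apply: le_trans sM.
by rewrite ler_wpM2l ?(ltW s0)// lerDl.
Qed.

Lemma ser_small n (r : C) c M f (e : C) : 0 < r -> ser (cvec n r) c M f -> f 0 = 0 -> 0 < e ->
  exists s, [/\ 0 < s, s <= r & exists2 N, N <= e & ser (cvec n s) c N f].
Proof.
move=> r0 cf f0 e0; have [s [s0 sr se]] := small_radius r0 (absb_ge0 cf.1) e0.
exists s; split=> //; exists ((s / r) ^+ 1 * M); rewrite ?expr1//.
rewrite -[s / r]expr1; apply: (ser_scale s0 sr _ cf) => a /mdeg_eq0P ->.
by rewrite -(ser_coef0 (pos_cst n r0) cf).
Qed.

Lemma ser_cst n (rho : 'rV[C]_n) (k : C) : pd rho rho ->
  exists c, ser rho c `|k| (fun=> k).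
Proof.
move=> rr; have b0 (z : 'rV[C]_n) : monomial [ffun=> 0%N] z = 1.
  by rewrite /monomial big1// => i _; rewrite ffunE.
exists (fun a => if a == [ffun=> 0%N] then k else 0).
have := ser_monomial k [ffun=> 0%N] rr; rewrite b0 mulr1.
by apply: ser_ext => z _; rewrite b0 mulr1.
Qed.

Lemma ser_coord n (rho : 'rV[C]_n) i : pd rho rho ->
  exists c, ser rho c (rho 0 i) (fun z => z 0 i).
Proof.
move=> rr; exists (fun a => if a == msing i 1 then 1 else 0).
have := ser_monomial 1 (msing i 1) rr; rewrite monomial_sing normr1 mul1r expr1.
by apply: ser_ext => z _; rewrite monomial_sing expr1 mul1r.
Qed.

Lemma ser_leM n (rho : 'rV[C]_n) c M N f : M <= N -> ser rho c M f -> ser rho c N f.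
Proof. by move=> MN [cM cf]; split=> //; exact: absb_leM MN cM. Qed.

Lemma holomorphicP n (h : 'rV[C]_n -> C) z0 :
  holomorphic_at h z0 <->
  exists r c M, 0 < r /\ ser (cvec n r) c M (fun z => h (z0 + z)).
Proof.
split=> [[c /has_pseriesP[r [M H]]]|[r [c [M H]]]]; first by exists r, c, M.
by exists c; apply/has_pseriesP; exists r, M.
Qed.

Lemma ser_holomorphic n (rho : 'rV[C]_n) c M h z0 : pos rho ->
  ser rho c M (fun z => h (z0 + z)) -> holomorphic_at h z0.
Proof.
move=> /pos_lower[r [r0 rr]] H; apply/holomorphicP; exists r, c, M; split=> //.
by apply: ser_shrink H => i; rewrite mxE gtr0_norm.
Qed.

Lemma holomorphic_ext n (h k : 'rV[C]_n -> C) z0 :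
  (\forall z \near z0, h z = k z) -> holomorphic_at h z0 -> holomorphic_at k z0.
Proof.
move=> /nbhs_pdP[s s0 hk] /holomorphicP[r [c [M [r0 H]]]].
have [t [t0 tr ts]] := pos_min r0 s0.
apply/holomorphicP; exists t, c, M; split=> //.
apply: ser_ext (ser_shrink (pd_cst_le n (ltW t0) tr) H) => z zt.
exact/hk/(pd_le ts).
Qed.

Lemma holomorphicD n (h k : 'rV[C]_n -> C) z0 : holomorphic_at h z0 ->
  holomorphic_at k z0 -> holomorphic_at (fun z => h z + k z) z0.
Proof.
move=> /holomorphicP[r [c [M [r0 H]]]] /holomorphicP[s [d [N [s0 K]]]].
have [t [t0 tr ts]] := pos_min r0 s0.
have := serD (ser_shrink (pd_cst_le n (ltW t0) tr) H) (ser_shrink (pd_cst_le n (ltW t0) ts) K).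
exact/ser_holomorphic/pos_cst.
Qed.

Lemma holomorphicM n (h k : 'rV[C]_n -> C) z0 : holomorphic_at h z0 ->
  holomorphic_at k z0 -> holomorphic_at (fun z => h z * k z) z0.
Proof.
move=> /holomorphicP[r [c [M [r0 H]]]] /holomorphicP[s [d [N [s0 K]]]].
have [t [t0 tr ts]] := pos_min r0 s0.
have := serM cptC (ser_shrink (pd_cst_le n (ltW t0) tr) H) (ser_shrink (pd_cst_le n (ltW t0) ts) K).
exact/ser_holomorphic/pos_cst.
Qed.

Lemma holomorphic_cst n (k : C) (z0 : 'rV[C]_n) : holomorphic_at (fun=> k) z0.
Proof.
have p : pos (cvec n (1 : C)) := pos_cst n ltr01.
by have [c] := ser_cst k (pos_pd p); exact: ser_holomorphic.
Qed.

Lemma holomorphic_coord n i (z0 : 'rV[C]_n) : holomorphic_at (fun z => z 0 i) z0.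
Proof.
have p : pos (cvec n (1 : C)) := pos_cst n ltr01.
have [c cP] := ser_coord i (pos_pd p); have [d dP] := ser_cst (z0 0 i) (pos_pd p).
apply: (ser_holomorphic p (c := fun a => d a + c a) (M := `|z0 0 i| + cvec n 1 0 i)).
by apply: ser_ext (serD dP cP) => z _; rewrite mxE.
Qed.

Lemma holomorphic_small n (h : 'rV[C]_n -> C) z0 e : holomorphic_at h z0 -> 0 < e ->
  exists r, 0 < r /\ forall s, 0 < s -> s <= r ->
    exists c, ser (cvec n s) c e (fun z => h (z0 + z) - h z0).
Proof.
move=> H e0; have : holomorphic_at (fun z => h z + (- h z0)) z0.
  by apply: holomorphicD H _; exact: holomorphic_cst.
move=> /holomorphicP[r [c [M [r0 K]]]].
have [|s [s0 sr [N Ne cN]]] := ser_small r0 K _ e0; first by rewrite addr0 subrr.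
exists s; split=> // t t0 ts; exists c.
exact: ser_leM Ne (ser_shrink (pd_cst_le n (ltW t0) ts) cN).
Qed.

Lemma holomorphic_comp n m (f : 'rV[C]_m -> C) (phi : 'rV[C]_n -> 'rV[C]_m) z0 :
  (forall i, holomorphic_at (fun z => phi z 0 i) z0) ->
  holomorphic_at f (phi z0) -> holomorphic_at (f \o phi) z0.
Proof.
move=> Hphi /holomorphicP[r [c [M [r0 H]]]].
have [s Hs] := choice (fun i => holomorphic_small (Hphi i) r0).
have [|t [t0 Ht]] := @pos_lower C _ (\row_i s i).
  by move=> i; rewrite mxE; have [] := Hs i.
have p : pos (cvec n t) := pos_cst n t0.
have [] := @ser_comp _ cptC n m (cvec n t) (cvec m r) c M _ (fun z => phi (z0 + z) - phi z0) p H.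
  move=> i; have [_ /(_ t t0)] := Hs i.
  have := Ht i; rewrite mxE => -> /(_ isT)[d dP]; exists d; rewrite mxE.
  by apply: ser_ext dP => z _; rewrite !mxE.
move=> d dP; apply: (ser_holomorphic p (c := d) (M := M)).
by apply: ser_ext dP => z _ /=; rewrite addrC subrK.
Qed.

(** Translation by a small [u] maps the polydisc of radius [r / 2] into that of radius [r], so
    recentring a series is a case of substitution. *)
Lemma holomorphic_near n (h : 'rV[C]_n -> C) z0 : holomorphic_at h z0 ->
  \forall z \near z0, holomorphic_at h z.
Proof.
move=> /holomorphicP[r [c [M [r0 H]]]]; apply/nbhs_pdP; exists (r / 2).
  by rewrite divr_gt0.
move=> u ur; have r20 : 0 < r / 2 by rewrite divr_gt0.
have p : pos (cvec n (r / 2)) := pos_cst n r20.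
have [] := @ser_comp _ cptC n n (cvec n (r / 2)) (cvec n r) c M _ (fun z => u + z) p H.
  move=> i; have [d dP] := ser_coord i (pos_pd p); have [e eP] := ser_cst (u 0 i) (pos_pd p).
  exists (fun a => e a + d a); apply: (@ser_leM _ _ _ (`|u 0 i| + cvec n (r / 2) 0 i)).
    by have := ur i; rewrite !mxE => ur'; rewrite [leRHS]splitr lerD.
  by apply: ser_ext (serD eP dP) => z _; rewrite mxE.
move=> d dP; apply: (ser_holomorphic p (c := d) (M := M)).
by apply: ser_ext dP => z _ /=; rewrite addrA.
Qed.

Lemma holomorphic_cts n (h : 'rV[C]_n -> C) z0 e : holomorphic_at h z0 -> 0 < e ->
  \forall z \near z0, `|h z - h z0| <= e.
Proof.
move=> H e0; have [r [r0 /(_ r r0 (lexx _))[c cP]]] := holomorphic_small H e0.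
by apply/nbhs_pdP; exists r => // z zr; exact: ser_norm zr cP.
Qed.

Lemma holomorphic_neq0 n (h : 'rV[C]_n -> C) z0 : holomorphic_at h z0 -> h z0 != 0 ->
  \forall z \near z0, `|h z0| / 2 <= `|h z|.
Proof.
move=> H h0; have e0 : 0 < `|h z0| / 2 by rewrite divr_gt0 ?normr_gt0.
apply: filterS (holomorphic_cts H e0) => z; rewrite distrC => h1.
have : `|h z0| <= `|h z0 - h z| + `|h z| by rewrite -{1}(subrK (h z) (h z0)) ler_normD.
by rewrite {1}(splitr `|h z0|) => /le_trans/(_ (lerD h1 (lexx _))); rewrite lerD2l.
Qed.

End Holomorphic.

(** * One variable and the identity theorem *)

#[local] Existing Instance totally_filter.

Section OneVariable.
Variable C : numClosedFieldType.
Hypothesis cptC : disc_compact C.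

(** Realness of [phi] makes the sublevel sets a chain, hence a filter base; by continuity its
    cluster point is a minimiser. *)
Lemma compact_min (K : set C) (phi : C -> C) : compact K -> K !=set0 ->
  (forall t, K t -> phi t \is Num.real) ->
  (forall t, K t -> forall e, 0 < e -> \forall s \near t, K s -> `|phi s - phi t| <= e) ->
  exists2 t, K t & forall s, K s -> phi t <= phi s.
Proof.
move=> cK [k Kk] phiR phic.
pose B y := [set x | K x /\ phi x <= phi y].
have PF : ProperFilter (filter_from K B).
  apply: filter_from_proper; last by move=> y Ky; exists y.
  apply: filter_from_filter; first by exists k.
  move=> i j Ki Kj; have /orP[ij|ji] : (phi i <= phi j) || (phi j <= phi i).
  - exact: real_comparable (phiR _ Ki) (phiR _ Kj).
  - by exists i => // x [Kx xi]; split; split=> //; exact: le_trans ij.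
  - by exists j => // x [Kx xj]; split; split=> //; exact: le_trans ji.
have [|x [Kx cl]] := cK (filter_from K B) PF.
  by exists k => // x [].
exists x => // y Ky; rewrite real_leNgt ?phiR//; apply/negP => yx.
have e0 : 0 < (phi x - phi y) / 2 by rewrite divr_gt0// subr_gt0.
have [||s [[Ks sy] /(_ Ks) sx]] := cl (B y) [set s | K s -> `|phi s - phi x| <= (phi x - phi y) / 2].
- by exists y.
- exact: phic.
have : phi x - phi y <= (phi x - phi y) / 2.
  apply: le_trans sx; rewrite distrC; apply: le_trans (real_ler_norm _).
    by rewrite lerB.
  by rewrite realB ?phiR.
by rewrite ler_pdivlMr// ger_pMr ?subr_gt0// lern1.
Qed.

Definition ser1 (r : C) (c : nat -> C) (M : C) (F : C -> C) : Prop :=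
  absb (fun k => c k * r ^+ k) M /\
  forall t, `|t| <= r -> sumto (fun k => c k * t ^+ k) (F t).

Lemma ser1_lead r c M F m t : 0 < r -> ser1 r c M F ->
  (forall k, (k < m)%N -> c k = 0) -> `|t| <= r ->
  `|F t - c m * t ^+ m| <= M / r ^+ m.+1 * `|t| ^+ m.+1.
Proof.
move=> r0 [cM cF] c0 tr.
have H1 := cF t tr.
have S : sumto (fun k => if k == m then c k * t ^+ k else 0) (c m * t ^+ m).
  have := @sumto_single _ _ (fun k => if k == m then c k * t ^+ k else 0) m.
  by rewrite eqxx; apply => i /negbTE ->.
have H2 := sumtoZ (-1) S.
have := sumtoD H1 H2; rewrite mulN1r; apply: sumto_norm.
have E : M / r ^+ m.+1 * `|t| ^+ m.+1 = (`|t| / r) ^+ m.+1 * M.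
  by rewrite expr_div_n; ring.
have q0 : 0 <= `|t| / r by rewrite divr_ge0// ltW.
have q1 : `|t| / r <= 1 by rewrite ler_pdivrMr// mul1r.
rewrite E; have := absbZ ((`|t| / r) ^+ m.+1) cM; rewrite (ger0_norm (exprn_ge0 _ q0)) => B.
apply: absb_le B => k; case: (ltngtP k m) => [km|mk|->].
- by rewrite c0// mul0r mulr0 addr0 normr0.
- rewrite mulr0 addr0.
  have -> : `|c k * t ^+ k| = (`|t| / r) ^+ k * `|c k * r ^+ k|.
    rewrite !normrM !normrX (gtr0_norm r0) expr_div_n; field.
    by rewrite expf_neq0// gt_eqF.
  rewrite [leRHS]normrM ler_wpM2r// (ger0_norm (exprn_ge0 _ q0)); exact: ler_wiXn2l.
- by rewrite mulN1r subrr normr0.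
Qed.

Lemma ser1_neq0 r c M F m : 0 < r -> ser1 r c M F ->
  (forall k, (k < m)%N -> c k = 0) -> c m != 0 ->
  exists2 d, 0 < d & forall t, 0 < `|t| -> `|t| <= d -> F t != 0.
Proof.
move=> r0 cF c0 cm; have cm0 : 0 < `|c m| / 2 by rewrite divr_gt0 ?normr_gt0.
have M0 := absb_ge0 cF.1.
have K0 : 0 <= M / r ^+ m.+1 by rewrite divr_ge0// exprn_ge0 ?ltW.
have [s [s0 sr sM]] := small_radius r0 (mulr_ge0 K0 (ltW r0)) cm0.
exists s => // t t0 ts; apply/eqP => Ft.
have := ser1_lead r0 cF c0 (le_trans ts sr).
rewrite Ft sub0r normrN normrM normrX (exprSr `|t|) mulrA; apply/negP.
rewrite lt_geF// mulrAC ltr_pM2r ?exprn_gt0//.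
apply: le_lt_trans (_ : `|c m| / 2 < _); last first.
  by rewrite ltr_pdivrMr// ltr_pMr ?normr_gt0// ltr1n.
apply: le_trans sM; move: K0; set K := M / _ => K0.
rewrite (_ : s / r * (K * r) = K * s); last by field; rewrite gt_eqF.
by rewrite ler_wpM2l.
Qed.

Lemma ser1_uniq r c M F : 0 < r -> ser1 r c M F ->
  (forall e, 0 < e -> exists t, [/\ 0 < `|t|, `|t| <= e & F t = 0]) ->
  forall k, c k = 0.
Proof.
move=> r0 cF H k; apply/eqP; apply: contraT => ck.
have ex : exists k, c k != 0 by exists k.
case: (ex_minnP ex) => m cm mmin.
have c0 j : (j < m)%N -> c j = 0.
  by move=> jm; apply/eqP; apply: contraTT jm => /mmin; rewrite -leqNgt.
have [d d0 Hd] := ser1_neq0 r0 cF c0 cm.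
by have [t [t0 td Ft]] := H d d0; have := Hd t t0 td; rewrite Ft eqxx.
Qed.

Lemma ser1_zero r c M F : ser1 r c M F -> (forall k, c k = 0) ->
  forall t, `|t| <= r -> F t = 0.
Proof.
move=> [_ cF] c0 t tr; apply: sumto_unique (cF t tr) _.
by apply: eq_sumto (@sumto0 C _) => k; rewrite c0 mul0r.
Qed.

Definition an1 (F : C -> C) t0 : Prop :=
  exists r c M, 0 < r /\ ser1 r c M (fun t => F (t0 + t)).

Definition loc0 (F : C -> C) t0 : Prop :=
  exists2 e, 0 < e & forall t, `|t| <= e -> F (t0 + t) = 0.

Lemma an1_loc0 F t0 : an1 F t0 ->
  (forall e, 0 < e -> exists t, [/\ 0 < `|t|, `|t| <= e & F (t0 + t) = 0]) ->
  loc0 F t0.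
Proof.
move=> [r [c [M [r0 cF]]]] H; exists r => //.
exact: ser1_zero cF (ser1_uniq r0 cF H).
Qed.

Lemma loc0_norm_open F (t : C) : loc0 F `|t| -> \forall s \near t, loc0 F `|s|.
Proof.
move=> [e e0 He]; have e20 : 0 < e / 2 by rewrite divr_gt0.
apply/nbhs_ballP; exists (e / 2) => // s; rewrite -ball_normE/= => ts.
exists (e / 2) => // u ue.
have -> : `|s| + u = `|t| + (`|s| - `|t| + u) by ring.
apply: He; rewrite (le_trans (ler_normD _ _))// (splitr e) lerD//.
by rewrite (le_trans (ler_dist_dist _ _))// distrC ltW.
Qed.

Lemma an1_segment F : (forall t, 0 <= t -> t <= 1 -> an1 F t) -> loc0 F 0 -> F 1 = 0.
Proof.
move=> anF F0.
(* Compactness is available for discs, so the segment enters through the modulus: [K] collects the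
   [t] for which [F] is not locally zero at [|t|]. For [t0] in [K] of least modulus, [F] vanishes at
   the points just below [|t0|]; these zeros accumulate at [|t0|] and contradict the choice of
   [t0]. *)
pose K := [set t : C | `|t| <= 1] `&` [set t | ~ loc0 F `|t|].
case: (pselect (loc0 F 1)) => [[e e0 He]|n1].
  by rewrite -[1]addr0 He// normr0 ltW.
have cK : compact K.
  apply: compact_closedI; first exact: cptC.
  rewrite (_ : [set t | _] = ~` [set t | loc0 F `|t|])//; apply: open_closedC.
  by rewrite openE => t /loc0_norm_open.
have K1 : K 1 by split; rewrite /= normr1.
have [|t0 [t01 nt0] tmin] := compact_min cK (ex_intro _ _ K1) (fun t _ => normr_real t).
  move=> t _ e e0; apply/nbhs_ballP; exists e => // s; rewrite -ball_normE/= => ts _.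
  by rewrite (le_trans (ler_dist_dist _ _))// distrC ltW.
have tt0 : 0 < `|t0|.
  rewrite lt0r normr_ge0 andbT; apply/negP => /eqP t00.
  by apply: nt0; rewrite t00.
case: nt0; apply: an1_loc0; first exact: anF.
move=> e e0; have [s [s0 se st]] := pos_min e0 tt0.
exists (- s); rewrite normrN gtr0_norm//; split=> //.
have u0 : 0 <= `|t0| - s by rewrite subr_ge0.
case: (pselect (loc0 F (`|t0| - s))) => [[d d0 Hd]|nl].
  by rewrite -[_ - _]addr0 Hd// normr0 ltW.
have := tmin (`|t0| - s); rewrite /K/= ger0_norm// => h.
have : `|t0| <= `|t0| - s.
  by apply: h; split=> //; rewrite lerBlDr (le_trans t01)// lerDl ltW.
by rewrite lerDl oppr_ge0 lt_geF.
Qed.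

End OneVariable.

(** * Restriction to complex lines and the identity theorem *)

Section Lines.
Variable C : numClosedFieldType.
Hypothesis cptC : disc_compact C.
Variable n : nat.
Implicit Types (v z : 'rV[C]_n) (c : multi_index n -> C).

Definition mdegset (k : nat) : {fset multi_index n} :=
  seq_fset tt [seq b <- [seq ([ffun i => nat_of_ord (u i)] : multi_index n) |
     u : {ffun 'I_n -> 'I_k.+1}] | mdeg b == k].

Lemma in_mdegset k a : (a \in mdegset k) = (mdeg a == k).
Proof.
rewrite seq_fsetE mem_filter; case: eqP => ak //=.
apply/mapP; exists [ffun i => inord (a i)]; first by rewrite mem_enum.
by apply/ffunP => i; rewrite !ffunE inordK// ltnS -ak leq_mdeg.
Qed.

Definition hpart c k v : C := \sum_(a <- mdegset k) c a * monomial a v.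

Lemma homogeneous_partE c k v : homogeneous_part c k v = hpart c k v.
Proof.
rewrite /homogeneous_part (_ : [set a | _] = [set` mdegset k]).
  by rewrite fsbig_finite ?set_fsetK//; exact: finite_fset.
by apply/seteqP; split=> a /=; rewrite in_mdegset => /eqP.
Qed.

Lemma hpart_fiber c k v :
  sumto (fun a => if mdeg a == k then c a * monomial a v else 0) (hpart c k v).
Proof.
have := @sumto_finite _ _ (fun a => if mdeg a == k then c a * monomial a v else 0) (mdegset k).
rewrite (_ : \sum_(_ <- _) _ = hpart c k v); last first.
  by rewrite /hpart !big_seq; apply: eq_bigr => a; rewrite in_mdegset => ->.
by apply=> a; rewrite in_mdegset => /negbTE ->.
Qed.

Lemma hpartZ c k v t : hpart c k (t *: v) = t ^+ k * hpart c k v.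
Proof.
rewrite /hpart mulr_sumr !big_seq; apply: eq_bigr => a; rewrite in_mdegset => /eqP ak.
by rewrite monomial_scale ak mulrCA.
Qed.

Lemma ser_line (rho : 'rV[C]_n) c M f v r : 0 < r -> pd rho (r *: v) -> ser rho c M f ->
  ser1 r (fun k => hpart c k v) M (fun t => f (t *: v)).
Proof.
move=> r0 rv [cM cf].
have pdt t : `|t| <= r -> pd rho (t *: v).
  move=> tr i; apply: le_trans (rv i); rewrite !mxE !normrM ler_wpM2r//.
  by rewrite [leRHS]gtr0_norm.
have fib t : forall k, sumto (fun a => if mdeg a == k then c a * monomial a (t *: v) else 0)
    (hpart c k v * t ^+ k).
  by move=> k; rewrite mulrC -hpartZ; exact: hpart_fiber.
split.
  by apply: absb_fibers (ser_absb rv cM) (fib r).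
by move=> t tr; have := sumto_fibers cptC (ser_absb (pdt _ tr) cM) (fib t) (cf _ (pdt _ tr)).
Qed.

Lemma vec_scale (r : C) v : 0 < r -> exists s, 0 < s /\ pd (cvec n r) (s *: v).
Proof.
move=> r0; have p : 0 < 1 + \sum_i `|v 0 i| by rewrite ltr_wpDr// sumr_ge0.
have s0 : 0 < r / (1 + \sum_i `|v 0 i|) by rewrite divr_gt0.
exists (r / (1 + \sum_i `|v 0 i|)); split=> // i.
rewrite !mxE normrM (gtr0_norm s0) mulrAC ler_pdivrMr// ler_wpM2l ?(ltW r0)//.
by rewrite (bigD1 i)//= addrCA lerDl addr_ge0// sumr_ge0.
Qed.

Lemma holomorphic_line (h : 'rV[C]_n -> C) z0 t0 v :
  holomorphic_at h (z0 + t0 *: v) -> an1 (fun t => h (z0 + t *: v)) t0.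
Proof.
move=> /holomorphicP[r [c [M [r0 H]]]].
have [s [s0 sv]] := vec_scale v r0.
exists s, (fun k => hpart c k v), M; split=> //.
have [H1 H2] := ser_line s0 sv H; split=> // t ts.
by have := H2 t ts; rewrite -addrA -scalerDl.
Qed.

Lemma identity_segment (h : 'rV[C]_n -> C) z1 z :
  (forall t, 0 <= t -> t <= 1 -> holomorphic_at h (z1 + t *: (z - z1))) ->
  (\forall w \near z1, h w = 0) -> h z = 0.
Proof.
move=> hol /nbhs_pdP[r r0 H].
have := @an1_segment _ cptC (fun t => h (z1 + t *: (z - z1))).
rewrite scale1r subrKC; apply=> [t t0 t1|]; first exact/holomorphic_line/hol.
have [s [s0 sv]] := vec_scale (z - z1) r0.
exists s => // t ts; rewrite add0r; apply: H => i; apply: le_trans (sv i).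
by rewrite !mxE !normrM ler_wpM2r// [leRHS]gtr0_norm.
Qed.

Lemma ball_segment (r : C) z1 z t : 0 < r -> ball (0 : 'rV[C]_n) r z1 -> ball (0 : 'rV[C]_n) r z ->
  0 <= t -> t <= 1 -> ball (0 : 'rV[C]_n) r (z1 + t *: (z - z1)).
Proof.
move=> r0 /(ball_pdP _ _ r0) h1 /(ball_pdP _ _ r0) h t0 t1; apply/ball_pdP => // i.
move: (h1 i) (h i); rewrite !mxE !subr0 => a b.
have -> : z1 0 i + t * (z 0 i - z1 0 i) = (1 - t) * z1 0 i + t * z 0 i by ring.
rewrite (le_lt_trans (ler_normD _ _))// !normrM (ger0_norm t0) ger0_norm ?subr_ge0//.
have -> : r = (1 - t) * r + t * r by ring.
move: t0; rewrite le0r => /orP[/eqP ->|t0].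
  by rewrite !mul0r !addr0 subr0 !mul1r.
by rewrite ler_ltD ?ltr_pM2l// ler_wpM2l ?subr_ge0// ltW.
Qed.

Lemma neq0_dense (r : C) (h : 'rV[C]_n -> C) z2 z1 e : 0 < r ->
  (forall z, ball (0 : 'rV[C]_n) r z -> holomorphic_at h z) ->
  ball (0 : 'rV[C]_n) r z2 -> h z2 != 0 -> ball (0 : 'rV[C]_n) r z1 -> 0 < e ->
  exists2 z, pd (cvec n e) (z - z1) & h z != 0.
Proof.
move=> r0 hol b2 h2 b1 e0; apply: contrapT => H; move/eqP: h2; apply.
apply: (@identity_segment _ z1); first by move=> t t0 t1; exact/hol/ball_segment.
apply/nbhs_pdP; exists e => // z ze; apply/eqP; apply: contraT => hz; case: H.
by exists (z1 + z) => //; rewrite addrC addKr.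
Qed.

(** Uniqueness of digits in base [B]. It makes Kronecker's substitution injective on monomials with
    bounded exponents. *)
Lemma kronecker_inj (B : nat) m (f g : nat -> nat) :
  (forall i, f i < B)%N -> (forall i, g i < B)%N ->
  (\sum_(i < m) f i * B ^ i = \sum_(i < m) g i * B ^ i)%N ->
  forall i, (i < m)%N -> f i = g i.
Proof.
elim: m f g => [|m IH] f g fB gB //; rewrite !big_ord_recl !expn0 !muln1.
have sumS (u : nat -> nat) : (\sum_(i < m) u (bump 0 i) * B ^ bump 0 i =
    B * \sum_(i < m) u i.+1 * B ^ i)%N.
  by rewrite big_distrr/=; apply: eq_bigr => i _; rewrite /bump add1n expnS mulnCA.
rewrite !sumS => E.
have B0 : (0 < B)%N by apply: leq_ltn_trans (fB 0%N).
have E0 : f 0%N = g 0%N.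
  have := congr1 (modn^~ B) E; rewrite -/(modn _ _) /= ![(_ + B * _)%N]addnC.
  by rewrite ![(B * _)%N]mulnC !modnMDl !modn_small.
move: E; rewrite E0 => /addnI /eqP; rewrite eqn_pmul2l// => /eqP E.
case=> [|i] // im; apply: (IH (fun j => f j.+1) (fun j => g j.+1)) => //.
Qed.

End Lines.

(** * Order of a germ *)

#[local] Existing Instance totally_filter.

Section Order.
Variable C : numClosedFieldType.
Hypothesis cptC : disc_compact C.
Variable n : nat.
Implicit Types (v z : 'rV[C]_n) (c : multi_index n -> C).

Lemma poly_eq0 (p : {poly C}) : (forall s, p.[s] = 0) -> p = 0.
Proof.
move=> p0; apply/eqP; apply: contraT => /max_poly_roots H.
pose s := [seq (i%:R : C) | i <- iota 0 (size p)].
have := H s; rewrite size_map size_iota ltnn; apply.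
  by apply/allP => x _; rewrite /root p0.
by rewrite map_inj_uniq ?iota_uniq// => i j /eqP; rewrite eqr_nat => /eqP.
Qed.

Lemma hpart_eq0 c m : (forall v, hpart c m v = 0) -> forall a, mdeg a = m -> c a = 0.
Proof.
(* Kronecker's substitution z_i = s ^ (m + 1) ^ i separates the monomials of degree m. *)
move=> c0 a am; pose e (b : multi_index n) := (\sum_i b i * m.+1 ^ i)%N.
pose p : {poly C} := \sum_(b <- mdegset n m) c b *: 'X^(e b).
have p0 : p = 0.
  apply: poly_eq0 => s; rewrite -(c0 (\row_i s ^+ (m.+1 ^ i)%N)) /p horner_sum.
  apply: eq_bigr => b _; rewrite hornerZ hornerXn /monomial /e -prodrXr; congr (_ * _).
  by apply: eq_bigr => i _; rewrite mxE -exprM mulnC.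
have := congr1 (coefp (e a)) p0; rewrite /= /p coef_sum coef0.
have am' : a \in mdegset n m by rewrite in_mdegset am.
rewrite (big_fsetD1 _ am')/= coefZ coefXn eqxx mulr1 big1_seq ?addr0// => b.
rewrite !inE in_mdegset => /and3P[_ ba /eqP bm]; rewrite coefZ coefXn.
case: eqP => [eab|]; last by rewrite mulr0.
case/eqP: ba; apply/ffunP => i.
pose F (d : multi_index n) (k : nat) := if insub k is Some j then d j else 0%N.
have FB (d : multi_index n) k : mdeg d = m -> (F d k < m.+1)%N.
  by rewrite /F => dm; case: insub => [j|//]; rewrite ltnS -dm leq_mdeg.
have FE d : (\sum_(k < n) F d k * m.+1 ^ k)%N = e d.
  by apply: eq_bigr => k _; rewrite /F valK.
have := @kronecker_inj m.+1 n (F b) (F a) (fun k => FB b k bm) (fun k => FB a k am) _ i (ltn_ord i).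
by rewrite /F valK; apply; rewrite -/F !FE.
Qed.

Lemma holomorphic_sum (I : Type) (r : seq I) (F : I -> 'rV[C]_n -> C) z :
  (forall i, holomorphic_at (F i) z) -> holomorphic_at (fun w => \sum_(i <- r) F i w) z.
Proof.
move=> H; elim: r => [|i r IH].
  by under eq_fun do rewrite big_nil; exact: holomorphic_cst.
by under eq_fun do rewrite big_cons; exact: holomorphicD.
Qed.

Lemma holomorphic_prod (I : Type) (r : seq I) (F : I -> 'rV[C]_n -> C) z :
  (forall i, holomorphic_at (F i) z) -> holomorphic_at (fun w => \prod_(i <- r) F i w) z.
Proof.
move=> H; elim: r => [|i r IH].
  by under eq_fun do rewrite big_nil; exact: holomorphic_cst.
by under eq_fun do rewrite big_cons; exact: holomorphicM.
Qed.

Lemma holomorphicX (F : 'rV[C]_n -> C) k z :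
  holomorphic_at F z -> holomorphic_at (fun w => F w ^+ k) z.
Proof.
move=> H; elim: k => [|k IH]; first exact: holomorphic_cst.
by under eq_fun do rewrite exprS; exact: holomorphicM.
Qed.

Lemma holomorphic_hpart c k z : holomorphic_at (hpart c k) z.
Proof.
apply: holomorphic_sum => a; apply: holomorphicM => //; first exact: holomorphic_cst.
by apply: holomorphic_prod => i; apply: holomorphicX; exact: holomorphic_coord.
Qed.

Lemma entire_dense (f : 'rV[C]_n -> C) v z (e : C) : (forall z, holomorphic_at f z) ->
  f v != 0 -> 0 < e -> exists2 w, pd (cvec n e) (w - z) & f w != 0.
Proof.
move=> fE fv e0; apply: contrapT => H; move/eqP: fv; apply.
apply: (identity_segment cptC (z1 := z)) => //.
apply/nbhs_pdP; exists e => // w we; apply/eqP; apply: contraT => fw; case: H.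
by exists (z + w) => //; rewrite addrC addKr.
Qed.

(** The nonvanishing set of [g] is open and that of [f] is dense. This supplies directions that are
    good for several germs at once. *)
Lemma entire_common (f g : 'rV[C]_n -> C) v1 v2 :
  (forall z, holomorphic_at f z) -> (forall z, holomorphic_at g z) ->
  f v1 != 0 -> g v2 != 0 -> exists2 v, f v != 0 & g v != 0.
Proof.
move=> fE gE f1 g2; have /nbhs_pdP[e e0 He] := holomorphic_neq0 (gE v2) g2.
have [w wv fw] := entire_dense v2 fE f1 e0.
exists w => //; have := He _ wv; rewrite subrKC => h.
by rewrite -normr_gt0 (lt_le_trans _ h)// divr_gt0 ?normr_gt0.
Qed.

(** Leading behaviour along the line of [v]. Since [A] may be 0, it only bounds the order on the
    line from below; a nonzero [A] fixes it. *)
Definition lead (h : 'rV[C]_n -> C) m v A : Prop :=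
  exists K d, [/\ 0 <= K, 0 < d &
    forall t, `|t| <= d -> `|h (t *: v) - A * t ^+ m| <= K * `|t| ^+ m.+1].

Lemma lead_of_ser r c M h m v : 0 < r -> ser (cvec n r) c M h ->
  (forall a, (mdeg a < m)%N -> c a = 0) -> lead h m v (hpart c m v).
Proof.
move=> r0 ch c0; have [s [s0 sv]] := vec_scale v r0.
have L := ser_line cptC s0 sv ch.
exists (M / s ^+ m.+1), s; split=> //.
  by rewrite divr_ge0 ?(absb_ge0 ch.1)// exprn_ge0// ltW.
move=> t ts; apply: (ser1_lead s0 L) => // k km.
by rewrite /hpart big1_seq// => a; rewrite in_mdegset => /andP[_ /eqP ak]; rewrite c0 ?ak// mul0r.
Qed.

Lemma lead_ext h k m v A : germ_eq h k -> lead h m v A -> lead k m v A.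
Proof.
move=> /nbhs_pdP[r r0 hk] [K [d [K0 d0 H]]]; have [s [s0 sv]] := vec_scale v r0.
have [e [e0 ed es]] := pos_min d0 s0.
exists K, e; split=> // t te; rewrite -[t *: v]add0r -hk ?add0r ?H ?(le_trans te)//.
move=> i; apply: le_trans (sv i); rewrite !mxE !normrM ler_wpM2r// (le_trans te)//.
by rewrite gtr0_norm.
Qed.

Lemma le_littleo (A K d : C) m l : 0 <= K -> 0 < d -> (m < l)%N ->
  (forall t, 0 < t -> t <= d -> `|A * t ^+ m| <= K * t ^+ l) -> A = 0.
Proof.
move=> K0 d0 ml H; apply/eqP; rewrite -normr_le0; apply/ler_addgt0Pr => e e0.
rewrite add0r; have [s [s0 sd sK]] := small_radius d0 (mulr_ge0 K0 (ltW d0)) e0.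
have [u [u0 us u1]] := pos_min s0 (@ltr01 C).
have := H u u0 (le_trans us sd).
rewrite normrM normrX (gtr0_norm u0) -(subnKC ml) addSnnS exprD (mulrC `|A|) mulrCA ler_pM2l ?exprn_gt0//.
move/le_trans; apply; apply: le_trans sK.
have -> : s / d * (K * d) = K * s by field; rewrite gt_eqF.
rewrite ler_wpM2l// (le_trans _ us)// exprS ler_piMr ?(ltW u0)//.
by rewrite exprn_ile1 // ltW.
Qed.

Lemma lead_uniq h m l v A B : (m < l)%N -> lead h m v A -> lead h l v B -> A = 0.
Proof.
move=> ml [K [d [K0 d0 H]]] [L [e [L0 e0 G]]].
have [s [s0 sd se]] := pos_min d0 e0; have [u [u0 us u1]] := pos_min s0 (@ltr01 C).
apply: (@le_littleo A (K + (L + `|B|)) u m m.+1) => // [|t t0 tu].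
  by rewrite !addr_ge0.
have tE := gtr0_norm t0; rewrite -[X in _ * X ^+ m.+1]tE; rewrite -{}tE in tu.
have -> : A * t ^+ m = (h (t *: v) - B * t ^+ l) + B * t ^+ l - (h (t *: v) - A * t ^+ m) by ring.
have ts := le_trans tu us; have t1 := le_trans tu u1.
rewrite (le_trans (ler_normB _ _))// addrC mulrDl lerD ?H ?(le_trans ts)//.
rewrite (le_trans (ler_normD _ _))// mulrDl lerD//.
  apply: le_trans (G t _) _; first exact: le_trans se.
  by rewrite ler_wpM2l// ler_wiXn2l// (leq_trans ml).
by rewrite normrM normrX ler_wpM2l// ler_wiXn2l.
Qed.

Lemma leadM h k m l v A B : lead h m v A -> lead k l v B ->
  lead (fun z => h z * k z) (m + l) v (A * B).
Proof.
move=> [K [d [K0 d0 H]]] [L [e [L0 e0 G]]].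
have [s [s0 sd se]] := pos_min d0 e0; have [u [u0 us u1]] := pos_min s0 (@ltr01 C).
exists (K * (`|B| + L) + `|A| * L), u; split=> //.
  by rewrite addr_ge0// mulr_ge0// addr_ge0.
move=> t tu; have ts := le_trans tu us; have t1 := le_trans tu u1.
have Ht := H t (le_trans ts sd); have Gt := G t (le_trans ts se).
have -> : h (t *: v) * k (t *: v) - A * B * t ^+ (m + l) =
  (h (t *: v) - A * t ^+ m) * k (t *: v) + A * t ^+ m * (k (t *: v) - B * t ^+ l).
  by rewrite exprD; ring.
have kt : `|k (t *: v)| <= (`|B| + L) * `|t| ^+ l.
  rewrite -[k (t *: v)](subrKC (B * t ^+ l)) (le_trans (ler_normD _ _))// mulrDl.
  rewrite lerD ?normrM ?normrX// (le_trans Gt)// ler_wpM2l//.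
  by rewrite exprS ler_piMl// exprn_ge0.
rewrite (le_trans (ler_normD _ _))// [leRHS]mulrDl lerD//.
  rewrite normrM -addSn exprD mulrACA ler_pM//.
rewrite normrM -addnS exprD normrM normrX mulrACA ler_wpM2l// mulr_ge0// exprn_ge0//.
Qed.

(** The initial form is required to be nonzero at a vector rather than to have a nonzero
    coefficient, since lines and tangent cones speak of directions. *)
Definition has_order (h : 'rV[C]_n -> C) (m : nat) : Prop :=
  exists r c M, [/\ 0 < r, ser (cvec n r) c M h,
    forall a, (mdeg a < m)%N -> c a = 0 & exists v, hpart c m v != 0].

Lemma holomorphic0P (h : 'rV[C]_n -> C) :
  holomorphic_at h 0 <-> exists r c M, 0 < r /\ ser (cvec n r) c M h.
Proof.
split=> [/holomorphicP|] [r [c [M [r0 H]]]].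
  by exists r, c, M; split=> //; apply: ser_ext H => z _; rewrite add0r.
apply/holomorphicP; exists r, c, M; split=> //; apply: ser_ext H => z _; by rewrite add0r.
Qed.

Lemma ser_order r c M h : 0 < r -> ser (cvec n r) c M h ->
  (exists a, c a != 0) -> exists m, (forall a, (mdeg a < m)%N -> c a = 0) /\
   exists v, hpart c m v != 0.
Proof.
move=> r0 ch [a0 ca0].
have ex : exists m, `[< exists2 a, mdeg a = m & c a != 0 >].
  by exists (mdeg a0); apply/asboolP; exists a0.
case: (ex_minnP ex) => m /asboolP[a am ca] mmin; exists m; split.
  move=> b bm; apply/eqP; apply: contraTT bm => cb; rewrite -leqNgt; apply: mmin.
  by apply/asboolP; exists b.
apply: contrapT => H; move/eqP: ca; apply; apply: hpart_eq0 am => v.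
by apply/eqP; apply: contraT => hv; case: H; exists v.
Qed.

Lemma lead0 m v : lead (fun=> 0) m v 0.
Proof.
by exists 0, 1; split=> // t _; rewrite !mul0r subrr normr0.
Qed.

Lemma ser_uniq r c M h : 0 < r -> ser (cvec n r) c M h -> germ_eq h (fun=> 0) ->
  forall a, c a = 0.
Proof.
move=> r0 ch h0 a; apply/eqP; apply: contraT => ca.
have [|m [c0 [v hv]]] := ser_order r0 ch; first by exists a.
have L := lead_ext h0 (lead_of_ser v r0 ch c0).
by rewrite (lead_uniq (ltnSn m) L (lead0 _ _)) eqxx in hv.
Qed.

Lemma order_exists h : holomorphic_at h 0 -> ~ germ_eq h (fun=> 0) ->
  exists m, has_order h m.
Proof.
move=> /holomorphic0P[r [c [M [r0 ch]]]] h0.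
have [|m [c0 hv]] := ser_order r0 ch; last by exists m, r, c, M.
apply: contrapT => H; apply: h0; apply/nbhs_pdP; exists r => // z zr; rewrite add0r.
apply: sumto_unique (ch.2 _ zr) _; apply: eq_sumto (@sumto0 C _) => a.
suff -> : c a = 0 by rewrite mul0r.
by apply/eqP; apply: contraT => ca; case: H; exists a.
Qed.

Lemma has_order_holomorphic h m : has_order h m -> holomorphic_at h 0.
Proof. by move=> [r [c [M [r0 ch _ _]]]]; apply/holomorphic0P; exists r, c, M. Qed.

Lemma has_order_nz h m : has_order h m -> ~ germ_eq h (fun=> 0).
Proof.
move=> [r [c [M [r0 ch c0 [v hv]]]]] h0.
have L := lead_ext h0 (lead_of_ser v r0 ch c0).
by rewrite (lead_uniq (ltnSn m) L (lead0 _ _)) eqxx in hv.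
Qed.

Lemma lead_uniq_order h m l v A B : A != 0 -> B != 0 ->
  lead h m v A -> lead h l v B -> m = l.
Proof.
move=> A0 B0 hA hB; case: (ltngtP m l) => // ml.
- by rewrite (lead_uniq ml hA hB) eqxx in A0.
- by rewrite (lead_uniq ml hB hA) eqxx in B0.
Qed.

Lemma has_order_uniq h m l : has_order h m -> has_order h l -> m = l.
Proof.
move=> [r [c [M [r0 ch c0 [v hv]]]]] [s [d [N [s0 dh d0 [w hw]]]]].
have [u hu ku] := entire_common (@holomorphic_hpart c m) (@holomorphic_hpart d l) hv hw.
exact: lead_uniq_order hu ku (lead_of_ser _ r0 ch c0) (lead_of_ser _ s0 dh d0).
Qed.

Lemma has_order_ext h k m : germ_eq h k -> has_order h m -> has_order k m.
Proof.
move=> /nbhs_pdP[s s0 hk] [r [c [M [r0 ch c0 hv]]]].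
have [t [t0 tr ts]] := pos_min r0 s0.
exists t, c, M; split=> //; apply: ser_ext (ser_shrink (pd_cst_le n (ltW t0) tr) ch) => z zt.
by rewrite -[z]add0r hk//; exact: pd_le zt.
Qed.

(** The product has some order [p]. On a line where its initial form and those of both factors are
    nonzero, the leading exponents [m + l] and [p] must agree, so no convolution is computed. *)
Lemma has_orderM h k m l : has_order h m -> has_order k l ->
  has_order (fun z => h z * k z) (m + l).
Proof.
move=> hm kl; move: (hm) (kl).
move=> [r [c [M [r0 ch c0 [v hv]]]]] [s [d [N [s0 dh d0 [w hw]]]]].
have [u hu ku] := entire_common (@holomorphic_hpart c m) (@holomorphic_hpart d l) hv hw.
have L u := leadM (lead_of_ser u r0 ch c0) (lead_of_ser u s0 dh d0).
have [||p hp] := @order_exists (fun z => h z * k z).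
- by apply: holomorphicM => //; apply: has_order_holomorphic; eassumption.
- move=> h0; have := lead_uniq (ltnSn _) (lead_ext h0 (L u)) (lead0 _ _).
  by move/eqP; rewrite mulf_eq0 (negbTE hu) (negbTE ku).
move: (hp) => [q [e [Q [q0 eh e0 [x hx]]]]].
have [||||y /= hy ky] := @entire_common (fun z => hpart c m z * hpart d l z) (hpart e p) u x.
- by move=> z; apply: holomorphicM => //; exact: holomorphic_hpart.
- by move=> z; exact: holomorphic_hpart.
- by rewrite mulf_neq0.
- by [].
by rewrite (lead_uniq_order hy ky (L y) (lead_of_ser y q0 eh e0)).
Qed.

(** A lower bound on the order that mentions no coefficients, which makes it stable under
    substitution. *)
Definition growth (h : 'rV[C]_n -> C) m : Prop :=
  exists K d, [/\ 0 <= K, 0 < d & forall s z, 0 < s -> s <= d -> pd (cvec n s) z ->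
    `|h z| <= K * s ^+ m].

Lemma ser_growth r c M h m : 0 < r -> ser (cvec n r) c M h ->
  (forall a, (mdeg a < m)%N -> c a = 0) -> growth h m.
Proof.
move=> r0 ch c0; have M0 := absb_ge0 ch.1.
exists (M / r ^+ m), r; split=> // [|s z s0 sr zs].
  by rewrite divr_ge0// exprn_ge0// ltW.
by rewrite mulrAC -mulrA -expr_div_n mulrC; apply: ser_norm zs (ser_scale s0 sr c0 ch).
Qed.

Lemma has_order_growth h m : has_order h m -> growth h m.
Proof. by move=> [r [c [M [r0 ch c0 _]]]]; exact: ser_growth r0 ch c0. Qed.

Lemma growth_order h m l : has_order h m -> growth h l -> (l <= m)%N.
Proof.
move=> [r [c [M [r0 ch c0 [v hv]]]]] [K [d [K0 d0 H]]]; rewrite leqNgt; apply/negP => ml.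
have [L [e [L0 e0 G]]] := lead_of_ser v r0 ch c0.
have v0 : 0 < 1 + \sum_i `|v 0 i| by rewrite ltr_wpDr// sumr_ge0.
(* The point [t *: v] lies in the polydisc of radius [t * V], where the growth bound is applied. *)
pose V := 1 + \sum_i `|v 0 i|.
have [s [s0 sd se]] := pos_min (divr_gt0 d0 v0) e0.
have [u [u0 us u1]] := pos_min s0 (@ltr01 C).
move/eqP: hv; apply; apply: (@le_littleo _ (L + K * V ^+ l) u m m.+1) => // [|t t0 tu].
  by rewrite addr_ge0// mulr_ge0// exprn_ge0// ltW.
set A := hpart c m v in G *.
have -> : A * t ^+ m = h (t *: v) - (h (t *: v) - A * t ^+ m) by ring.
have tE := gtr0_norm t0.
rewrite (le_trans (ler_normB _ _))// addrC mulrDl lerD//.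
  have := G t; rewrite tE; apply; exact: le_trans tu (le_trans us se).
have tv : pd (cvec n (t * V)) (t *: v).
  move=> i; rewrite !mxE normrM tE ler_wpM2l ?(ltW t0)// /V (bigD1 i)//= addrCA lerDl.
  by rewrite addr_ge0// sumr_ge0.
have tV : t * V <= d by rewrite -ler_pdivlMr// (le_trans tu)// (le_trans us).
apply: le_trans (H _ _ (mulr_gt0 t0 v0) tV tv) _.
rewrite exprMn mulrA -!mulrA ler_wpM2l// mulrC ler_wpM2l ?exprn_ge0 ?(ltW v0)//.
by rewrite ler_wiXn2l ?(ltW t0)// (le_trans tu).
Qed.

Lemma ser_growth1 r c M h : 0 < r -> ser (cvec n r) c M h -> h 0 = 0 -> growth h 1.
Proof.
move=> r0 ch h0; apply: (ser_growth r0 ch) => a /mdeg_eq0P ->.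
by rewrite -(ser_coef0 (pos_cst n r0) ch).
Qed.

End Order.

Section OrderComp.
Variable C : numClosedFieldType.
Hypothesis cptC : disc_compact C.

Lemma holomorphic_growth1 n (h : 'rV[C]_n -> C) : holomorphic_at h 0 -> h 0 = 0 ->
  growth h 1.
Proof. by move=> /holomorphic0P[r [c [M [r0 ch]]]]; exact: ser_growth1 r0 ch. Qed.

Lemma growth_comp n p (h : 'rV[C]_p -> C) (phi : 'rV[C]_n -> 'rV[C]_p) m :
  (forall i, holomorphic_at (fun z => phi z 0 i) 0) -> phi 0 = 0 ->
  growth h m -> growth (h \o phi) m.
Proof.
move=> hphi phi0 [K [d [K0 d0 H]]].
have g i : growth (fun z => phi z 0 i) 1.
  by apply: holomorphic_growth1 => //; rewrite phi0 mxE.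
have [L HL] := choice g; have [e He] := choice HL.
have [|e0 [e00 ee]] := @pos_lower C _ (\row_i e i).
  by move=> i; rewrite mxE; have [] := He i.
pose V := 1 + \sum_i L i.
have L0 i : 0 <= L i by have [] := He i.
have V0 : 0 < V by rewrite ltr_wpDr// sumr_ge0.
have [s0 [s00 s0d s0e]] := pos_min (divr_gt0 d0 V0) e00.
exists (K * V ^+ m), s0; split=> // [|s z s_gt0 ss0 zs].
  by rewrite mulr_ge0// exprn_ge0// ltW.
rewrite -mulrA -exprMn; apply: H; first exact: mulr_gt0.
  by rewrite mulrC -ler_pdivlMr// (le_trans ss0).
move=> i; have [_ _ /(_ s z s_gt0)] := He i; rewrite expr1 => /(_ _ zs) h1.
rewrite mxE; apply: le_trans (h1 _) _.
  by have := ee i; rewrite mxE; apply: le_trans; exact: le_trans s0e.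
rewrite ler_wpM2r ?(ltW s_gt0)// /V (bigD1 i)//= addrCA lerDl addr_ge0// sumr_ge0//.
Qed.

End OrderComp.

(** * Weierstrass division *)

#[local] Existing Instance totally_filter.

Section WeierstrassDivision.
Variable C : numClosedFieldType.
Hypothesis cptC : disc_compact C.

Lemma absb_nat (x : nat -> C) M : (forall N, \sum_(i < N) `|x i| <= M) -> absb x M.
Proof.
move=> H F; pose N := (\max_(i <- F) i).+1.
have sub : (F `<=` seq_fset tt (iota 0 N))%fset.
  apply/fsubsetP => i iF; rewrite seq_fsetE mem_iota/= add0n ltnS.
  by rewrite (big_fsetD1 _ iF)/= leq_max leqnn.
apply: le_trans (H N); rewrite -(big_mkord xpredT (fun i => `|x i|)) /index_iota subn0.
have -> : \sum_(i <- iota 0 N) `|x i| = \sum_(i <- seq_fset tt (iota 0 N)) `|x i|.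
  apply: perm_big; rewrite uniq_perm ?iota_uniq ?fset_uniq// => i.
  by rewrite [RHS]seq_fsetE.
by rewrite (sum_fset_split _ sub) lerDl sumr_ge0.
Qed.

Lemma absb_geometric (B : C) : 0 <= B -> absb (fun m => B / 2 ^+ m) (2 * B).
Proof.
move=> B0; apply: absb_nat => N.
have -> : \sum_(i < N) `|B / 2 ^+ i| = 2 * B - 2 * B / 2 ^+ N.
  elim: N => [|N IH]; first by rewrite big_ord0 expr0 divr1 subrr.
  rewrite big_ord_recr/= IH ger0_norm; last by rewrite divr_ge0// exprn_ge0.
  by rewrite exprS; field; rewrite expf_neq0// pnatr_eq0.
by rewrite gerBl divr_ge0 ?exprn_ge0// mulr_ge0.
Qed.

Lemma sumto_shift (x : nat -> C) s M : absb x M -> sumto x s ->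
  sumto (fun m => x m.+1) (s - x 0%N).
Proof.
move=> xM xs; have xM' : absb (x \o succn) M by apply: absb_comp_inj xM => i j [].
have [t xt] := sumto_exists cptC xM'.
pose y m := if m is m'.+1 then x m else 0.
have yt : sumto y t.
  apply: (@sumto_inj _ cptC _ _ y succn t M) => //; first by move=> i j [].
  by case=> // m /(_ m); rewrite eqxx.
have := @sumto_single _ _ (fun m => if m is m'.+1 then 0 else x m) 0%N.
have h m : m != 0%N -> (if m is m'.+1 then 0 else x m) = 0 by case: m.
move=> /(_ h) h0; have := sumtoD yt h0.
have E m : y m + (if m is m'.+1 then 0 else x m) = x m by case: m => [|m]; rewrite ?add0r ?addr0.
move=> /(eq_sumto E)/(sumto_unique xs) ->; by rewrite addrK.
Qed.

Variables (n : nat) (j : 'I_n).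
Implicit Types (c d : multi_index n -> C) (z : 'rV[C]_n).

(** Coefficients of the quotient by [z_j ^ k], where the terms that are not divisible have been
    dropped. *)
Definition mshift k c a : C := c (madd a (msing j k)).

Lemma madd_inj k : injective (fun a : multi_index n => madd a (msing j k)).
Proof.
move=> a b /ffunP H; apply/ffunP => i; have := H i; rewrite !ffunE => /addIn //.
Qed.

Lemma mshift_absb rho c M k : pos rho -> absb (fun a => c a * monomial a rho) M ->
  absb (fun a => mshift k c a * monomial a rho) (M / rho 0 j ^+ k).
Proof.
move=> r0 cM; have p : 0 < (rho 0 j ^+ k)^-1 by rewrite invr_gt0 exprn_gt0.
have := absbZ (rho 0 j ^+ k)^-1 (absb_comp_inj (@madd_inj k) cM).
rewrite (gtr0_norm p) mulrC => B; apply: absb_le B => a /=.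
rewrite monomialD monomial_sing /mshift (_ : _^-1 * _ = c (madd a (msing j k)) * monomial a rho)//.
by field; rewrite expf_neq0// gt_eqF.
Qed.

Definition mdelta k (u : C) (a : multi_index n) : C := if a == msing j k then u else 0.

Lemma mconv_delta c k u a : mshift k (mconv c (mdelta k u)) a = c a * u.
Proof.
rewrite /mshift /mconv.
have aM : a \in mbelow (madd a (msing j k)) by rewrite in_mbelow mle_addr.
rewrite (big_fsetD1 _ aM)/= msubDl /mdelta eqxx big1_seq ?addr0// => b.
rewrite !inE in_mbelow => /and3P[_ ba bk]; case: eqP; rewrite ?mulr0// => E.
case/eqP: ba; have := maddBr bk; rewrite E => /madd_inj.
by [].
Qed.

Lemma mconvDr c d e a : mconv c (fun b => d b + e b) a = mconv c d a + mconv c e a.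
Proof. by rewrite /mconv -big_split; apply: eq_bigr => b _; rewrite mulrDr. Qed.

(* With radius r t in the direction j and r t ^ (nu + 1) in the others, every monomial
   of c other than those in z_j alone of degree at most nu gains a factor t ^ (nu + 1). *)
Lemma regular_radius r c M nu : 0 < r -> absb (fun a => c a * monomial a (cvec n r)) M ->
  (forall k, (k < nu)%N -> c (msing j k) = 0) -> c (msing j nu) != 0 ->
  exists rho, [/\ pos rho, pd (cvec n r) rho & exists2 N,
    absb (fun a => (c a - mdelta nu (c (msing j nu)) a) * monomial a rho) N &
    N <= rho 0 j ^+ nu * `|c (msing j nu)| / 2].
Proof.
move=> r0 cM c0 u0; set u := c _ in u0 *.
have M0 := absb_ge0 cM.
have p : 0 < r ^+ nu * `|u| / 2 by rewrite divr_gt0// mulr_gt0 ?exprn_gt0 ?normr_gt0.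
have [t [t0 t1]] := small_radius (@ltr01 C) M0 p; rewrite divr1 => tM.
pose e i := if i == j then 1%N else nu.+1.
pose rho : 'rV[C]_n := \row_i (r * t ^+ e i).
have rho0 : pos rho by move=> i; rewrite mxE mulr_gt0 ?exprn_gt0.
exists rho; split=> //.
  by move=> i; rewrite !mxE gtr0_norm ?mulr_gt0 ?exprn_gt0// ger_pMr// exprn_ile1// ltW.
exists (t ^+ nu.+1 * M); last first.
  rewrite mxE /e eqxx expr1 exprMn exprSr -mulrA.
  rewrite (_ : _ / 2 = t ^+ nu * (r ^+ nu * `|u| / 2)); last by field.
  by rewrite ler_wpM2l// exprn_ge0// ltW.
have tk0 : 0 <= t ^+ nu.+1 by rewrite exprn_ge0// ltW.
have B := absbZ (t ^+ nu.+1) cM; rewrite (ger0_norm tk0) in B.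
apply: absb_le B => a.
have W : monomial a rho = r ^+ mdeg a * t ^+ (\sum_i e i * a i)%N.
  rewrite /monomial /mdeg -!prodrXr -big_split; apply: eq_bigr => i _.
  by rewrite mxE exprMn -exprM.
rewrite /mdelta; case: eqP => [->|am]; first by rewrite subrr mul0r normr0.
rewrite subr0 monomial_cst; have [->|ca] := eqVneq (c a) 0; first by rewrite !mul0r mulr0.
have le : (nu.+1 <= \sum_i e i * a i)%N.
  case: (pselect (exists2 i, i != j & a i != 0%N)) => [[i ij ai]|H].
    rewrite (bigD1 i)//= /e (negbTE ij) (leq_trans _ (leq_addr _ _))//.
    by rewrite leq_pmulr// lt0n.
  have aE : a = msing j (a j).
    apply/ffunP => i; rewrite ffunE; case: eqP => [->//|/eqP ij].
    by apply/eqP; apply: contraT => ai; case: H; exists i.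
  rewrite (bigD1 j)//= /e eqxx mul1n (leq_trans _ (leq_addr _ _))//.
  rewrite ltn_neqAle; apply/andP; split.
    by apply/eqP => E; apply: am; rewrite E.
  by rewrite leqNgt; apply/negP => /c0; rewrite -aE => /eqP; rewrite (negbTE ca).
rewrite W (_ : c a * _ = t ^+ (\sum_i e i * a i) * (c a * r ^+ mdeg a)); last by ring.
rewrite normrM [leRHS]normrM ler_wpM2r// !normrX (gtr0_norm t0).
by rewrite ler_wiXn2l// ltW.
Qed.

Lemma weierstrass_division_coef rho ch cf Mf Mh nu N : pos rho ->
  absb (fun a => ch a * monomial a rho) Mh ->
  absb (fun a => cf a * monomial a rho) Mf ->
  ch (msing j nu) != 0 ->
  absb (fun a => (ch a - mdelta nu (ch (msing j nu)) a) * monomial a rho) N ->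
  N <= rho 0 j ^+ nu * `|ch (msing j nu)| / 2 ->
  exists q, (exists M, absb (fun a => q a * monomial a rho) M) /\
    forall a, mshift nu (mconv q ch) a = mshift nu cf a.
Proof.
(* Q sums to the Neumann series solving q = u^-1 (U f - U (q k)), where h = u z_j ^ nu + k
   and U f is the quotient of f by z_j ^ nu; the map q |-> u^-1 U (q k) has norm <= 1/2. *)
move=> r0 hM fM u0 kN Nle; set u := ch _ in u0 kN Nle.
pose k a := ch a - mdelta nu u a.
pose Q := fix Q m := if m is m'.+1 then fun a => - u^-1 * mshift nu (mconv (Q m') k) a
                     else fun a => u^-1 * mshift nu cf a.
have rj0 : 0 < rho 0 j ^+ nu by rewrite exprn_gt0.
pose B := `|u^-1| * (Mf / rho 0 j ^+ nu).
have B0 : 0 <= B by rewrite mulr_ge0// divr_ge0 ?(absb_ge0 fM)// ltW.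
have QB m : absb (fun a => Q m a * monomial a rho) (B / 2 ^+ m).
  elim: m => [|m IH].
    rewrite expr0 divr1; have X := absbZ u^-1 (mshift_absb nu r0 fM).
    by apply: absb_le X => a; rewrite mulrA.
  have X := absbZ (- u^-1) (mshift_absb nu r0 (mconv_absb cptC IH kN)).
  apply: absb_leM (absb_le _ X); last by move=> a; rewrite mulrA.
  have : `|- u^-1| * (B / 2 ^+ m * N / rho 0 j ^+ nu) <=
         `|- u^-1| * (B / 2 ^+ m * (rho 0 j ^+ nu * `|u| / 2) / rho 0 j ^+ nu).
    rewrite ler_wpM2l// ler_wpM2r ?invr_ge0 ?(ltW rj0)// ler_wpM2l//.
    by rewrite divr_ge0// exprn_ge0.
  move=> /le_trans; apply; rewrite normrN normfV exprS le_eqVlt; apply/orP; left; apply/eqP.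
  by field; rewrite expf_neq0 ?pnatr_eq0//= normr_eq0 u0 gt_eqF.
pose x (w : nat * multi_index n) := Q w.1 w.2 * monomial w.2 rho.
have xB : absb x (2 * B).
  apply: (@absb_pair _ _ _ x (fun m => B / 2 ^+ m)); first exact: QB.
  exact: absb_geometric.
have w0 b : monomial b rho != 0 by rewrite gt_eqF ?monomial_gt0.
have colB a : absb (fun m => x (m, a)) (2 * B).
  by apply: (@absb_comp_inj _ _ _ x (fun m => (m, a))) xB => m m' [].
have [y Hy] := choice (fun a => sumto_exists cptC (colB a)).
pose q a := y a / monomial a rho.
have Qq a : sumto (fun m => Q m a) (q a).
  have := sumtoZ (monomial a rho)^-1 (Hy a); rewrite mulrC; apply: eq_sumto => m.
  by rewrite /x/= mulrC mulfK.
have QM a : absb (fun m => Q m a) (`|(monomial a rho)^-1| * (2 * B)).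
  by apply: absb_le (absbZ (monomial a rho)^-1 (colB a)) => m; rewrite /x/= mulrC mulfK.
exists q; split.
  exists (2 * B); apply: absb_le (absb_cols cptC xB Hy) => a.
  by rewrite /q divfK.
move=> a.
have L1 : sumto (fun m => mshift nu (mconv (Q m) ch) a) (mshift nu (mconv q ch) a).
  rewrite /mshift /mconv; apply: sumto_sum => b.
  have := sumtoZ (ch (msub (madd a (msing j nu)) b)) (Qq b); rewrite mulrC.
  by apply: eq_sumto => m; rewrite mulrC.
(* Splitting [h] into [u z_j ^ nu] and [k] shows that the terms telescope, so their sum is [u] times
   [Q 0], that is, the quotient part of [f]. *)
have E m : mshift nu (mconv (Q m) ch) a = u * (Q m a + -1 * Q m.+1 a).
  have -> : mconv (Q m) ch = mconv (Q m) (fun b => mdelta nu u b + k b).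
    by congr mconv; apply/funext => b; rewrite /k subrKC.
  rewrite /mshift mconvDr -!/(mshift _ _ _) mconv_delta /=.
  by field.
have L2 := sumtoZ u (sumtoD (Qq a) (sumtoZ (-1) (sumto_shift (QM a) (Qq a)))).
rewrite (sumto_unique L1 (eq_sumto (fun m => esym (E m)) L2)) /=.
by field.
Qed.

(** The coefficient of [z_j ^ i] in the expansion by powers of [z_j]; the test on [a j] makes it a
    series in the other variables. *)
Definition mslice i (c : multi_index n -> C) (a : multi_index n) : C :=
  if a j == 0%N then mshift i c a else 0.

Lemma mslice_absb rho c M i : pos rho -> absb (fun a => c a * monomial a rho) M ->
  absb (fun a => mslice i c a * monomial a rho) (M / rho 0 j ^+ i).
Proof.
move=> r0 cM; apply: absb_le (mshift_absb i r0 cM) => a.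
by rewrite /mslice; case: ifP => // _; rewrite mul0r normr0.
Qed.

Lemma msub_singK (a : multi_index n) i : (i <= a j)%N -> madd (msub a (msing j i)) (msing j i) = a.
Proof.
move=> ia; apply/ffunP => k; rewrite !ffunE subnK//.
by case: eqP => [->|].
Qed.

(** The series is grouped by the exponent of [z_j]; the hypothesis on [mshift] says that no exponent
    reaches [nu], which leaves finitely many slices. *)
Lemma ser_slices rho c M R nu : pos rho -> ser rho c M R ->
  (forall a, mshift nu c a = 0) ->
  exists rr : nat -> 'rV[C]_n -> C,
   [/\ forall i, exists N, ser rho (mslice i c) N (rr i) &
       forall z, pd rho z -> R z = \sum_(i < nu) rr i z * z 0 j ^+ i].
Proof.
move=> r0 [cM cR] c0.
have [rr Hrr] := choice (fun i => ser_exists cptC (mslice_absb i r0 cM)).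
exists rr; split=> [i|z rz]; first by eexists; exact: Hrr.
pose y i := if (i < nu)%N then rr i z * z 0 j ^+ i else 0.
have fib (i : nat) : sumto (fun a : multi_index n => if a j == i then c a * monomial a z else 0) (y i).
  rewrite /y; case: ltnP => [inu|nui]; last first.
    apply: eq_sumto (@sumto0 C _) => a; case: eqP => // ai.
    rewrite -(@msub_singK a nu) ?ai// -/(mshift nu c _) c0.
    by rewrite mul0r.
  have [sM sR] := Hrr i.
  apply: (@sumto_inj _ cptC _ _ _ (fun a => madd a (msing j i)) _ (`|z 0 j ^+ i| * (M / rho 0 j ^+ i))).
  - exact: madd_inj.
  - move=> a H; case: eqP => // ai; have := H (msub a (msing j i)).
    by rewrite msub_singK ?ai// eqxx.
  - apply: absb_le (absbZ (z 0 j ^+ i) (ser_absb rz sM)) => a /=.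
    rewrite !ffunE eqxx -[X in _ == X]add0n eqn_add2r /mslice.
    case: ifP => _; rewrite ?normr0 ?normr_ge0// monomialD monomial_sing /mshift.
    by rewrite (_ : c _ * _ = z 0 j ^+ i * (c (madd a (msing j i)) * monomial a z))//; ring.
  - have := sumtoZ (z 0 j ^+ i) (sR z rz); rewrite mulrC; apply: eq_sumto => a /=.
    rewrite !ffunE eqxx -[X in _ == X]add0n eqn_add2r /mslice.
    case: ifP => _; last by rewrite mul0r mulr0.
    by rewrite monomialD monomial_sing /mshift; ring.
have H := sumto_fibers cptC (ser_absb rz cM) fib (cR z rz).
apply: (sumto_unique H).
have := @sumto_finite _ _ y (seq_fset tt (iota 0 nu)).
have -> : \sum_(i <- seq_fset tt (iota 0 nu)) y i = \sum_(i < nu) rr i z * z 0 j ^+ i.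
  rewrite -(big_mkord xpredT (fun i => rr i z * z 0 j ^+ i)) /index_iota subn0.
  transitivity (\sum_(i <- iota 0 nu) y i).
    apply: perm_big; rewrite uniq_perm ?iota_uniq ?fset_uniq// => i.
    by rewrite [LHS]seq_fsetE.
  by rewrite !big_seq; apply: eq_bigr => i; rewrite mem_iota /y/= add0n => ->.
by apply=> i; rewrite seq_fsetE mem_iota/= add0n /y => /negbTE ->.
Qed.

Lemma mslice_indep rho c i N f z z' : pd rho z -> pd rho z' ->
  (forall k, k != j -> z 0 k = z' 0 k) -> ser rho (mslice i c) N f -> f z = f z'.
Proof.
move=> rz rz' zz' [_ cf]; apply: sumto_unique (cf z rz) _.
apply: eq_sumto (cf z' rz') => a; rewrite /mslice; case: eqP => aj; last by rewrite !mul0r.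
congr (_ * _); apply: eq_bigr => k _; case: (eqVneq k j) => [->|/zz' ->//].
by rewrite aj.
Qed.

(** The polydisc is chosen from [h] alone, before [f]: later the same one must serve for [z_j ^ nu]
    and for an arbitrary dividend. *)
Lemma weierstrass_division r0 ch Mh h nu : 0 < r0 -> ser (cvec n r0) ch Mh h ->
  (forall k, (k < nu)%N -> ch (msing j k) = 0) -> ch (msing j nu) != 0 ->
  exists2 rho, pos rho /\ pd (cvec n r0) rho &
    forall cf Mf f, ser rho cf Mf f ->
    exists q (rr : nat -> 'rV[C]_n -> C),
    [/\ exists c M, ser rho c M q, forall i, exists c M, ser rho c M (rr i),
      forall i z z', pd rho z -> pd rho z' -> (forall k, k != j -> z 0 k = z' 0 k) ->
        rr i z = rr i z' &
      forall z, pd rho z -> f z = q z * h z + \sum_(i < nu) rr i z * z 0 j ^+ i].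
Proof.
move=> r00 hh h0 u0; have [rho [rho0 rr0 [N kN Nle]]] := regular_radius r00 hh.1 h0 u0.
exists rho => // cf Mf f ff; have hh' := ser_shrink rr0 hh.
have [qc [[Mq qM] qE]] := weierstrass_division_coef rho0 hh'.1 ff.1 u0 kN Nle.
have [q Hq] := ser_exists cptC qM.
have HR := serD ff (serZ (-1) (serM cptC Hq hh')).
have [|rr [Hrr ERR]] := ser_slices (nu := nu) rho0 HR.
  move=> a; have := qE a; rewrite /mshift => ->; by rewrite mulN1r subrr.
exists q, rr; split.
- by exists qc, Mq.
- by move=> i; have [P HP] := Hrr i; eexists; exists P; exact: HP.
- by move=> i z z' rz rz' zz'; have [P HP] := Hrr i; exact: mslice_indep HP.
- by move=> z rz; rewrite -ERR// mulN1r subrKC.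
Qed.

End WeierstrassDivision.

(** * Weierstrass preparation *)

#[local] Existing Instance totally_filter.

Section ComplexPolynomials.
Variable C : numClosedFieldType.

Lemma poly_lip (p : {poly C}) a : exists2 K, 0 <= K &
  forall t, `|t - a| <= 1 -> `|p.[t] - p.[a]| <= K * `|t - a|.
Proof.
have : root (p - p.[a]%:P) a by rewrite /root hornerD hornerN hornerC subrr.
move=> /factor_theorem[q E].
exists (\sum_(i < size q) `|q`_i| * (`|a| + 1) ^+ i).
  by rewrite sumr_ge0// => i _; rewrite mulr_ge0// exprn_ge0// addr_ge0.
move=> t ta; have -> : p.[t] - p.[a] = q.[t] * (t - a).
  by have := congr1 (horner^~ t) E; rewrite hornerD hornerN hornerC hornerM hornerXsubC.
rewrite normrM ler_wpM2r// horner_coef (le_trans (ler_norm_sum _ _ _))//.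
apply: ler_sum => i _; rewrite normrM normrX ler_wpM2l// lerXn2r ?nnegrE ?addr_ge0//.
by rewrite -[t](subrKC a) (le_trans (ler_normD _ _))// lerD2l.
Qed.

Lemma bounded_poly_dvd (rs : seq C) (r : {poly C}) (M tau : C) : 0 <= M ->
  (forall a, a \in rs -> `|a| < tau) ->
  (forall t, `|t| <= tau -> `|r.[t]| <= M * `|(\prod_(a <- rs) ('X - a%:P)).[t]|) ->
  \prod_(a <- rs) ('X - a%:P) %| r.
Proof.
move=> M0; elim: rs r => [|a rs IH] r rst H; first by rewrite big_nil dvd1p.
have at_ : `|a| < tau by rewrite rst// mem_head.
have ra : root r a.
  have := H a (ltW at_); rewrite big_cons hornerM hornerXsubC subrr mul0r normr0 mulr0.
  by rewrite normr_le0.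
have [r1 E] := factor_theorem _ _ ra.
rewrite big_cons E mulrC dvdp_mul2r ?polyXsubC_eq0//.
apply: IH => [b brs|]; first by rewrite rst// inE brs orbT.
set p := \prod_(b <- rs) ('X - b%:P).
have H1 t : `|t| <= tau -> t != a -> `|r1.[t]| <= M * `|p.[t]|.
  move=> tt ta; have := H t tt; rewrite E big_cons !hornerM hornerXsubC !normrM.
  by rewrite mulrC mulrCA ler_pM2l// normr_gt0 subr_eq0.
move=> t tt; have [->|ta] := eqVneq t a; last exact: H1.
have [K K0 HK] := poly_lip r1 a; have [L L0 HL] := poly_lip p a.
apply/ler_addgt0Pr => e e0.
have KL : 0 <= K + M * L by rewrite addr_ge0// mulr_ge0.
have [s [s0 s1]] := small_radius (@ltr01 C) KL e0; rewrite divr1 => sKL.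
have ta0 : 0 < tau - `|a| by rewrite subr_gt0.
have [u [u0 us ut]] := pos_min s0 ta0.
have ua : `|a + u - a| = u by rewrite addrC addKr gtr0_norm.
have u1 : `|a + u - a| <= 1 by rewrite ua (le_trans us).
have auT : `|a + u| <= tau.
  by rewrite (le_trans (ler_normD _ _))// (gtr0_norm u0) -lerBrDl.
have aun : a + u != a by rewrite -subr_eq0 -normr_gt0 ua.
have X := HK _ u1; have Y := HL _ u1; rewrite ua in X Y.
have -> : r1.[a] = r1.[a + u] - (r1.[a + u] - r1.[a]) by ring.
rewrite (le_trans (ler_normB _ _))//.
have Z : `|p.[a + u]| <= `|p.[a]| + L * u.
  have -> : p.[a + u] = p.[a] + (p.[a + u] - p.[a]) by ring.
  by rewrite (le_trans (ler_normD _ _))// lerD2l.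
apply: le_trans (lerD (le_trans (H1 _ auT aun) (ler_wpM2l M0 Z)) X) _.
have -> : M * (`|p.[a]| + L * u) + K * u = M * `|p.[a]| + u * (K + M * L) by ring.
by rewrite lerD2l (le_trans _ sKL)// ler_wpM2r.
Qed.

Lemma bounded_monic_dvd (p r : {poly C}) (M tau : C) : 0 <= M -> p \is monic ->
  (forall a, root p a -> `|a| < tau) ->
  (forall t, `|t| <= tau -> `|r.[t]| <= M * `|p.[t]|) -> p %| r.
Proof.
move=> M0 pm pt H; have [rs E] := closed_field_poly_normal p.
rewrite (monicP pm) scale1r in E; rewrite E; apply: (bounded_poly_dvd M0 (tau := tau)).
  by move=> a ars; apply: pt; rewrite E root_prod_XsubC.
by rewrite -E.
Qed.

(** The [s i] come from the remainder of [z_j ^ nu] under division, hence the minus sign. *)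
Definition wpoly (nu : nat) (s : nat -> C) : {poly C} := 'X^nu - \poly_(i < nu) s i.

Lemma wpolyE nu s t : (wpoly nu s).[t] = t ^+ nu - \sum_(i < nu) s i * t ^+ i.
Proof. by rewrite hornerD hornerN hornerXn horner_poly. Qed.

Lemma size_wpoly nu s : size (wpoly nu s) = nu.+1.
Proof.
by rewrite size_polyDl size_polyXn// size_polyN ltnS size_poly.
Qed.

Lemma wpoly_monic nu s : wpoly nu s \is monic.
Proof.
by rewrite monicE lead_coefDl ?lead_coefXn// size_polyN size_polyXn ltnS size_poly.
Qed.

(** If [tau <= |t|], then [|t| ^ i <= (|t| / tau) ^ nu] for [i < nu] because [tau <= 1], and the
    equation for [t] would give [tau ^ nu <= sum |s i|]. *)
Lemma wpoly_root nu (s : nat -> C) (t tau : C) : 0 < tau -> tau <= 1 ->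
  \sum_(i < nu) `|s i| < tau ^+ nu -> root (wpoly nu s) t -> `|t| < tau.
Proof.
move=> tau0 tau1 H; rewrite /root wpolyE subr_eq0 => /eqP E.
rewrite real_ltNge ?normr_real ?gtr0_real//; apply/negP => tt.
have t0 : 0 < `|t| := lt_le_trans tau0 tt.
have : `|t| ^+ nu <= (\sum_(i < nu) `|s i|) * (`|t| ^+ nu / tau ^+ nu).
  rewrite -[leLHS]normrX [in leLHS]E mulr_suml (le_trans (ler_norm_sum _ _ _))//.
  apply: ler_sum => i _; rewrite normrM ler_wpM2l// normrX -expr_div_n.
  have q1 : 1 <= `|t| / tau by rewrite ler_pdivlMr// mul1r.
  apply: le_trans (_ : (`|t| / tau) ^+ i <= _); last by rewrite ler_weXn2l// ltnW.
  rewrite lerXn2r ?nnegrE ?divr_ge0 ?(ltW tau0)//.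
  by rewrite ler_pdivlMr// ler_piMr.
apply/negP; rewrite lt_geF// mulrCA -[ltRHS]mulr1 ltr_pM2l ?exprn_gt0//.
by rewrite ltr_pdivrMr ?exprn_gt0// mul1r.
Qed.

End ComplexPolynomials.

(** * Linear coordinates adapted to a direction *)

Section Shear.
Variable C : numClosedFieldType.
Variables (n : nat) (j : 'I_n).
Implicit Types (v z : 'rV[C]_n) (c : multi_index n -> C).

Definition ej : 'rV[C]_n := delta_mx 0 j.

(** Sends the [j]-th basis vector to [v] and fixes the others, so lines of direction [v] are pulled
    back to parallels of the [j]-th axis. It is invertible when [v 0 j != 0]. *)
Definition shear v z : 'rV[C]_n := z + z 0 j *: (v - ej).
Definition unshear v z : 'rV[C]_n := z - (z 0 j / v 0 j) *: (v - ej).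

Lemma ejE i : ej 0 i = (i == j)%:R.
Proof. by rewrite mxE eqxx. Qed.

Lemma shearK v : v 0 j != 0 -> cancel (shear v) (unshear v).
Proof.
move=> vj z; apply/rowP => i; rewrite !mxE !eqxx /=; field; exact: vj.
Qed.

Lemma unshearK v : v 0 j != 0 -> cancel (unshear v) (shear v).
Proof.
move=> vj z; apply/rowP => i; rewrite !mxE !eqxx /=; field; exact: vj.
Qed.

Lemma shear0 v : shear v 0 = 0.
Proof. by rewrite /shear mxE scale0r addr0. Qed.

Lemma unshear0 v : unshear v 0 = 0.
Proof. by rewrite /unshear mxE mul0r scale0r subr0. Qed.

Lemma shear_ej v z t : shear v (z + t *: ej) = shear v z + t *: v.
Proof. by apply/rowP => i; rewrite !mxE !eqxx /=; ring. Qed.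

Definition zset z t : 'rV[C]_n := \row_i (if i == j then t else z 0 i).

Lemma zset_id z : zset z (z 0 j) = z.
Proof. by apply/rowP => i; rewrite mxE; case: eqP => // ->. Qed.

Lemma zset_ej z t : zset z t = z + (t - z 0 j) *: ej.
Proof.
apply/rowP => i; rewrite !mxE eqxx; case: eqP => [->|] /=; last by rewrite mulr0 addr0.
by rewrite mulr1 subrKC.
Qed.

Lemma zsetj z t : zset z t 0 j = t.
Proof. by rewrite mxE eqxx. Qed.

Lemma zset_neq z t i : i != j -> zset z t 0 i = z 0 i.
Proof. by rewrite mxE => /negbTE ->. Qed.

Lemma pd_zset rho z t : pd rho z -> `|t| <= rho 0 j -> pd rho (zset z t).
Proof. by move=> rz rt i; rewrite mxE; case: eqP => [->|]. Qed.

Lemma hpart_ej c k : hpart c k ej = c (msing j k).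
Proof.
have M : msing j k \in mdegset n k by rewrite in_mdegset mdeg_sing.
rewrite /hpart (big_fsetD1 _ M)/= monomial_sing ejE eqxx expr1n mulr1.
rewrite big1_seq ?addr0// => a; rewrite !inE in_mdegset => /and3P[_ ak /eqP ad].
have [i [ij ai]] : exists i, i != j /\ a i != 0%N.
  apply: contrapT => H; case/eqP: ak.
  have a0 i : i != j -> a i = 0%N.
    by move=> ij; apply/eqP; apply: contraT => ai; case: H; exists i.
  apply/ffunP => i; rewrite ffunE; case: eqP => [->|/eqP/a0 //].
  by rewrite -ad /mdeg (bigD1 j)//= big1 ?addn0// => i' /a0.
by rewrite /monomial (bigD1 i)//= ejE (negbTE ij) expr0n (negbTE ai) mul0r mulr0.
Qed.

End Shear.

(** * The preparation theorem *)

Section Preparation.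
Variable C : numClosedFieldType.
Hypothesis cptC : disc_compact C.
Variables (n : nat) (j : 'I_n).
Implicit Types (v z : 'rV[C]_n) (c : multi_index n -> C).

Lemma holomorphicB (h k : 'rV[C]_n -> C) z0 : holomorphic_at h z0 ->
  holomorphic_at k z0 -> holomorphic_at (fun z => h z - k z) z0.
Proof.
move=> H K; apply: (holomorphic_ext (h := fun z => h z + (-1) * k z)).
  by near=> z; rewrite mulN1r.
apply: holomorphicD => //; apply: holomorphicM => //; exact: holomorphic_cst.
Unshelve. all: by end_near. Qed.

Lemma holomorphic_shear v z0 i : holomorphic_at (fun z => shear j v z 0 i) z0.
Proof.
apply: (holomorphic_ext (h := fun z => z 0 i + z 0 j * (v 0 i - ej C j 0 i))).
  by near=> z; rewrite !mxE.
apply: holomorphicD; first exact: holomorphic_coord.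
apply: holomorphicM => //; [exact: holomorphic_coord|exact: holomorphic_cst].
Unshelve. all: by end_near. Qed.

Lemma holomorphic_unshear v z0 i : holomorphic_at (fun z => unshear j v z 0 i) z0.
Proof.
apply: (holomorphic_ext (h := fun z => z 0 i - z 0 j * ((v 0 i - ej C j 0 i) / v 0 j))).
  by near=> z; rewrite !mxE; ring.
apply: holomorphicB; first exact: holomorphic_coord.
apply: holomorphicM => //; [exact: holomorphic_coord|exact: holomorphic_cst].
Unshelve. all: by end_near. Qed.

Lemma lead_line r c M h m v : 0 < r -> ser (cvec n r) c M h ->
  (forall k, (k < m)%N -> hpart c k v = 0) -> lead h m v (hpart c m v).
Proof.
move=> r0 ch c0; have [s [s0 sv]] := vec_scale v r0.
have L := ser_line cptC s0 sv ch.
exists (M / s ^+ m.+1), s; split=> //.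
  by rewrite divr_ge0 ?(absb_ge0 ch.1)// exprn_ge0// ltW.
by move=> t ts; exact: (ser1_lead s0 L).
Qed.

Lemma lead_same (h : 'rV[C]_n -> C) m v A B : lead h m v A -> lead h m v B -> A = B.
Proof.
move=> [K [d [K0 d0 H]]] [L [e [L0 e0 G]]]; apply/eqP; rewrite -subr_eq0; apply/eqP.
have [s [s0 sd se]] := pos_min d0 e0.
apply: (@le_littleo _ _ (L + K) s m m.+1) => // [|t t0 ts]; first by rewrite addr_ge0.
have -> : (A - B) * t ^+ m = (h (t *: v) - B * t ^+ m) - (h (t *: v) - A * t ^+ m) by ring.
rewrite (le_trans (ler_normB _ _))// mulrDl lerD//.
- by have := G t; rewrite (gtr0_norm t0); apply; exact: le_trans se.
- by have := H t; rewrite (gtr0_norm t0); apply; exact: le_trans sd.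
Qed.

Lemma lead_regular r c M h m A : 0 < r -> ser (cvec n r) c M h ->
  lead h m (ej C j) A -> A != 0 ->
  (forall k, (k < m)%N -> c (msing j k) = 0) /\ c (msing j m) != 0.
Proof.
move=> r0 ch L A0.
have c0 k : (k < m)%N -> c (msing j k) = 0.
  elim/ltn_ind: k => k IH km; rewrite -hpart_ej.
  apply: (lead_uniq km _ L); apply: lead_line r0 ch _ => i ik.
  by rewrite hpart_ej; apply: IH => //; exact: ltn_trans km.
split=> //; rewrite -hpart_ej.
have H : lead h m (ej C j) (hpart c m (ej C j)).
  by apply: lead_line r0 ch _ => i im; rewrite hpart_ej c0.
by rewrite (lead_same H L).
Qed.

Lemma lead_shear (h : 'rV[C]_n -> C) m v A :
  lead h m v A -> lead (h \o shear j v) m (ej C j) A.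
Proof.
move=> [K [d [K0 d0 H]]]; exists K, d; split=> // t td.
by rewrite /= -[t *: ej C j]add0r shear_ej shear0 add0r H.
Qed.

(** Dividing [z_j ^ nu] by [h] leaves a remainder that must vanish on the axis; comparing orders
    there then makes [p] a unit. The division clause is returned as well, so that both statements
    hold on the same polydisc. *)
Lemma weierstrass_preparation r0 ch Mh h nu : 0 < r0 -> ser (cvec n r0) ch Mh h ->
  (forall k, (k < nu)%N -> ch (msing j k) = 0) -> ch (msing j nu) != 0 ->
  exists2 rho, pos rho /\ pd (cvec n r0) rho &
   (exists p (ss : nat -> 'rV[C]_n -> C),
    [/\ exists c M, ser rho c M p, forall i, exists c M, ser rho c M (ss i),
      forall i z z', pd rho z -> pd rho z' -> (forall k, k != j -> z 0 k = z' 0 k) ->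
        ss i z = ss i z',
      p 0 != 0 /\ (forall i, (i < nu)%N -> ss i 0 = 0) &
      forall z t, pd rho z -> `|t| <= rho 0 j ->
        (wpoly nu (ss^~ z)).[t] = p (zset j z t) * h (zset j z t)])
   /\
    forall cf Mf f, ser rho cf Mf f ->
    exists q (rr : nat -> 'rV[C]_n -> C),
    [/\ exists c M, ser rho c M q, forall i, exists c M, ser rho c M (rr i),
      forall i z z', pd rho z -> pd rho z' -> (forall k, k != j -> z 0 k = z' 0 k) ->
        rr i z = rr i z' &
      forall z, pd rho z -> f z = q z * h z + \sum_(i < nu) rr i z * z 0 j ^+ i].
Proof.
move=> r00 hh h0 u0.
have [rho [rho0 rr0] W] := weierstrass_division cptC r00 hh h0 u0.
exists rho => //; split=> //.
have HX : ser rho (fun a => if a == msing j nu then 1 else 0)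
    (`|1| * monomial (msing j nu) rho) (fun z => z 0 j ^+ nu).
  have := ser_monomial 1 (msing j nu) (pos_pd rho0); apply: ser_ext => z _.
  by rewrite mul1r monomial_sing.
have [p [ss [[cp [Mp pS]] sS sI E]]] := W _ _ _ HX.
have EP z t : pd rho z -> `|t| <= rho 0 j ->
    (wpoly nu (ss^~ z)).[t] = p (zset j z t) * h (zset j z t).
  move=> rz rt; rewrite wpolyE; have rzt := pd_zset rz rt.
  have := E _ rzt; rewrite zsetj => ->.
  under eq_bigr do rewrite (sI _ _ z rzt rz (fun k => @zset_neq _ _ _ _ _ _)).
  by rewrite addrK.
exists p, ss; split=> //; first by exists cp, Mp.
have hG : exists K d, [/\ 0 <= K, 0 < d & forall t, `|t| <= d -> `|h (t *: ej C j)| <= K * `|t| ^+ nu].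
  have L := lead_line r00 hh (m := nu) (v := ej C j).
  have [|K [d [K0 d0 H]]] := L; first by move=> k kn; rewrite hpart_ej h0.
  set A := hpart _ _ _ in H.
  have [e [e0 ed e1]] := pos_min d0 (@ltr01 C).
  exists (K + `|A|), e; split=> // [|t te]; first by rewrite addr_ge0.
  rewrite -[h _](subrK (A * t ^+ nu)) (le_trans (ler_normD _ _))// mulrDl lerD//.
    rewrite (le_trans (H _ (le_trans te ed)))// ler_wpM2l// ler_wiXn2l//.
    exact: le_trans e1.
  by rewrite normrM normrX.
have [K [d [K0 d0 H]]] := hG.
have pN z : pd rho z -> `|p z| <= Mp by move=> rz; exact: ser_norm rz pS.
have Mp0 : 0 <= Mp := absb_ge0 pS.1.
have z0 : pd rho 0 := pos_pd0 rho0.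
have zt t : zset j 0 t = t *: ej C j by rewrite zset_ej add0r mxE subr0.
have [e [e0 ed er]] := pos_min d0 (rho0 j).
have R0 : \poly_(i < nu) ss i 0 = 0.
  apply/eqP; apply: contraT => Rn0.
  (* On the axis [h] is [O(t ^ nu)], so the remainder is bounded by a multiple of [t ^ nu]; being of
     degree below [nu], it is 0. *)
  have : 'X^nu %| \poly_(i < nu) ss i 0.
    apply: (@bounded_monic_dvd _ _ _ (1 + Mp * K) e).
    - by rewrite addr_ge0// mulr_ge0.
    - exact: monicXn.
    - by move=> a; rewrite /root hornerXn expf_eq0 => /andP[_ /eqP ->]; rewrite normr0.
    move=> t te; have := EP 0 t z0 (le_trans te er); rewrite hornerD hornerN hornerXn zt => X.
    have -> : (\poly_(i < nu) ss i 0).[t] = t ^+ nu - p (t *: ej C j) * h (t *: ej C j).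
      by rewrite -X; ring.
    rewrite (le_trans (ler_normB _ _))// mulrDl mul1r lerD2l normrM -mulrA normrX.
    rewrite ler_pM//; last by rewrite H// (le_trans te).
    by apply: pN; rewrite -zt; apply: pd_zset => //; exact: le_trans er.
  move/dvdp_leq => /(_ Rn0); rewrite size_polyXn leqNgt => /negP; case.
  by rewrite ltnS size_poly.
have ss0 i : (i < nu)%N -> ss i 0 = 0.
  by move=> inu; have := congr1 (coefp i) R0; rewrite /= coef_poly inu coef0.
split=> //; apply/eqP => p0.
have [r [r1 rr]] := pos_lower rho0.
have pS' : ser (cvec n r) cp Mp p.
  by apply: ser_shrink pS => i; rewrite mxE gtr0_norm.
have [Kp [dp [Kp0 dp0 Hp]]] := ser_growth1 r1 pS' p0.
have [s [s0 se sp]] := pos_min e0 dp0.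
(* If [p] vanished at 0, then [t ^ nu], which equals [p h] on the axis, would be
   [O(t ^ (nu + 1))]. *)
have := @le_littleo _ 1 (Kp * K) s nu nu.+1.
move=> H1; have /eqP := oner_neq0 C; apply; apply: H1 => // [|t t0 ts].
  by rewrite mulr_ge0.
have tE := gtr0_norm t0.
have := EP 0 t z0; rewrite tE => /(_ (le_trans ts (le_trans se er))).
rewrite hornerD hornerN R0 horner0 subr0 hornerXn zt mul1r => ->.
rewrite normrM (_ : Kp * K * t ^+ nu.+1 = Kp * t ^+ 1 * (K * t ^+ nu)); last first.
  by rewrite exprS expr1; ring.
rewrite ler_pM//.
  apply: Hp => //; first exact: le_trans sp.
  move=> i; rewrite !mxE eqxx normrM tE; case: (i == j); rewrite ?normr1 ?mulr1// normr0 mulr0.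
  exact: ltW.
by have := H t; rewrite tE; apply; rewrite (le_trans ts) // (le_trans se).
Qed.

End Preparation.

(** * Bounded quotients of germs *)

#[local] Existing Instance totally_filter.

Section BoundedQuotient.
Variable C : numClosedFieldType.
Hypothesis cptC : disc_compact C.
Variables (n : nat) (j : 'I_n).
Implicit Types (v z : 'rV[C]_n) (c : multi_index n -> C).

(** The index [j] is fixed beforehand; asking for [v 0 j != 0] is what makes the shear towards [v]
    invertible. *)
Lemma regular_direction (h : 'rV[C]_n -> C) m : has_order h m ->
  exists v A, [/\ v 0 j != 0, A != 0 & lead h m v A].
Proof.
move=> [r [c [M [r0 ch c0 [v hv]]]]].
have [||||w hw wj] := @entire_common _ cptC _ (hpart c m) (fun z => z 0 j) v (ej C j).
- by move=> z; exact: holomorphic_hpart.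
- by move=> z; exact: holomorphic_coord.
- by [].
- by rewrite ejE eqxx oner_neq0.
by exists w, (hpart c m w); split=> //; exact: lead_of_ser r0 ch c0.
Qed.

Lemma holomorphic_comp_shear (h : 'rV[C]_n -> C) v : holomorphic_at h 0 ->
  holomorphic_at (h \o shear j v) 0.
Proof.
move=> hh; apply: holomorphic_comp => //; last by rewrite shear0.
by move=> i; exact: holomorphic_shear.
Qed.

Lemma holomorphic_comp_unshear (h : 'rV[C]_n -> C) v : holomorphic_at h 0 ->
  holomorphic_at (h \o unshear j v) 0.
Proof.
move=> hh; apply: holomorphic_comp => //; last by rewrite unshear0.
by move=> i; exact: holomorphic_unshear.
Qed.

Lemma near_comp (P : set 'rV[C]_n) (phi : 'rV[C]_n -> 'rV[C]_n) z0 :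
  (forall i, holomorphic_at (fun z => phi z 0 i) z0) ->
  (\forall z \near phi z0, P z) -> \forall z \near z0, P (phi z).
Proof.
move=> hphi /nbhs_pdP[r r0 H].
have [s Hs] := choice (fun i => holomorphic_small (hphi i) r0).
have [|t [t0 Ht]] := @pos_lower C _ (\row_i s i).
  by move=> i; rewrite mxE; have [] := Hs i.
apply/nbhs_pdP; exists t => // z zt; rewrite -(subrKC (phi z0) (phi (z0 + z))).
apply: H => i; have [_ /(_ t t0)] := Hs i; have := Ht i; rewrite mxE => ts /(_ ts)[c cP].
by rewrite !mxE; exact: ser_norm zt cP.
Qed.

Lemma near_unshear (P : set 'rV[C]_n) v : (\forall z \near (0 : 'rV[C]_n), P z) ->
  \forall z \near (0 : 'rV[C]_n), P (unshear j v z).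
Proof.
by move=> H; apply: near_comp; [move=> i; exact: holomorphic_unshear|rewrite unshear0].
Qed.

Lemma near_shear (P : set 'rV[C]_n) v : (\forall z \near (0 : 'rV[C]_n), P z) ->
  \forall z \near (0 : 'rV[C]_n), P (shear j v z).
Proof.
by move=> H; apply: near_comp; [move=> i; exact: holomorphic_shear|rewrite shear0].
Qed.

Lemma near_sum_small (ss : nat -> 'rV[C]_n -> C) nu tau : 0 < tau ->
  (forall i, holomorphic_at (ss i) 0) -> (forall i, (i < nu)%N -> ss i 0 = 0) ->
  \forall z \near (0 : 'rV[C]_n), \sum_(i < nu) `|ss i z| <= tau.
Proof.
move=> + ssH; elim: nu tau => [|nu IH] tau tau0 ss0.
  by near=> z; rewrite big_ord0 ltW.
have t20 : 0 < tau / 2 by rewrite divr_gt0.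
have H1 := IH _ t20 (fun i inu => ss0 i (ltnW inu)).
have H2 := holomorphic_cts (ssH nu) t20.
apply: filterS2 H1 H2 => z h1 h2; rewrite big_ord_recr/= [leRHS]splitr lerD//.
by rewrite ss0// subr0 in h2.
Unshelve. all: by end_near. Qed.

Lemma ser_holomorphic0 rho c M (f : 'rV[C]_n -> C) : pos rho -> ser rho c M f ->
  holomorphic_at f 0.
Proof.
move=> r0 cf; apply: (ser_holomorphic r0 (c := c) (M := M)).
by apply: ser_ext cf => z _; rewrite add0r.
Qed.

(* Weierstrass division by b leaves a remainder of degree < m in one variable.  For fixed
   values of the others it is dominated by b, hence by the Weierstrass polynomial of b, all
   of whose roots are close to 0; so that polynomial divides it, and the remainder is 0. *)
Lemma bounded_dvd (a b : 'rV[C]_n -> C) : holomorphic_at a 0 -> holomorphic_at b 0 ->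
  ~ germ_eq b (fun=> 0) -> (exists M, \forall z \near (0 : 'rV[C]_n), `|a z| <= M * `|b z|) ->
  germ_dvd b a.
Proof.
move=> ha hb b0 [M ab]; have [m bm] := order_exists hb b0.
have [v [A [vj A0 L]]] := regular_direction bm.
set a' := a \o shear j v; set b' := b \o shear j v.
have /holomorphic0P[ra [ca [Ma [ra0 Ha]]]] : holomorphic_at a' 0 by exact: holomorphic_comp_shear.
have /holomorphic0P[rb [cb [Mb [rb0 Hb]]]] : holomorphic_at b' 0 by exact: holomorphic_comp_shear.
have [r [r0 rra rrb]] := pos_min ra0 rb0.
have {}Ha := ser_shrink (pd_cst_le n (ltW r0) rra) Ha.
have {}Hb := ser_shrink (pd_cst_le n (ltW r0) rrb) Hb.
have [c0 cm] := lead_regular cptC r0 Hb (lead_shear j L) A0.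
have [rho [rho0 rrho] [[p [ss [[cp [Mp pS]] sS sI [p0 ss0] EP]]] D]] :=
  weierstrass_preparation cptC r0 Hb c0 cm.
have [q [rr [[cq [Mq qS]] rS rI ED]]] := D _ _ _ (ser_shrink rrho Ha).
have ssH i : holomorphic_at (ss i) 0.
  by have [c [N H]] := sS i; exact: ser_holomorphic0 H.
have /nbhs_pdP[r1 r10 H1] := near_shear v ab.
have /nbhs_pdP[r2 r20 H2] := holomorphic_neq0 (ser_holomorphic0 rho0 pS) p0.
have [r3 [r30 rr3]] := pos_lower rho0.
have [t1 [t10 t1r1 t1r2]] := pos_min r10 r20.
have [t2 [t20 t2t1 t2r3]] := pos_min t10 r30.
have [tau [tau0 taut2 tau1]] := pos_min t20 (@ltr01 C).
have tm0 : 0 < tau ^+ m / 2 by rewrite divr_gt0// exprn_gt0.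
have /nbhs_pdP[r4 r40 H4] := near_sum_small tm0 ssH ss0.
have [d [d0 dr4 dtau]] := pos_min r40 tau0.
have pdr z : pd (cvec n tau) z -> pd rho z.
  move=> zt i; have := zt i; rewrite mxE => /le_trans; apply.
  by rewrite (le_trans _ (rr3 i))// (le_trans taut2).
(* The given [M] carries no sign, hence its absolute value. *)
have M0 : 0 <= `|M| + Mq by rewrite addr_ge0// (absb_ge0 qS.1).
have EQ z : pd (cvec n d) z -> a' z = q z * b' z.
  move=> zd; have zt := pd_le dtau zd; have zr := pdr _ zt.
  suff R0 : \poly_(i < m) rr i z = 0.
    rewrite (ED _ zr) (_ : \sum_(i < m) _ = 0) ?addr0//.
    by have := horner_poly m (rr^~ z) (z 0 j); rewrite R0 horner0 => <-.
  apply/eqP; apply: contraT => Rn0.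
  have : wpoly m (ss^~ z) %| \poly_(i < m) rr i z.
    (* The remainder is at most [(|M| + Mq) |b'|], and [|b'|] is at most [2 / |p 0|] times [|p b'|],
       the modulus of the Weierstrass polynomial. *)
    apply: (@bounded_monic_dvd _ _ _ ((`|M| + Mq) * (2 / `|p 0|)) tau).
    - by rewrite mulr_ge0// divr_ge0.
    - exact: wpoly_monic.
    - move=> x; apply: wpoly_root => //; have := H4 z (pd_le dr4 zd); rewrite add0r.
      by move=> /le_lt_trans; apply; rewrite ltr_pdivrMr// ltr_pMr ?exprn_gt0// ltr1n.
    move=> t tt; have ztt : pd (cvec n tau) (zset j z t) by apply: pd_zset => //; rewrite mxE.
    have zrt := pdr _ ztt.
    have trj : `|t| <= rho 0 j by have := zrt j; rewrite zsetj.
    rewrite (EP _ _ zr trj) normrM.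
    have -> : (\poly_(i < m) rr i z).[t] = a' (zset j z t) - q (zset j z t) * b' (zset j z t).
      rewrite (ED _ zrt) horner_poly zsetj addrC addKr; apply: eq_bigr => i _.
      by rewrite (rI _ _ z zrt zr (fun k => @zset_neq _ _ _ _ _ _)).
    have B1 : `|a' (zset j z t)| <= M * `|b' (zset j z t)|.
      by have := H1 (zset j z t); rewrite add0r; apply; apply: pd_le ztt; rewrite (le_trans taut2)// (le_trans t2t1).
    have B2 : `|p 0| / 2 <= `|p (zset j z t)|.
      by have := H2 (zset j z t); rewrite add0r; apply; apply: pd_le ztt; rewrite (le_trans taut2)// (le_trans t2t1).
    have p00 : 0 < `|p 0| by rewrite normr_gt0.
    have B3 : `|b' (zset j z t)| <= 2 / `|p 0| * (`|p (zset j z t)| * `|b' (zset j z t)|).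
      rewrite mulrA ler_peMl// -ler_pdivrMl ?divr_gt0// mulr1 invfM invrK mulrC//.
    rewrite (le_trans (ler_normB _ _))//.
    apply: le_trans (_ : (`|M| + Mq) * `|b' (zset j z t)| <= _).
      rewrite mulrDl lerD//.
        apply: (le_trans B1); rewrite -[leLHS]ger0_norm; last first.
          by rewrite (le_trans _ B1).
        by rewrite normrM normr_id.
      by rewrite normrM ler_wpM2r// (ser_norm zrt qS).
    by rewrite -mulrA ler_wpM2l.
  move/dvdp_leq => /(_ Rn0); rewrite size_wpoly leqNgt => /negP; case.
  by rewrite ltnS size_poly.
exists (q \o unshear j v); first by apply: holomorphic_comp_unshear; exact: ser_holomorphic0 qS.
have : \forall z \near (0 : 'rV[C]_n), a' z = b' z * q z.
  by apply/nbhs_pdP; exists d => // z zd; rewrite add0r EQ// mulrC.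
move=> /(near_unshear v); apply: filterS => z.
by rewrite /a' /b' /= unshearK.
Qed.

(** Near 0 the constant 1 is bounded by a multiple of [|q|], so bounded division of 1 by [q] gives
    the inverse. *)
Lemma unit_inverse (q : 'rV[C]_n -> C) : holomorphic_at q 0 -> q 0 != 0 ->
  exists2 p, holomorphic_at p 0 & germ_eq (fun z => q z * p z) (fun=> 1).
Proof.
move=> hq q0; have [||||p hp E] := @bounded_dvd (fun=> 1) q.
- exact: holomorphic_cst.
- exact: hq.
- move=> /nbhs_pdP[r r0 /(_ 0)]; rewrite add0r => H; move: q0; rewrite H ?eqxx//.
  exact: (pd_cst0 (ltW r0)).
- exists (2 / `|q 0|); apply: filterS (holomorphic_neq0 hq q0) => z h.
  have p00 : 0 < `|q 0| by rewrite normr_gt0.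
  by rewrite normr1 -ler_pdivrMl ?divr_gt0// mulr1 invfM invrK mulrC.
by exists p => //; apply: filterS E => z ->.
Qed.

Lemma germ_unitP (q : 'rV[C]_n -> C) : holomorphic_at q 0 -> germ_unit q <-> q 0 != 0.
Proof.
move=> hq; split=> [[_ [p hp E]]|q0]; last by split=> //; exact: unit_inverse.
apply/eqP => q0; have := nbhs_singleton E; rewrite /= q0 mul0r => /eqP.
by rewrite eq_sym oner_eq0.
Qed.

Lemma order0 (q : 'rV[C]_n -> C) m : has_order q m -> (m == 0%N) = (q 0 != 0).
Proof.
move=> qm; have [r [c [M [r0 ch c0 [v hv]]]]] := qm.
apply/eqP/idP => [m0|q0]; last first.
  case: m c0 {hv qm} => // m c0; move: q0.
  rewrite (ser_coef0 (pos_cst n r0) ch) c0 ?eqxx//.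
  rewrite /mdeg big1// => i _; exact: ffunE.
apply/eqP => q0; have := growth_order cptC qm (ser_growth1 r0 ch q0).
by rewrite m0.
Qed.

(** Induction on the order: in a product of two nonunits both factors have positive order, and
    orders add. *)
Lemma irreducible_factor (d : 'rV[C]_n -> C) : holomorphic_at d 0 ->
  ~ germ_eq d (fun=> 0) -> d 0 = 0 -> exists2 p, germ_irreducible p & germ_dvd p d.
Proof.
move=> hd dn d0; have [m dm] := order_exists hd dn.
elim/ltn_ind: m d hd dn d0 dm => m IH d hd dn d0 dm.
have nu : ~ germ_unit d by rewrite germ_unitP// d0 eqxx.
case: (pselect (germ_irreducible d)) => [irr|nirr].
  exists d => //; exists (fun=> 1); first exact: holomorphic_cst.
  by apply: filterE => z; rewrite mulr1.
have [q [u [hq hu E qu]]] : exists q u, [/\ holomorphic_at q 0, holomorphic_at u 0,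
    germ_eq d (fun z => q z * u z) & ~ (germ_unit q \/ germ_unit u)].
  apply: contrapT => H; apply: nirr; split=> // q u hq hu E.
  by apply: contrapT => qu; apply: H; exists q, u.
have qn : ~ germ_eq q (fun=> 0).
  by move=> q0; apply: dn; apply: filterS2 E q0 => z -> ->; rewrite mul0r.
have un : ~ germ_eq u (fun=> 0).
  by move=> u0; apply: dn; apply: filterS2 E u0 => z -> ->; rewrite mulr0.
have q0 : q 0 = 0.
  apply/eqP; apply: contraT => q0; case: qu; left; exact/germ_unitP.
have u0 : u 0 = 0.
  apply/eqP; apply: contraT => u0; case: qu; right; exact/germ_unitP.
have [k qk] := order_exists hq qn; have [l ul] := order_exists hu un.
have ml : m = (k + l)%N.
  have E' : germ_eq (fun z => q z * u z) d by apply: filterS E => z ->.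
  exact: (has_order_uniq cptC dm (has_order_ext E' (has_orderM cptC qk ul))).
have l0 : (0 < l)%N by rewrite lt0n (order0 ul) u0 eqxx.
have km : (k < m)%N by rewrite ml -[ltnLHS]addn0 ltn_add2l.
have [p pirr [w hw Ew]] := IH k km q hq qn q0 qk.
exists p => //; exists (fun z => w z * u z); first exact: holomorphicM.
by apply: filterS2 E Ew => z -> ->; rewrite mulrA.
Qed.

(** Reducedness only speaks of irreducible squares; an irreducible factor [p] of [d] turns a factor
    [d ^ 2] into a factor [p ^ 2]. *)
Lemma reduced_no_square (h d : 'rV[C]_n -> C) : reduced_germ h ->
  holomorphic_at d 0 -> d 0 = 0 -> ~ germ_dvd (fun z => d z ^+ 2) h.
Proof.
move=> [hh h0 hn red] hd d0 [q hq E].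
have dn : ~ germ_eq d (fun=> 0).
  by move=> d00; apply: hn; apply: filterS2 E d00 => z -> ->; rewrite expr0n mul0r.
have [p pirr [w hw Ew]] := irreducible_factor hd dn d0.
apply: (red p pirr); exists (fun z => w z ^+ 2 * q z).
  by apply: holomorphicM => //; exact: holomorphicX.
by apply: filterS2 E Ew => z -> ->; rewrite exprMn mulrA.
Qed.

End BoundedQuotient.

(** * The ring of power series converging on a polydisc *)

#[local] Existing Instance totally_filter.

Section SeriesRing.
Variables (C : numClosedFieldType) (cptC : disc_compact C) (n : nat).
Variables (rho : 'rV[C]_n) (rho0 : pos rho).

Definition polydisc := {z : 'rV[C]_n | pd rho z}.

(* The two proofs are arguments so that the subring instance, whose proof needs them,
   can be found by unification. *)
Definition is_series of disc_compact C & pos rho : {pred (polydisc -> C)} :=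
  fun f => `[< exists c M g, ser rho c M g /\ forall z : polydisc, f z = g (sval z) >].

Lemma is_series_subring : GRing.subring_closed (is_series cptC rho0).
Proof.
split=> [|f g /asboolP[c [M [f' [cf Ef]]]] /asboolP[d [N [g' [dg Eg]]]]
  |f g /asboolP[c [M [f' [cf Ef]]]] /asboolP[d [N [g' [dg Eg]]]]]; apply/asboolP.
- by have [c cP] := ser_cst 1 (pos_pd rho0); exists c, `|1|, (fun=> 1).
- exists (fun a => c a + -1 * d a), (M + `|-1| * N), (fun z => f' z + -1 * g' z).
  split; first exact: serD cf (serZ (-1) dg).
  by move=> z; rewrite -Ef -Eg mulN1r.
- exists (mconv c d), (M * N), (fun z => f' z * g' z).
  by split; [exact: serM|move=> z; rewrite -Ef -Eg].
Qed.

HB.instance Definition _ :=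
  GRing.isSubringClosed.Build (polydisc -> C) (is_series cptC rho0) is_series_subring.

(** Series are represented by their values on the polydisc instead of their coefficients: the ring
    laws are inherited from functions and evaluation at a point is a morphism by computation. *)
Record convser := Series { series_fun : polydisc -> C; _ : series_fun \in is_series cptC rho0 }.

HB.instance Definition _ := [isSub for series_fun].
HB.instance Definition _ := [Choice of convser by <:].
HB.instance Definition _ := GRing.SubChoice_isSubComPzRing.Build _ _ convser (subringClosedP _).

Definition polydisc0 : polydisc := exist _ 0 (pos_pd0 rho0).

Lemma series_oner_neq0 : (1 : convser) != 0.
Proof.
apply/eqP => /(congr1 series_fun) /(congr1 (fun f => f polydisc0)).
by move=> /eqP; rewrite oner_eq0.
Qed.

HB.instance Definition _ := GRing.PzSemiRing_isNonZero.Build convser series_oner_neq0.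

Definition series_unit : pred convser := fun f => `[< exists g, g * f = 1 >].
Definition series_inv (f : convser) : convser :=
  if pselect (exists g, g * f = 1) is left h then sval (cid h) else f.

Lemma series_mulVr : {in series_unit, left_inverse 1 series_inv *%R}.
Proof.
move=> f /asboolP h; rewrite /series_inv; case: pselect => // h'.
by case: (cid h').
Qed.

Lemma series_unitP (f g : convser) : g * f = 1 -> series_unit f.
Proof. by move=> h; apply/asboolP; exists g. Qed.

Lemma series_inv_out : {in [predC series_unit], series_inv =1 id}.
Proof.
move=> f /negP h; rewrite /series_inv; case: pselect => // h'.
by case: h; apply/asboolP.
Qed.

HB.instance Definition _ := GRing.ComNzRing_hasMulInverse.Build convser
  series_mulVr series_unitP series_inv_out.

Lemma seriesP (f : convser) : exists c M g,
  ser rho c M g /\ forall z : polydisc, series_fun f z = g (sval z).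
Proof. by case: f => f /= /asboolP. Qed.

Lemma polydisc_inner_radius : exists2 r, 0 < r & pd rho (cvec n r).
Proof.
have [r [r0 rr]] := pos_lower rho0; exists r => // i.
by rewrite mxE gtr0_norm.
Qed.

Lemma ser_zero c M g : ser rho c M g -> germ_eq g (fun=> 0) ->
  forall z, pd rho z -> g z = 0.
Proof.
move=> cg g0 z rz; have [r r0 rr] := polydisc_inner_radius.
have c0 := ser_uniq cptC r0 (ser_shrink rr cg) g0.
by apply: sumto_unique (cg.2 z rz) _; apply: eq_sumto (@sumto0 C _) => a; rewrite c0 mul0r.
Qed.

(** Two nonzero germs have orders, and the sum of these is an order of the product. *)
Lemma germ_mul_eq0 (f g : 'rV[C]_n -> C) : holomorphic_at f 0 -> holomorphic_at g 0 ->
  germ_eq (fun z => f z * g z) (fun=> 0) -> germ_eq f (fun=> 0) \/ germ_eq g (fun=> 0).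
Proof.
move=> hf hg fg; apply: contrapT => /not_orP[f0 g0].
have [k fk] := order_exists hf f0; have [l gl] := order_exists hg g0.
exact: (has_order_nz cptC (has_orderM cptC fk gl)).
Qed.

Lemma series_idomain : GRing.integral_domain_axiom convser.
Proof.
move=> f g fg; have [c [M [f' [cf Ef]]]] := seriesP f; have [d [N [g' [dg Eg]]]] := seriesP g.
have [r r0 rr] := polydisc_inner_radius.
have fg0 : germ_eq (fun z => f' z * g' z) (fun=> 0).
  apply/nbhs_pdP; exists r => // z zr; rewrite add0r.
  have rz : pd rho z := pd_trans zr rr.
  have := congr1 (fun h => series_fun h (exist _ z rz)) fg.
  by rewrite -[LHS]/(series_fun f (exist _ z rz) * series_fun g (exist _ z rz)) Ef Eg.
have hf := ser_holomorphic0 rho0 cf; have hg := ser_holomorphic0 rho0 dg.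
have [f0|g0] := germ_mul_eq0 hf hg fg0; apply/orP; [left|right]; apply/eqP/val_inj/funext => -[z rz].
- by rewrite /= Ef (ser_zero cf).
- by rewrite /= Eg (ser_zero dg).
Qed.

HB.instance Definition _ := GRing.ComUnitRing_isIntegral.Build convser series_idomain.

Definition series_ev (z : polydisc) (f : convser) : C := series_fun f z.

Lemma series_ev_zmod z : zmod_morphism (series_ev z).
Proof. by []. Qed.

Lemma series_ev_monoid z : monoid_morphism (series_ev z).
Proof. by []. Qed.

HB.instance Definition _ z := GRing.isZmodMorphism.Build convser C (series_ev z) (series_ev_zmod z).
HB.instance Definition _ z := GRing.isMonoidMorphism.Build convser C (series_ev z) (series_ev_monoid z).

Lemma series_of c M g : ser rho c M g ->
  exists f : convser, forall z : polydisc, series_ev z f = g (sval z).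
Proof.
move=> cg; have H : (fun z : polydisc => g (sval z)) \in is_series cptC rho0.
  by apply/asboolP; exists c, M, g.
by exists (Series H).
Qed.

End SeriesRing.

(** * The discriminant *)

#[local] Existing Instance totally_filter.

(** * Square factors of polynomials over a domain of characteristic zero *)

Section SquareFactor.
Import Pdiv.Idomain.
Variable R : idomainType.
Hypothesis char0 : forall k, (k.+1)%:R != 0 :> R.

Lemma deriv_eq0 (p : {poly R}) : p^`() = 0 -> (size p <= 1)%N.
Proof.
move=> p0; rewrite leqNgt; apply/negP => sp.
have pn0 : p != 0 by rewrite -size_poly_gt0 ltnW.
have := congr1 (fun q : {poly R} => q`_((size p).-2)) p0; rewrite coef0 coef_deriv.
move: (lead_coefE p); case: (size p) sp => [|[|k]]//= _ E.
by rewrite -E -mulr_natl => /eqP; rewrite mulf_eq0 (negbTE (char0 _)) lead_coef_eq0 (negbTE pn0).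
Qed.

Lemma square_factor (P : {poly R}) : P != 0 -> (1 < size (gcdp P P^`()))%N ->
  exists (c : R) (E H : {poly R}), [/\ c != 0, (1 < size H)%N & c *: P = E * H ^+ 2].
Proof.
(* Q := P / G is the product of the distinct irreducible factors of P, so gcd (Q, G) is
   the product of the multiple ones. *)
set G := gcdp _ _ => P0 sG.
have G0 : G != 0 by rewrite -size_poly_gt0 (ltn_trans _ sG).
(* Over a domain, divisibility holds up to a nonzero constant; [c1], [c2] and [c3] collect these
   constants. *)
have /dvdpP[[c1 Q]/= c10 EQ] : G %| P by exact: dvdp_gcdl.
have GP' : G %| P^`() by exact: dvdp_gcdr.
set H := gcdp Q G.
have /dvdpP[[c2 Q1]/= c20 EQ1] : H %| Q by exact: dvdp_gcdl.
have /dvdpP[[c3 G1]/= c30 EG1] : H %| G by exact: dvdp_gcdr.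
exists (c1 * (c2 * c3)), (Q1 * G1), H; split.
- by rewrite !mulf_neq0.
(* If [H] were constant, [G] would be coprime to [Q]. As [G] divides [P'], the product rule makes it
   divide [Q G'], hence [G'], which is nonzero of smaller size. *)
- rewrite ltnNge; apply/negP => sH.
  have H0 : H != 0 by rewrite gcdp_eq0 negb_and G0 orbT.
  have cQG : coprimep G Q.
    by rewrite coprimep_sym /coprimep eqn_leq sH size_poly_gt0.
  have D : c1 *: P^`() = Q^`() * G + Q * G^`() by rewrite -derivZ EQ derivM.
  have : G %| Q * G^`().
    by rewrite -(dvdp_addr _ (dvdp_mull Q^`() (dvdpp G))) -D dvdpZr.
  rewrite Gauss_dvdpr// => GG'.
  have G'0 : G^`() != 0.
    by apply/eqP => /deriv_eq0; rewrite leqNgt sG.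
  by have := dvdp_leq G'0 GG'; rewrite leqNgt lt_size_deriv.
- transitivity ((c2 *: Q) * (c3 *: G)); last by rewrite EQ1 EG1 mulrACA expr2.
  by rewrite -scalerAl -scalerAr scalerA -EQ scalerA mulrC.
Qed.

End SquareFactor.

Section NumericFactors.
Variable C : numClosedFieldType.

(** The roots of [F] are among those of [P], so each linear factor of [F] has modulus at most
    [tau + tau] on the disc. *)
Lemma factor_bound (F P : {poly C}) (tau t : C) : 0 < tau -> P != 0 ->
  (forall x, root P x -> `|x| <= tau) -> F %| P -> `|t| <= tau ->
  `|F.[t]| <= `|lead_coef F| * (tau + tau) ^+ (size F).-1.
Proof.
move=> tau0 P0 Pr FP tt; have F0 : F != 0 by apply: contraNneq P0 => F0; rewrite F0 dvd0p in FP.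
have [rs E] := closed_field_poly_normal F.
have sF : (size F).-1 = size rs by rewrite E size_scale ?lead_coef_eq0// size_prod_XsubC.
have rsr x : x \in rs -> `|x| <= tau.
  move=> xrs; apply: Pr; have /dvdpP[q ->] := FP; rewrite rootM; apply/orP; right.
  by rewrite E rootZ ?lead_coef_eq0// root_prod_XsubC.
rewrite {1}E hornerZ normrM ler_wpM2l// sF horner_prod normr_prod.
elim: rs rsr {E sF} => [|x rs IH] H; first by rewrite big_nil expr0.
rewrite big_cons exprS ler_pM//; last by apply: IH => y yrs; rewrite H// inE yrs orbT.
  by rewrite prodr_ge0.
by rewrite hornerXsubC (le_trans (ler_normB _ _))// lerD// H// mem_head.
Qed.


End NumericFactors.

(** The images of the leading coefficients being nonzero, no size drops and the Sylvester matrix is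
    mapped entry by entry. *)
Lemma resultant_map (aR rR : nzRingType) (f : {rmorphism aR -> rR}) (p q : {poly aR}) :
  f (lead_coef p) != 0 -> f (lead_coef q) != 0 ->
  f (resultant p q) = resultant (map_poly f p) (map_poly f q).
Proof.
move=> nz_fp nz_fq; rewrite /resultant /Sylvester_mx !size_map_poly_id0//.
rewrite -det_map_mx /= map_col_mx; congr (\det (col_mx _ _));
  by apply: map_lin1_mx => v; rewrite map_poly_rV rmorphM /= map_rVpoly.
Qed.

(** * The discriminant of the Weierstrass polynomial of a germ without square factors *)

Section Discriminant.
Variables (C : numClosedFieldType) (cptC : disc_compact C) (n : nat) (j : 'I_n).
Variables (rho : 'rV[C]_n) (rho0 : pos rho).
Variables (nu : nat) (p h : 'rV[C]_n -> C) (ss : nat -> 'rV[C]_n -> C).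
Hypothesis nu0 : (0 < nu)%N.
Hypothesis pS : exists c M, ser rho c M p.
Hypothesis hS : exists c M, ser rho c M h.
Hypothesis sS : forall i, exists c M, ser rho c M (ss i).
Hypothesis p0 : p 0 != 0.
Hypothesis ss0 : forall i, (i < nu)%N -> ss i 0 = 0.
Hypothesis EP : forall z t, pd rho z -> `|t| <= rho 0 j ->
  (wpoly nu (ss^~ z)).[t] = p (zset j z t) * h (zset j z t).
Hypothesis nosq : forall d : 'rV[C]_n -> C, holomorphic_at d 0 -> d 0 = 0 ->
  ~ germ_dvd (fun z => d z ^+ 2) h.

Local Notation A := (convser cptC rho0).

Lemma series_char0 k : (k.+1)%:R != 0 :> A.
Proof.
apply/eqP => /(congr1 (series_ev (polydisc0 rho0))).
by rewrite rmorph_nat rmorph0 => /eqP; rewrite pnatr_eq0.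
Qed.

Lemma near_pd : \forall z \near (0 : 'rV[C]_n), pd rho z.
Proof.
have [r r0 rr] := polydisc_inner_radius rho0; apply/nbhs_pdP; exists r => // z zr.
by rewrite add0r; exact: pd_trans zr rr.
Qed.

Lemma near_coord (tau : C) : 0 < tau -> \forall z \near (0 : 'rV[C]_n), `|(z : 'rV[C]_n) 0 j| <= tau.
Proof.
by move=> t0; apply/nbhs_pdP; exists tau => // z /(_ j); rewrite add0r mxE.
Qed.

Lemma near_roots (tau : C) : 0 < tau -> \forall z \near (0 : 'rV[C]_n),
  forall x, root (wpoly nu (ss^~ z)) x -> `|x| <= tau.
Proof.
move=> t0; have [s [s0 st s1]] := pos_min t0 (@ltr01 C).
have sn0 : 0 < s ^+ nu / 2 by rewrite divr_gt0// exprn_gt0.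
have ssH i : holomorphic_at (ss i) 0 by have [c [M H]] := sS i; exact: ser_holomorphic0 H.
apply: filterS (near_sum_small sn0 ssH ss0) => z hz x rx.
apply: le_trans st; apply: ltW; apply: wpoly_root rx => //.
by rewrite (le_lt_trans hz)// ltr_pdivrMr// ltr_pMr ?exprn_gt0// ltr1n.
Qed.

Lemma no_square_factor (S : nat -> A) (c : A) (E H : {poly A}) :
  (forall i (z : polydisc rho), series_ev z (S i) = ss i (sval z)) ->
  c != 0 -> (1 < size H)%N ->
  c *: ('X^nu - \poly_(i < nu) S i) = E * H ^+ 2 -> False.
Proof.
(* D = H / lead_coef H and F = E (lead_coef H) ^ 2 / c at X = z_j satisfy P = F D ^ 2.
   Both quotients are bounded where c does not vanish; multiplying numerator and
   denominator by c makes the bound hold at the zeros of c as well. *)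
move=> SE c0 sH EF; set P := 'X^nu - _ in EF.
have mapP (z : polydisc rho) : map_poly (series_ev z) P = wpoly nu (ss^~ (sval z)).
  rewrite /P /wpoly rmorphB/= map_polyXn; congr (_ - _); apply/polyP => i.
  by rewrite coef_map !coef_poly; case: ifP => // _; rewrite ?rmorph0//= -SE.
have Pm : P \is monic.
  by rewrite monicE lead_coefDl ?lead_coefXn// size_polyN size_polyXn ltnS size_poly.
have EL : c = lead_coef E * lead_coef H ^+ 2.
  by rewrite -lead_coef_exp -lead_coefM -EF lead_coefZ (monicP Pm) mulr1.
have b0 : lead_coef H != 0 by rewrite lead_coef_eq0 -size_poly_gt0 (ltn_trans _ sH).
have [d [M Zd]] : exists d M, ser rho d M (fun z => z 0 j).
  by have [d dP] := ser_coord j (pos_pd rho0); exists d, (rho 0 j).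
have [Zj ZE] := series_of cptC rho0 Zd.
have fn (f : A) : exists2 g : 'rV[C]_n -> C, exists c M, ser rho c M g &
    forall z, series_ev z f = g (sval z).
  by have [c' [M' [g [Sg Eg]]]] := seriesP f; exists g => //; exists c', M'.
have hol (g : 'rV[C]_n -> C) : (exists c M, ser rho c M g) -> holomorphic_at g 0.
  by move=> [c' [M' Sg]]; exact: ser_holomorphic0 Sg.
have nz (f : A) g : (exists c M, ser rho c M g) -> (forall z, series_ev z f = g (sval z)) ->
    f != 0 -> ~ germ_eq g (fun=> 0).
  move=> [c' [M' Sg]] Eg /eqP f0 g0; apply: f0; apply/val_inj/funext => z.
  rewrite -[LHS]/(series_ev z f) Eg -[RHS]/(0 : C).
  by case: z => z rz; exact: (ser_zero cptC rho0 Sg).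
have [cf cS cE] := fn c; have [bf bS bE] := fn (lead_coef H).
have [af aS aE] := fn H.[Zj]; have [ef eS eE] := fn E.[Zj].
have evp (F : {poly A}) (z : polydisc rho) :
    series_ev z F.[Zj] = (map_poly (series_ev z) F).[sval z 0 j].
  by rewrite -horner_map/= ZE.
(* Where [c] is nonzero, the values of [E] and [H] are numerical divisors of the Weierstrass
   polynomial, whose roots are small near 0. *)
have key (tau : C) : 0 < tau -> \forall z \near (0 : 'rV[C]_n), cf z != 0 ->
    [/\ `|af z| <= `|bf z| * (tau + tau) ^+ (size H).-1,
        `|ef z * bf z ^+ 2| <= `|cf z| * (tau + tau) ^+ (size E).-1 & bf z != 0].
  move=> t0; apply: filterS3 near_pd (near_coord t0) (near_roots t0) => z rz zj zr cz.
  pose w : polydisc rho := exist _ z rz.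
  have W : cf z *: wpoly nu (ss^~ z) = map_poly (series_ev w) E * map_poly (series_ev w) H ^+ 2.
    by rewrite -rmorphXn -rmorphM/= -EF map_polyZ/= mapP cE.
  have EL' : cf z = series_ev w (lead_coef E) * bf z ^+ 2.
    by have := congr1 (series_ev w) EL; rewrite rmorphM rmorphXn/= cE bE.
  have [lE bz] : series_ev w (lead_coef E) != 0 /\ bf z != 0.
    by apply/andP; move: cz; rewrite EL' mulf_eq0 negb_or expf_eq0.
  have lH : series_ev w (lead_coef H) != 0 by rewrite bE.
  have Pz0 : wpoly nu (ss^~ z) != 0 by rewrite -size_poly_gt0 size_wpoly.
  have dP F : F %| cf z *: wpoly nu (ss^~ z) -> F %| wpoly nu (ss^~ z) by rewrite dvdpZr.
  have dH : map_poly (series_ev w) H %| wpoly nu (ss^~ z).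
    by apply: dP; rewrite W dvdp_mull// expr2 dvdp_mulr.
  have dE : map_poly (series_ev w) E %| wpoly nu (ss^~ z).
    by apply: dP; rewrite W dvdp_mulr.
  have lcH : lead_coef (map_poly (series_ev w) H) = bf z.
    by rewrite lead_coef_map_eq//; exact: bE.
  have lcE : lead_coef (map_poly (series_ev w) E) * bf z ^+ 2 = cf z.
    by rewrite lead_coef_map_eq// EL'.
  have := factor_bound t0 Pz0 zr dH zj; rewrite size_map_poly_id0// lcH -evp aE/= => B1.
  have := factor_bound t0 Pz0 zr dE zj; rewrite size_map_poly_id0// -evp eE/= => B2.
  split=> //; rewrite (normrM (ef z)) -lcE (normrM (lead_coef _)) mulrAC ler_wpM2r//.
have c0' := nz _ _ cS cE c0; have b0' := nz _ _ bS bE b0.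
have [cH bH aH eH] : [/\ holomorphic_at cf 0, holomorphic_at bf 0,
   holomorphic_at af 0 & holomorphic_at ef 0] by split; exact: hol.
have cancel (f g : 'rV[C]_n -> C) : holomorphic_at f 0 -> holomorphic_at g 0 ->
    germ_eq (fun z => cf z * f z) (fun z => cf z * g z) -> germ_eq f g.
  move=> fH gH E'; have [|||F|F] := @germ_mul_eq0 _ cptC _ cf (fun z => f z - g z).
  - exact: cH.
  - exact: holomorphicB.
  - by apply: filterS E' => z; rewrite mulrBr => ->; rewrite subrr.
  - by [].
  - by apply: filterS F => z /eqP; rewrite subr_eq0 => /eqP.
(* With [tau = 1 / 2] the factor [(tau + tau) ^ k] in [key] is 1, whatever the degree. *)
have half0 : (0 : C) < 1 / 2 by rewrite divr_gt0.
have half1 : (1 / 2 + 1 / 2 : C) = 1 by rewrite -splitr.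
have [||||D DH DE] := @bounded_dvd _ cptC _ j (fun z => cf z * af z) (fun z => cf z * bf z).
- exact: holomorphicM.
- exact: holomorphicM.
- by move=> /(germ_mul_eq0 cptC cH bH)[].
- exists 1; apply: filterS (key _ half0) => z; rewrite half1 mul1r !normrM.
  have [->|cz /(_ isT)[]] := eqVneq (cf z) 0; first by rewrite normr0 !mul0r.
  by rewrite expr1n mulr1 => aB _ _; rewrite ler_wpM2l.
have {}DE : germ_eq af (fun z => bf z * D z).
  apply: cancel => //; first exact: holomorphicM.
  by apply: filterS DE => z ->; rewrite mulrA.
have [||||F FH FE] := @bounded_dvd _ cptC _ j (fun z => cf z * (ef z * bf z ^+ 2))
    (fun z => cf z * cf z).
- by apply: holomorphicM => //; apply: holomorphicM => //; exact: holomorphicX.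
- exact: holomorphicM.
- by move=> /(germ_mul_eq0 cptC cH cH)[].
- exists 1; apply: filterS (key _ half0) => z; rewrite half1 mul1r !normrM.
  have [->|cz /(_ isT)[]] := eqVneq (cf z) 0; first by rewrite normr0 !mul0r.
  by rewrite !expr1n !mulr1 => _ eB _; rewrite ler_wpM2l.
have {}FE : germ_eq (fun z => ef z * bf z ^+ 2) (fun z => cf z * F z).
  apply: cancel; [|exact: holomorphicM|].
  - by apply: holomorphicM => //; exact: holomorphicX.
  - by apply: filterS FE => z ->; rewrite mulrA.
have pH := hol _ pS; have hH := hol _ hS.
have PE : germ_eq (fun z => p z * h z) (fun z => F z * D z ^+ 2).
  apply: cancel; [exact: holomorphicM|by apply: holomorphicM => //; exact: holomorphicX|].
  apply: filterS3 near_pd DE FE => z rz Da Fe.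
  pose w : polydisc rho := exist _ z rz.
  have := congr1 (fun q => series_ev w q.[Zj]) EF.
  rewrite hornerZ hornerM horner_exp !rmorphM/= cE eE !aE/= evp mapP/=.
  have zj : `|z 0 j| <= rho 0 j := rz j.
  rewrite (EP rz zj) zset_id => ->.
  by rewrite Da [RHS]mulrA -Fe; ring.
have [pi piH piE] := unit_inverse cptC j pH p0.
apply: (@nosq D) => //; last first.
  exists (fun z => F z * pi z); first exact: holomorphicM.
  apply: filterS2 PE piE => z ph ppi; rewrite -[h z]mul1r -ppi.
  rewrite (_ : p z * pi z * h z = pi z * (p z * h z)); last by ring.
  by rewrite ph; ring.
(* [H] is not constant, so taking [tau = s / 4] in [key] gives [|D z| <= s / 2] wherever [c] is
   nonzero, against [s <= |D 0| / 2 <= |D z|]. Hence [D 0 != 0] would force [c] to vanish near 0. *)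
apply/eqP; apply: contraT => D0; exfalso.
have d0 : 0 < `|D 0| / 2 by rewrite divr_gt0 ?normr_gt0.
have [s [s0 sd s1]] := pos_min d0 (@ltr01 C).
have s40 : 0 < s / 4 by rewrite divr_gt0.
apply: c0'; apply: filterS3 (key _ s40) DE (holomorphic_neq0 DH D0) => z K Da Dz.
apply/eqP; apply: contraT => /K[B _ bz]; rewrite Da normrM ler_pM2l ?normr_gt0// in B.
have s2 : s / 4 + s / 4 = s / 2 by field.
have : `|D 0| / 2 <= s / 2.
  apply: (le_trans Dz); apply: (le_trans B); rewrite s2.
  case: (size H) sH => [|[|k]]// _ /=; rewrite exprS ler_piMr ?divr_ge0 ?(ltW s0)//.
  rewrite exprn_ile1 ?divr_ge0 ?(ltW s0)// ler_pdivrMr// mul1r (le_trans s1)// ler1n//.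
move=> /(le_trans sd); rewrite ler_pdivlMr// ger_pMr// lern1//.
Qed.

(** [delta] represents the resultant of [P] and its derivative over the ring of series. If it
    vanished, their gcd would be nonconstant and [square_factor] would contradict
    [no_square_factor]; at a point it evaluates to the numerical resultant. *)
Lemma discriminant_exists : exists delta : 'rV[C]_n -> C,
  [/\ exists c M, ser rho c M delta, ~ germ_eq delta (fun=> 0) &
    forall z, pd rho z -> delta z != 0 ->
      coprimep (wpoly nu (ss^~ z)) (wpoly nu (ss^~ z))^`()].
Proof.
have HS i : exists f : A, forall z, series_ev z f = ss i (sval z).
  by have [c [M H]] := sS i; exact: series_of H.
have [S SE] := choice HS.
pose P : {poly A} := 'X^nu - \poly_(i < nu) S i.
have mapP (z : polydisc rho) : map_poly (series_ev z) P = wpoly nu (ss^~ (sval z)).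
  rewrite /P /wpoly rmorphB/= map_polyXn; congr (_ - _); apply/polyP => i.
  by rewrite coef_map !coef_poly; case: ifP => // _; rewrite ?rmorph0//= -SE.
have sP : size P = nu.+1.
  by rewrite size_polyDl size_polyXn// size_polyN ltnS size_poly.
have Pm : P \is monic.
  by rewrite monicE lead_coefDl ?lead_coefXn// size_polyN size_polyXn ltnS size_poly.
have P0 : P != 0 by rewrite monic_neq0.
have [c [M [delta [dS dE]]]] := seriesP (resultant P P^`()).
exists delta; split; first by exists c, M.
- move=> d0; have : resultant P P^`() == 0.
    apply/eqP/val_inj/funext => -[z rz]; rewrite [LHS]dE/=.
    exact: (ser_zero cptC rho0 dS).
  rewrite resultant_eq0 => sG.
  have [e [E [H [e0 sH EF]]]] := square_factor series_char0 P0 sG.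
  exact: (no_square_factor SE e0 sH EF).
- move=> z rz dz; pose w : polydisc rho := exist _ z rz.
  (* The leading coefficient [nu] stays nonzero under evaluation, as [resultant_map] requires. *)
  have lP' : lead_coef P^`() = nu%:R.
    have cP' : P^`()`_(nu.-1) = nu%:R.
      rewrite coef_deriv prednK//; have := monicP Pm; rewrite lead_coefE sP/= => ->.
      by [].
    have sP' : size P^`() = nu.
      apply/eqP; rewrite eqn_leq; apply/andP; split.
        by have := lt_size_deriv P0; rewrite sP ltnS.
      have : (nu.-1 < size P^`())%N; last by rewrite prednK.
      rewrite ltnNge; apply/negP => /leq_sizeP/(_ _ (leqnn _)); rewrite cP' => /eqP.
      by case: (nu) nu0 => // k _; rewrite (negbTE (series_char0 _)).
    by rewrite lead_coefE sP'.
  have : series_ev w (resultant P P^`()) != 0 by rewrite /series_ev dE.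
  rewrite resultant_map ?(monicP Pm) ?rmorph1 ?oner_neq0//; last first.
    by rewrite lP' rmorph_nat pnatr_eq0 -lt0n.
  rewrite -deriv_map mapP/= resultant_eq0 -leqNgt => sG.
  rewrite coprimep_def eqn_leq sG size_poly_gt0 gcdp_eq0 negb_and.
  by rewrite -size_poly_gt0 size_wpoly.
Qed.

End Discriminant.

(** * Multiplicity and order *)

#[local] Existing Instance totally_filter.

Section Multiplicity.
Variables (C : numClosedFieldType) (cptC : disc_compact C) (n : nat).
Implicit Types (v z : 'rV[C]_n).
Local Open Scope card_scope.

Lemma card_seq (T : choiceType) (s : seq T) : uniq s -> ([set` s] #= `I_(size s))%card.
Proof.
move=> us; rewrite (_ : [set` s] = [set` seq_fset tt s]); last first.
  by apply/seteqP; split=> x /=; have := seq_fsetE tt s x => ->.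
by apply/card_eq_fsetP; rewrite size_seq_fset undup_id.
Qed.

Lemma open_dense_hpart (c : multi_index n -> C) k v0 : hpart c k v0 != 0 ->
  open [set v | hpart c k v != 0] /\ dense [set v | hpart c k v != 0].
Proof.
move=> h0; split.
  rewrite openE => v /= hv; have := holomorphic_neq0 (holomorphic_hpart cptC c k v) hv.
  by apply: filterS => w /= hw; rewrite -normr_gt0 (lt_le_trans _ hw)// divr_gt0 ?normr_gt0.
move=> O [z Oz] oO; have /nbhs_pdP[e e0 He] : nbhs z O by exact: open_nbhs_nbhs.
have [w we hw] := entire_dense cptC z (holomorphic_hpart cptC c k) h0 e0.
by exists w; split=> //; have := He _ we; rewrite subrKC.
Qed.

Lemma genericI (P Q : set 'rV[C]_n) : generic P -> generic Q -> generic (P `&` Q).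
Proof.
move=> [U [oU dU UP]] [W [oW dW WQ]]; exists (U `&` W); split.
- exact: openI.
- by move=> O O0 oO; rewrite setIA; apply: dW; [exact: dU|exact: openI].
- by move=> z [/UP ? /WQ ?].
Qed.

Lemma generic_meet (P O : set 'rV[C]_n) : generic P -> open O -> O !=set0 -> exists2 z, O z & P z.
Proof.
move=> [U [oU dU UP]] oO O0; have [z [Oz Uz]] := dU O O0 oO.
by exists z => //; exact: UP.
Qed.

(** The condition is void outside the ball of radius [d], so the open set also contains the region
    [F] where a coordinate exceeds [d]. Since [d < r1], points off [F] lie inside the larger ball,
    where the identity theorem gives density. *)
Lemma generic_neq0 (d r1 : C) (delta : 'rV[C]_n -> C) : 0 < d -> d < r1 ->
  (forall z, ball (0 : 'rV[C]_n) r1 z -> holomorphic_at delta z) ->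
  ~ germ_eq delta (fun=> 0) ->
  generic [set z | ball (0 : 'rV[C]_n) d z -> delta z != 0].
Proof.
move=> d0 dr hol dn; have r10 := lt_trans d0 dr.
have [z2 b2 dz2] : exists2 z2, ball (0 : 'rV[C]_n) r1 z2 & delta z2 != 0.
  apply: contrapT => H; apply: dn; apply/nbhs_ballP; exists r1 => // z bz.
  by apply/eqP; apply: contraT => dz; case: H; exists z.
pose F := [set z : 'rV[C]_n | exists i, d < `|z 0 i|].
have oF : open F.
  rewrite openE => z [i zi]; apply/nbhs_pdP; exists ((`|z 0 i| - d) / 2).
    by rewrite divr_gt0// subr_gt0.
  move=> w /(_ i); rewrite mxE => wi; exists i; rewrite mxE.
  have : `|z 0 i| <= `|z 0 i + w 0 i| + `|w 0 i|.
    by rewrite -{1}[z 0 i](addrK (w 0 i)) (le_trans (ler_normB _ _)).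
  rewrite -lerBlDr; apply: lt_le_trans; rewrite ltrBrDl.
  apply: (le_lt_trans (lerD wi (lexx d))).
  rewrite -ltrBrDr ltr_pdivrMr// ltr_pMr ?subr_gt0// ltr1n//.
exists ((ball (0 : 'rV[C]_n) r1 `&` [set z | delta z != 0]) `|` F); split.
- apply: openU => //; rewrite openE => z [bz dz].
  apply: filterI; first by apply: open_nbhs_nbhs; split=> //; exact: ball_open.
  have := holomorphic_neq0 (hol _ bz) dz; apply: filterS => w /= hw.
  by rewrite -normr_gt0 (lt_le_trans _ hw)// divr_gt0 ?normr_gt0.
- move=> O [z Oz] oO; case: (pselect (F z)) => [Fz|nF]; first by exists z; split=> //; right.
  have bz : ball (0 : 'rV[C]_n) r1 z.
    apply/ball_pdP => // i; rewrite mxE subr0; apply: le_lt_trans dr.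
    by rewrite real_leNgt ?normr_real ?gtr0_real//; apply/negP => h; apply: nF; exists i.
  have : nbhs z (O `&` ball (0 : 'rV[C]_n) r1).
    by apply: filterI; apply: open_nbhs_nbhs; split=> //; exact: ball_open.
  move=> /nbhs_pdP[e e0 He].
  have [w we dw] := neq0_dense cptC r10 hol b2 dz2 bz e0.
  have [Ow bw] := He _ we; rewrite subrKC in Ow bw.
  by exists w; split=> //; left.
- move=> z [[_ dz] _|[i di] /(ball_pdP _ _ d0)/(_ i)]; first exact: dz.
  by rewrite mxE subr0 => /(lt_trans di); rewrite ltxx.
Qed.

(** After a shear the points to be counted are the roots of one numerical Weierstrass polynomial of
    degree [m], which are distinct where the discriminant is nonzero. *)
Lemma multiplicity_order (h : 'rV[C]_n -> C) m : reduced_germ h -> has_order h m ->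
  is_multiplicity h m.
Proof.
move=> red hm; have [hh h0 hn _] := red.
have [r [c [M [r0 ch c0 [v0 hv0]]]]] := hm.
have [oU dU] := open_dense_hpart hv0.
exists [set v | hpart c m v != 0]; split=> // v /= hv vn0.
have [j vj] : exists j, v 0 j != 0.
  apply: contrapT => H; move/eqP: vn0; apply; apply/rowP => j; rewrite mxE.
  by apply/eqP; apply: contraT => vj; case: H; exists j.
have m0 : (0 < m)%N by rewrite lt0n (order0 cptC hm) h0 eqxx.
have L := lead_shear j (lead_of_ser cptC v r0 ch c0).
set h' := h \o shear j v in L.
have hh' : holomorphic_at h' 0 by exact: holomorphic_comp_shear.
have /holomorphic0P[r' [ch' [M' [r'0 Hh']]]] := hh'.
have [c0' cm'] := lead_regular cptC r'0 Hh' L hv.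
have [rho [rho0 rrho] [[p [ss [pS sS sI [p0 ss0] EP]]] _]] :=
  weierstrass_preparation cptC r'0 Hh' c0' cm'.
have nosq (d : 'rV[C]_n -> C) : holomorphic_at d 0 -> d 0 = 0 -> ~ germ_dvd (fun z => d z ^+ 2) h'.
  move=> hd d0 [q hq E].
  apply: (@reduced_no_square _ cptC _ j h (d \o unshear j v)) => //.
  - exact: holomorphic_comp_unshear.
  - by rewrite /= unshear0.
  exists (q \o unshear j v); first exact: holomorphic_comp_unshear.
  have := near_unshear cptC j v E; apply: filterS => z; by rewrite /h' /= unshearK.
have hS : exists c M, ser rho c M h' by exists ch', M'; exact: ser_shrink Hh'.
have [delta [[cd [Md dS]] dn dP]] := discriminant_exists cptC rho0 m0 pS hS sS p0 ss0 EP nosq.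
have pH : holomorphic_at p 0 by have [cp [Mp H]] := pS; exact: ser_holomorphic0 H.
(* In this neighbourhood the unit [p] has no zero, so zeros of [h] on the line correspond to roots
   of the polynomial. *)
have N1 : \forall z \near (0 : 'rV[C]_n), pd rho (unshear j v z) /\ p (unshear j v z) != 0.
  apply: (@near_unshear _ cptC _ j (fun z => pd rho z /\ p z != 0) v).
  apply: filterS2 (near_pd rho0) (holomorphic_neq0 pH p0) => z rz pz; split=> //.
  by rewrite -normr_gt0 (lt_le_trans _ pz)// divr_gt0 ?normr_gt0.
have /nbhs_ballP[e0 /= e00 He0] := N1.
exists e0 => // e e_gt0 ee0.
have : \forall y \near (0 : 'rV[C]_n), ball (0 : 'rV[C]_n) e (shear j v y).
  apply: (@near_shear _ cptC _ j (ball (0 : 'rV[C]_n) e) v); exact: nbhsx_ballx.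
move=> /nbhs_pdP[t1 t10 Ht1]; have [tau [tau0 taut1 taur]] := pos_min t10 (rho0 j).
have Nt : \forall z \near (0 : 'rV[C]_n), pd (cvec n tau) z.
  by apply/nbhs_pdP; exists tau => // z; rewrite add0r.
(* This controls [d]: for base points close enough to 0, all [m] roots are at most [tau], which
   keeps the points they define in the ball of radius [e]. *)
have N2 : \forall z \near (0 : 'rV[C]_n), pd (cvec n tau) (unshear j v z) /\
    forall x, root (wpoly m (ss^~ (unshear j v z))) x -> `|x| <= tau.
  apply: (@near_unshear _ cptC _ j (fun y => pd (cvec n tau) y /\
    forall x, root (wpoly m (ss^~ y)) x -> `|x| <= tau) v).
  by apply: filterI Nt _; exact: near_roots.
have dH : holomorphic_at (delta \o unshear j v) 0.
  by apply: (holomorphic_comp_unshear cptC); exact: ser_holomorphic0 dS.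
have /nbhs_ballP[r1 /= r10 Hr1] := holomorphic_near cptC dH.
have /nbhs_ballP[d2 /= d20 Hd2] := N2.
have [d1 [d10 d1e d12]] := pos_min e00 d20.
have [d [d0 dd1 dr1]] := pos_min d10 (divr_gt0 r10 (ltr0n _ 2)).
exists d => //.
have [||V [oV dV VP]] := @generic_neq0 d r1 (delta \o unshear j v) d0 _ Hr1.
- by rewrite (le_lt_trans dr1)// ltr_pdivrMr// ltr_pMr// ltr1n.
- move=> E; apply: dn; have := near_shear cptC j v E; apply: filterS => z.
  by rewrite /= shearK.
exists V; split=> // z /VP/= Vz bz _.
set w := unshear j v z in Vz.
have [wr pw] := He0 z (le_ball (le_trans dd1 d1e) bz).
have [wt wroots] := Hd2 z (le_ball (le_trans dd1 d12) bz).
have cop := dP _ wr (Vz bz).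
set P := wpoly m (ss^~ w) in cop wroots.
have [rs E] := closed_field_poly_normal P.
rewrite (monicP (wpoly_monic _ _)) scale1r in E.
have urs : uniq rs by rewrite -separable_prod_XsubC -E unlock.
have srs : size rs = m.
  by have := size_wpoly m (ss^~ w); rewrite -/P E size_prod_XsubC => -[].
(* [f] parametrises the line through [z] by the [j]-th coordinate in sheared space. *)
pose f t := shear j v (zset j w t).
have fE t : f t = z + (t - w 0 j) *: v.
  by rewrite /f zset_ej shear_ej /w unshearK.
have finj : injective f.
  move=> s t /(can_inj (shearK vj)) /(congr1 (fun y : 'rV[C]_n => y 0 j)).
  by rewrite !zsetj.
have uf : uniq (map f rs) by rewrite map_inj_uniq.
rewrite -srs -(size_map f rs) (_ : _ `&` _ `&` _ = [set` map f rs]); first exact: card_seq.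
apply/seteqP; split=> [y [[[s _ ys] hy] be]|y /= /mapP[t trs ->]].
  have yf : y = f (s + w 0 j) by rewrite fE addrK.
  have [yr py] : pd rho (unshear j v y) /\ p (unshear j v y) != 0.
    by apply: He0; exact: le_ball be.
  move: yr py; rewrite yf /f shearK// => yr py.
  apply: map_f; rewrite -root_prod_XsubC -E /root -/P.
  have := yr j; rewrite zsetj => /(EP _ _ wr) ->.
  by move: hy; rewrite /zero_locus/= yf /f /h' /= => ->; rewrite mulr0.
have rt : root P t by rewrite E root_prod_XsubC.
have tt := wroots t rt.
have bf : ball (0 : 'rV[C]_n) e (f t).
  have := Ht1 (zset j w t); rewrite add0r; apply; apply: pd_le taut1 _.
  by apply: pd_zset => //; rewrite mxE.
split=> //; split; first by rewrite fE; exists (t - w 0 j).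
have [yr py] : pd rho (unshear j v (f t)) /\ p (unshear j v (f t)) != 0.
  by apply: He0; exact: le_ball bf.
move: yr py; rewrite /f shearK// => yr py.
have tr : `|t| <= rho 0 j by have := yr j; rewrite zsetj.
have := EP _ _ wr tr; move: rt; rewrite /root => /eqP -> /esym/eqP.
by rewrite mulf_eq0 (negbTE py) => /eqP.
Qed.


End Multiplicity.

(** * Rouche's theorem on a disc *)

#[local] Existing Instance totally_filter.

Section Rouche.
Variable C : numClosedFieldType.
Hypothesis cptC : disc_compact C.
Implicit Types (F G N : C -> C).

Definition asym F m (A : C) : Prop :=
  exists K d, [/\ 0 <= K, 0 < d &
    forall t, `|t| <= d -> `|F t - A * t ^+ m| <= K * `|t| ^+ m.+1].

Lemma asym_uniq F m l A B : (m < l)%N -> asym F m A -> asym F l B -> A = 0.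
Proof.
have lift k D : asym F k D -> lead (fun z : 'rV[C]_1 => F (z 0 0)) k (const_mx 1) D.
  move=> [K [d [K0 d0 H]]]; exists K, d; split=> // t td.
  by rewrite !mxE mulr1; exact: H.
by move=> ml /lift hA /lift hB; exact: (lead_uniq ml hA hB).
Qed.

Lemma asym0 F m A : asym F m A -> F 0 = A * 0 ^+ m.
Proof.
move=> [K [d [K0 d0 /(_ 0)]]]; rewrite normr0 (exprS 0 m) mul0r mulr0 => /(_ (ltW d0)).
by rewrite normr_le0 subr_eq0 => /eqP.
Qed.

Lemma an1_dicho F t0 : an1 F t0 -> loc0 F t0 \/
  exists k a, a != 0 /\ asym (fun s => F (t0 + s)) k a.
Proof.
move=> [r [c [M [r0 cF]]]]; case: (pselect (exists k, c k != 0)) => [ex|H]; [right|left].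
  case: (ex_minnP ex) => m cm mmin; exists m, (c m); split=> //.
  have c0 j : (j < m)%N -> c j = 0.
    by move=> jm; apply/eqP; apply: contraTT jm => /mmin; rewrite -leqNgt.
  exists (M / r ^+ m.+1), r; split=> //.
    by rewrite divr_ge0 ?(absb_ge0 cF.1)// exprn_ge0// ltW.
  by move=> t tr; exact: (ser1_lead r0 cF c0 tr).
have c0 k : c k = 0 by apply/eqP; apply: contraT => ck; case: H; exists k.
by exists r => //; exact: (ser1_zero cF c0).
Qed.

Lemma an1_comb F G (c : C) t0 : an1 F t0 -> an1 G t0 -> an1 (fun t => G t - c * F t) t0.
Proof.
move=> [r [u [M [r0 [uM uF]]]]] [s [v [N [s0 [vN vG]]]]].
have [e [e0 er es]] := pos_min r0 s0.
have sh (w : nat -> C) L q : e <= q -> absb (fun k => w k * q ^+ k) L ->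
    absb (fun k => w k * e ^+ k) L.
  move=> eq; apply: absb_le => k; rewrite !normrM ler_wpM2l// !normrX lerXn2r ?nnegrE//.
  by rewrite !gtr0_norm// (lt_le_trans e0).
exists e, (fun k => v k + - c * u k), (N + `|- c| * M); split=> //; split.
  apply: absb_le (absbD (sh _ _ _ es vN) (absbZ (- c) (sh _ _ _ er uM))) => k.
  by rewrite mulrDl mulrA.
move=> t te; rewrite -mulNr; apply: eq_sumto (sumtoD (vG t (le_trans te es)) (sumtoZ (- c) (uF t (le_trans te er)))) => k.
by rewrite mulrDl mulrA.
Qed.

Lemma asym_lower F m A : A != 0 -> asym F m A ->
  exists2 d, 0 < d & forall t, `|t| <= d -> `|A| / 2 * `|t| ^+ m <= `|F t|.
Proof.
move=> A0 [K [d [K0 d0 H]]]; have A20 : 0 < `|A| / 2 by rewrite divr_gt0 ?normr_gt0.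
have [s [s0 s1 sK]] := small_radius (@ltr01 C) K0 A20; rewrite divr1 in sK.
have [e [e0 ed es]] := pos_min d0 s0; exists e => // t te.
have := H t (le_trans te ed); rewrite distrC => h.
have : `|A * t ^+ m| <= `|A * t ^+ m - F t| + `|F t| by rewrite -{1}(subrK (F t) (A * t ^+ m)) ler_normD.
rewrite -lerBlDl; apply: le_trans; rewrite lerBrDr -lerBrDl.
apply: (le_trans h); rewrite normrM normrX exprS mulrA.
rewrite (_ : `|A| * _ - _ = `|A| / 2 * `|t| ^+ m); last by field.
rewrite ler_wpM2r ?exprn_ge0//; apply: le_trans sK; rewrite mulrC ler_wpM2r//.
exact: le_trans es.
Qed.

Lemma asym_upper F m A : asym F m A ->
  exists K d, [/\ 0 <= K, 0 < d & forall t, `|t| <= d -> `|F t| <= K * `|t| ^+ m].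
Proof.
move=> [K [d [K0 d0 H]]]; have [e [e0 ed e1]] := pos_min d0 (@ltr01 C).
exists (K + `|A|), e; split=> // [|t te]; first by rewrite addr_ge0.
rewrite -[F t](subrK (A * t ^+ m)) (le_trans (ler_normD _ _))// mulrDl lerD//.
  by rewrite (le_trans (H _ (le_trans te ed)))// ler_wpM2l// ler_wiXn2l// (le_trans te).
by rewrite normrM normrX.
Qed.

Lemma Re_le_norm (x : C) : 'Re x <= `|x|.
Proof.
by rewrite (le_trans (real_ler_norm (Creal_Re _)))// leif_normC_Re_Creal.
Qed.

(** The quotient behaves like [(a / A) s ^ q] with [q = k - m > 0]. On the ray through a [q]-th root
    [w] of [-A / a] this is [- x ^ q], and the remainders are smaller by a factor [x]. *)
Lemma quotient_descent F N m k A a : A != 0 -> a != 0 -> (m < k)%N ->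
  asym F m A -> asym N k a -> forall e, 0 < e ->
  exists s, [/\ 0 < `|s|, `|s| <= e & 'Re (N s / F s) < 0].
Proof.
move=> A0 a0 mk FA Na e e0.
have q0 : (0 < k - m)%N by rewrite subn_gt0.
set q := (k - m)%N in q0.
pose w := q.-root (- A / a); have wq : w ^+ q = - A / a by rewrite rootCK.
have w0 : w != 0.
  apply/eqP => w0; move: wq; rewrite w0 expr0n gtn_eqF// => /esym/eqP.
  by rewrite mulf_eq0 invr_eq0 oppr_eq0 (negbTE A0) (negbTE a0).
have [dF dF0 HF] := asym_lower A0 FA.
have [KF [eF [KF0 eF0 GF]]] := FA; have [KN [eN [KN0 eN0 GN]]] := Na.
have Ap : 0 < `|A| by rewrite normr_gt0.
have wp : 0 < `|w| by rewrite normr_gt0.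
(* The error terms of the quotient are at most [x ^ q * (x * T)]; making [x * T] at most [1 / 2]
   leaves a negative real part. *)
pose T := 2 / `|A| * (KN * `|w| ^+ q.+1 + KF * `|w|).
have T0 : 0 <= T by rewrite mulr_ge0 ?divr_ge0// addr_ge0 ?mulr_ge0// exprn_ge0.
have [e1 [e10 e1F e1G]] := pos_min dF0 eF0; have [e2 [e20 e2N e2e]] := pos_min eN0 e0.
have [e3 [e30 e31 e32]] := pos_min e10 e20.
have [x [x0 xu xT]] : exists x, [/\ 0 < x, x * `|w| <= e3 & x * T <= 1 / 2].
  have [y [y0 y1 yT]] := small_radius (@ltr01 C) T0 (divr_gt0 ltr01 (ltr0n C 2)).
  have [x [x0 xy xe]] := pos_min y0 (divr_gt0 e30 wp); exists x; split=> //.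
    by rewrite -ler_pdivlMr.
  by rewrite divr1 in yT; apply: le_trans yT; rewrite ler_wpM2r.
set s := x * w.
have sN : `|s| = x * `|w| by rewrite normrM gtr0_norm.
have sp : 0 < `|s| by rewrite sN mulr_gt0.
have s3 : `|s| <= e3 by rewrite sN.
have Fs := HF s (le_trans s3 (le_trans e31 e1F)).
have FR := GF s (le_trans s3 (le_trans e31 e1G)).
have NR := GN s (le_trans s3 (le_trans e32 e2N)).
exists s; split=> //; first exact: le_trans s3 (le_trans e32 e2e).
have F0 : F s != 0.
  rewrite -normr_gt0; apply: lt_le_trans Fs.
  by rewrite mulr_gt0 ?divr_gt0// exprn_gt0.
have xq : 0 < x ^+ q by rewrite exprn_gt0.
have sq : s ^+ q = x ^+ q * (- A / a) by rewrite /s exprMn wq.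
have kE : k = (m + q)%N by rewrite /q subnKC// ltnW.
have E1 : a * s ^+ k = - A * x ^+ q * s ^+ m.
  by rewrite kE exprD sq; field.
have E2 : N s / F s = - x ^+ q + ((N s - a * s ^+ k) + x ^+ q * (F s - A * s ^+ m)) / F s.
  by rewrite E1; field.
have B : `|((N s - a * s ^+ k) + x ^+ q * (F s - A * s ^+ m)) / F s| <= x ^+ q * (1 / 2).
  rewrite normrM normfV ler_pdivrMr ?normr_gt0//.
  apply: (@le_trans _ _ (x ^+ q * (x * T) * (`|A| / 2 * `|s| ^+ m))); last first.
    apply: ler_pM => //.
    - by rewrite mulr_ge0 ?(ltW xq)// mulr_ge0// ltW.
    - by rewrite ler_wpM2l// ltW.
  have -> : x ^+ q * (x * T) * (`|A| / 2 * `|s| ^+ m) =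
     KN * `|s| ^+ k.+1 + x ^+ q * (KF * `|s| ^+ m.+1).
    rewrite kE -addnS exprD (exprS _ m).
    have -> : `|s| ^+ q.+1 = x * x ^+ q * `|w| ^+ q.+1 by rewrite sN exprMn exprS.
    rewrite [X in _ = _ + _ * (_ * (X * _))]sN /T.
    by field; rewrite gt_eqF.
  rewrite (le_trans (ler_normD _ _))// lerD// normrM (gtr0_norm xq) ler_wpM2l// ltW//.
rewrite E2 raddfD/= (Creal_ReP _ _) ?realN ?gtr0_real// addrC subr_lt0.
apply: (le_lt_trans (Re_le_norm _)); apply: (le_lt_trans B).
by rewrite gtr_pMr// ltr_pdivrMr// mul1r ltr1n.
Qed.

(** * Minimum principle for the real part of a quotient *)

Section MinimumPrinciple.
Variables (F G : C -> C) (r A B : C) (m l : nat).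
Hypothesis r0 : 0 < r.
Hypothesis anF : forall t, `|t| <= r -> an1 F t.
Hypothesis anG : forall t, `|t| <= r -> an1 G t.
Hypothesis Fn0 : forall t, 0 < `|t| -> `|t| <= r -> F t != 0.
Hypothesis A0 : A != 0.
Hypothesis FA : asym F m A.
Hypothesis GB : asym G l B.
Hypothesis ml : (m < l)%N.

(** Since [m < l], the quotient tends to 0 at the centre, so the value 0 is its continuous
    extension. *)
Definition quot t : C := if t == 0 then 0 else G t / F t.

(** One expansion covers the centre and the other points: in both cases [G - quot t0 F] vanishes at
    [t0] to higher order than [F], or identically. *)
Lemma quot_local t0 : `|t0| <= r -> exists m' A',
  [/\ A' != 0, asym (fun s => F (t0 + s)) m' A' &
   loc0 (fun u => G u - quot t0 * F u) t0 \/
   exists k a, [/\ a != 0, (m' < k)%N &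
     asym (fun s => G (t0 + s) - quot t0 * F (t0 + s)) k a]].
Proof.
move=> tr; have AN := an1_comb (quot t0) (anF tr) (anG tr).
have [t00|tn0] := eqVneq t0 0.
  have addE (H : C -> C) : (fun s => H (t0 + s)) = H by apply/funext => s; rewrite t00 add0r.
  exists m, A; split=> //; first by rewrite addE.
  case: (an1_dicho AN) => [|[k [a [an0 Na]]]]; [by left|right].
  exists k, a; split=> //; apply: leq_trans ml _; rewrite leqNgt; apply/negP => kl.
  have NE : (fun s => G (t0 + s) - quot t0 * F (t0 + s)) = G.
    by apply/funext => s; rewrite /quot t00 eqxx mul0r subr0 add0r.
  by move: an0; rewrite NE in Na; rewrite (asym_uniq kl Na GB) eqxx.
have Ft : F t0 != 0 by apply: Fn0 => //; rewrite normr_gt0.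
case: (an1_dicho (anF tr)) => [[e e0 /(_ 0)]|[k [a [an0 Fa]]]].
  by rewrite addr0 normr0 => /(_ (ltW e0)) /eqP; rewrite (negbTE Ft).
exists k, a; split=> //; case: (an1_dicho AN) => [|[k' [a' [an0' Na]]]]; [by left|right].
exists k', a'; split=> //.
have k0 : k = 0%N.
  case: k Fa => // k /asym0; rewrite addr0 exprS mul0r mulr0 => /eqP.
  by rewrite (negbTE Ft).
rewrite k0 lt0n; apply/eqP => k'0; move: Na; rewrite k'0 => /asym0.
rewrite addr0 /quot (negbTE tn0) divfK// subrr expr0 mulr1 => /esym/eqP.
by rewrite (negbTE an0').
Qed.

Lemma quot_diff t0 s : t0 + s != 0 -> `|t0 + s| <= r ->
  quot (t0 + s) - quot t0 = (G (t0 + s) - quot t0 * F (t0 + s)) / F (t0 + s).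
Proof.
move=> ts tr; rewrite {1}/quot (negbTE ts); field.
by apply: Fn0; rewrite // normr_gt0.
Qed.

Lemma quot_cts t0 : `|t0| <= r -> forall e, 0 < e ->
  \forall u \near t0, `|u| <= r -> `|'Re (quot u) - 'Re (quot t0)| <= e.
Proof.
move=> tr e e0; have [m' [A' [A'0 FA' H]]] := quot_local tr.
have [K [d [K0 d0 NK]]] : exists K d, [/\ 0 <= K, 0 < d & forall s, `|s| <= d ->
   `|G (t0 + s) - quot t0 * F (t0 + s)| <= K * `|s| ^+ m'.+1].
  case: H => [[d d0 Hd]|[k [a [an0 mk Na]]]].
    by exists 0, d; split=> // s /Hd ->; rewrite normr0 mul0r.
  have [K [d [K0 d0 NK]]] := asym_upper Na; have [d1 [d10 d1d d11]] := pos_min d0 (@ltr01 C).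
  exists K, d1; split=> // s sd; apply: le_trans (NK s (le_trans sd d1d)) _.
  by rewrite ler_wpM2l// ler_wiXn2l// (le_trans sd).
have [d1 d10 FL] := asym_lower A'0 FA'.
have Ap : 0 < `|A'| / 2 by rewrite divr_gt0 ?normr_gt0.
have KA : 0 <= K / (`|A'| / 2) by rewrite divr_ge0// ltW.
have [x [x0 x1 xe]] := small_radius (@ltr01 C) KA e0; rewrite divr1 in xe.
have [y [y0 yd yd1]] := pos_min d0 d10; have [z [z0 zx zy]] := pos_min x0 y0.
(* Away from the centre the ball must avoid 0, where [quot] is not given by the fraction. *)
have [w [w0 wz wt]] : exists w, [/\ 0 < w, w <= z & t0 != 0 -> w < `|t0|].
  have [->|tn0] := eqVneq t0 0; first by exists z; split; rewrite ?eqxx.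
  have tp : 0 < `|t0| by rewrite normr_gt0.
  have [w [w0 wz wt]] := pos_min z0 (divr_gt0 tp (ltr0n C 2)).
  exists w; split=> // _; apply: (le_lt_trans wt); rewrite ltr_pdivrMr// ltr_pMr ?normr_gt0// ltr1n//.
apply/nbhs_ballP; exists w => // u; rewrite -ball_normE/= => tu ur.
have [->|un] := eqVneq u t0; first by rewrite subrr normr0 ltW.
have u0 : u != 0.
  have [t00|/wt wt0] := eqVneq t0 0; first by rewrite -t00.
  by apply: contraTneq tu => ->; rewrite subr0 lt_gtF.
set s := u - t0; have uE : t0 + s = u by rewrite /s subrKC.
have sw : `|s| <= w by rewrite /s distrC ltW.
have sp : 0 < `|s| by rewrite normr_gt0 subr_eq0.
have sd := le_trans sw (le_trans wz (le_trans zy yd)).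
have sd1 := le_trans sw (le_trans wz (le_trans zy yd1)).
have Fu : 0 < `|F u| by rewrite normr_gt0 Fn0// normr_gt0.
rewrite -raddfB/= (le_trans (leif_normC_Re_Creal _))//.
rewrite -uE quot_diff ?uE// normrM normfV ler_pdivrMr//.
have := NK s sd; rewrite uE => /le_trans; apply.
have := FL s sd1; rewrite uE => /(ler_wpM2l (ltW e0))/(le_trans _); apply.
rewrite exprS mulrA [leRHS]mulrA ler_wpM2r ?exprn_ge0//.
have h : `|s| * (K / (`|A'| / 2)) <= e.
  by apply: le_trans xe; rewrite ler_wpM2r// (le_trans sw)// (le_trans wz).
by move: h; rewrite mulrA ler_pdivrMr// mulrC.
Qed.

Lemma minimum_principle : ~ (forall t, `|t| = r -> 0 < 'Re (G t / F t)).
Proof.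
(* A minimiser of the real part with the largest modulus cannot be interior: near it the
   quotient is either constant or decreases in some direction. *)
move=> Hc; pose K := [set t : C | `|t| <= r].
have cK : compact K := cptC (r := r).
have K0 : K 0 by rewrite /K/= normr0 ltW.
have [|t1 Kt1 Ht1] := compact_min cK (ex_intro _ _ K0)
    (fun t _ => Creal_Re (quot t)).
  by move=> t Kt e e0; exact: quot_cts.
pose K2 := K `&` [set t | 'Re (quot t) <= 'Re (quot t1)].
have clK : closed K by apply: compact_closed => //; exact: norm_hausdorff.
have clK2 : closed K2.
  move=> t clt; have Kt : K t.
    by apply: clK => V nV; have [s [[Ks _] Vs]] := clt V nV; exists s.
  split=> //=; apply/ler_addgt0Pr => e e0.
  have [s [[Ks ss] Hs]] := clt _ (quot_cts Kt e0).
  have := Hs Ks; rewrite distrC => h.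
  rewrite -[leLHS](subrKC ('Re (quot s))) lerD//; apply: le_trans h.
  by apply: real_ler_norm; rewrite realB ?Creal_Re.
have cK2 : compact K2.
  rewrite (_ : K2 = K `&` K2); first exact: compact_closedI.
  by rewrite /K2 setIA setIid.
have K21 : K2 t1 by split=> /=.
have [|t2 [Kt2 qt2] Ht2] := compact_min (phi := fun t => - `|t|) cK2 (ex_intro _ _ K21)
    (fun t _ => ltac:(by rewrite realN normr_real)).
  move=> t _ e e0; apply/nbhs_ballP; exists e => // s; rewrite -ball_normE/= => ts _.
  by rewrite -opprD normrN (le_trans (ler_dist_dist _ _))// distrC ltW.
have mint2 s : K s -> 'Re (quot t2) <= 'Re (quot s).
  by move=> Ks; apply: le_trans qt2 _; exact: Ht1.
(* The value at the centre is 0 and the values on the circle have positive real part, so a minimiser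
   is interior. *)
have t2r : `|t2| < r.
  rewrite lt_neqAle Kt2 andbT; apply/eqP => t2r.
  have tn : t2 != 0 by rewrite -normr_gt0 t2r.
  have := Hc t2 t2r; have := mint2 0 K0; rewrite /quot eqxx (negbTE tn) raddf0 => h.
  by move=> /(le_lt_trans h); rewrite ltxx.
have e0 : 0 < (r - `|t2|) by rewrite subr_gt0.
have [m' [A' [A'0 FA' H]]] := quot_local Kt2.
have [w [w0 we wt]] : exists w, [/\ 0 < w, w <= r - `|t2| & t2 != 0 -> w < `|t2|].
  have [->|tn0] := eqVneq t2 0; first by exists r; split; rewrite ?normr0 ?subr0 ?eqxx.
  have tp : 0 < `|t2| by rewrite normr_gt0.
  have [w [w0 wz wt]] := pos_min e0 (divr_gt0 tp (ltr0n C 2)).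
  exists w; split=> // _; apply: (le_lt_trans wt); rewrite ltr_pdivrMr// ltr_pMr ?normr_gt0// ltr1n//.
have Kw s : `|s| <= w -> K (t2 + s).
  by move=> sw; rewrite /K/= (le_trans (ler_normD _ _))// -lerBrDl (le_trans sw).
have nw s : 0 < `|s| -> `|s| <= w -> t2 + s != 0.
  move=> sp sw; have [->|/wt wt2] := eqVneq t2 0; first by rewrite add0r -normr_gt0.
  apply/eqP => E; have : `|t2| <= w by rewrite -[t2](addrK s) E sub0r normrN.
  by move=> /(lt_le_trans wt2); rewrite ltxx.
case: H => [[d d0 Hd]|[k [a [an0 mk Na]]]].
- have [x [x0 xd xw]] := pos_min d0 w0.
  (* If the quotient is locally constant, a step radially outwards yields a minimiser of larger
     modulus. *)
  pose s := if t2 == 0 then x else x * (t2 / `|t2|).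
  have sx : `|s| = x.
    rewrite /s; case: eqP => [_|/eqP tn]; first exact: gtr0_norm.
    by rewrite normrM normf_div normr_id divff ?normr_eq0// mulr1 gtr0_norm.
  have ts : `|t2 + s| = `|t2| + x.
    rewrite /s; case: eqP => [->|/eqP tn]; first by rewrite normr0 !add0r gtr0_norm.
    have -> : t2 + x * (t2 / `|t2|) = t2 / `|t2| * (`|t2| + x).
      by field; rewrite normr_eq0.
    rewrite normrM normf_div normr_id divff ?normr_eq0// mul1r ger0_norm//.
    by rewrite addr_ge0// ltW.
  have sw : `|s| <= w by rewrite sx.
  have sp : 0 < `|s| by rewrite sx.
  have qE : quot (t2 + s) = quot t2.
    apply/eqP; rewrite -subr_eq0 quot_diff; [|exact: nw|exact: Kw].
    by rewrite Hd ?mul0r// sx.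
  have K2s : K2 (t2 + s) by split; [exact: Kw|rewrite /= qE].
  have := Ht2 _ K2s; rewrite lerN2 ts gerDl => /(lt_le_trans x0).
  by rewrite ltxx.
- have [s [sp sw]] := quotient_descent A'0 an0 mk FA' Na w0.
  rewrite -quot_diff; [|exact: nw|exact: Kw].
  rewrite raddfB/= subr_lt0 => /(le_lt_trans (mint2 _ (Kw _ sw))).
  by rewrite ltxx.
Qed.

End MinimumPrinciple.

Lemma rouche_order (F G : C -> C) r m l A B : 0 < r ->
  (forall t, `|t| <= r -> an1 F t) -> (forall t, `|t| <= r -> an1 G t) ->
  (forall t, 0 < `|t| -> `|t| <= r -> F t != 0 /\ G t != 0) ->
  A != 0 -> B != 0 -> asym F m A -> asym G l B ->
  (forall t, `|t| = r -> `|F t - G t| < `|F t|) -> m = l.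
Proof.
move=> r0 anF anG n0 A0 B0 FA GB H.
have n0F t : 0 < `|t| -> `|t| <= r -> F t != 0 by move=> t0 tr; have [] := n0 t t0 tr.
have n0G t : 0 < `|t| -> `|t| <= r -> G t != 0 by move=> t0 tr; have [] := n0 t t0 tr.
have Re1 t : `|t| = r -> 0 < 'Re (G t / F t).
  move=> tr; have Ft : F t != 0 by apply: n0F; rewrite tr.
  have h : `|1 - G t / F t| < 1.
    have -> : 1 - G t / F t = (F t - G t) / F t by field.
    by rewrite normf_div ltr_pdivrMr ?normr_gt0// mul1r H.
  have := le_lt_trans (Re_le_norm _) h; rewrite raddfB/= (Creal_ReP _ _) ?real1//.
  by rewrite gtrDl oppr_lt0.
case: (ltngtP m l) => // ml; exfalso.
  exact: (minimum_principle r0 anF anG n0F A0 FA GB ml Re1).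
(* The inverse of [w] has real part [Re w / |w| ^ 2], so the roles of [F] and [G] can be
   exchanged. *)
apply: (minimum_principle r0 anG anF n0G B0 GB FA ml) => t tr.
have := Re1 t tr; set w := G t / F t => wp.
have -> : F t / G t = w^-1 by rewrite /w invf_div.
have w0 : w != 0 by apply: contraTneq wp => ->; rewrite raddf0 ltxx.
have wn : 0 < `|w| ^- 2 by rewrite invr_gt0 exprn_gt0// normr_gt0.
by rewrite invC_norm ReMl ?gtr0_real// Re_conj mulr_gt0.
Qed.

End Rouche.

(** * Analytic invariance and satellites *)

#[local] Existing Instance totally_filter.

Section Transfer.
Variables (C : numClosedFieldType) (cptC : disc_compact C) (n : nat).
Hypothesis hn : (2 <= n)%N.
Implicit Types (v z : 'rV[C]_n) (h k p q u : 'rV[C]_n -> C).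
Local Open Scope card_scope.

Let j0 : 'I_n := Ordinal (leq_trans (isT : (0 < 2)%N) hn).
Let j1 : 'I_n := Ordinal (leq_trans (isT : (1 < 2)%N) hn).

Lemma open_neq0 (O : set 'rV[C]_n) h : open O -> (forall z, O z -> holomorphic_at h z) ->
  open (O `&` [set z | h z != 0]).
Proof.
move=> oO hO; rewrite openE => z [Oz hz]; apply: filterI; first exact: open_nbhs_nbhs.
apply: filterS (holomorphic_neq0 (hO z Oz) hz) => w /= hw.
by rewrite -normr_gt0 (lt_le_trans _ hw)// divr_gt0 ?normr_gt0.
Qed.

Lemma is_multiplicity_uniq h m l : is_multiplicity h m -> is_multiplicity h l -> m = l.
Proof.
move=> hm hl.
have [||v [_ /= vj] [Pv Qv]] := @generic_meet C n _
    (setT `&` [set v : 'rV[C]_n | v 0 j0 != 0]) (genericI hm hl).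
- by apply: open_neq0 => [|z _]; [exact: openT|exact: holomorphic_coord].
- by exists (ej C j0); split=> //=; rewrite ejE eqxx oner_neq0.
have vn0 : v != 0 by apply: contraNneq vj => ->; rewrite mxE.
have [e1 e10 E1] := Pv vn0; have [e2 e20 E2] := Qv vn0.
have [e [e0 ee1 ee2]] := pos_min e10 e20.
have [d1 d10 D1] := E1 e e0 ee1; have [d2 d20 D2] := E2 e e0 ee2.
have [d [d0 dd1 dd2]] := pos_min d10 d20.
(* Where [Dt] is nonzero, [z] and [v] are independent and the line misses 0; this uses two
   coordinates. The choice [v 0 j0 != 0] keeps [Dt] from vanishing identically. *)
pose Dt z := z 0 j1 * v 0 j0 - z 0 j0 * v 0 j1.
have DH z : holomorphic_at Dt z.
  by apply: holomorphicB => //; apply: holomorphicM => //; [exact: holomorphic_coord|exact: holomorphic_cst|exact: holomorphic_coord|exact: holomorphic_cst].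
have D1n : Dt (ej C j1) != 0.
  by rewrite /Dt !ejE eqxx/= mul0r subr0 mul1r.
have [w we Dw] := entire_dense cptC 0 DH D1n (divr_gt0 d0 (ltr0n C 2)).
have bw : ball (0 : 'rV[C]_n) d w.
  by apply: pd_ball we; rewrite ?divr_gt0// ltr_pdivrMr// ltr_pMr// ltr1n.
have ob : open (ball (0 : 'rV[C]_n) d) by exact: ball_open.
have [|z [bz Dz] [Az Bz]] := generic_meet (genericI D1 D2) (open_neq0 ob (fun z _ => DH z)).
  by exists w.
have nl : ~ line z v 0.
  move=> [t _ zt]; move/eqP: Dz; apply; rewrite /Dt.
  have zE i : z 0 i = - t * v 0 i.
    by have := congr1 (fun y : 'rV[C]_n => y 0 i) zt; rewrite !mxE mulNr => /eqP; rewrite addr_eq0 => /eqP.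
  by rewrite !zE; ring.
have c1 := Az (le_ball dd1 bz) nl; have c2 := Bz (le_ball dd2 bz) nl.
exact/card_eq_II/(card_eq_trans (card_esym c1) c2).
Qed.

Lemma multiplicityE h m : reduced_germ h -> has_order h m -> multiplicity h = m.
Proof.
move=> red hm; have M := multiplicity_order cptC red hm.
rewrite /multiplicity; case: xgetP => [k _ /= Hk|/(_ m)/= []//].
exact: is_multiplicity_uniq Hk M.
Qed.

Lemma generic_sub (P Q : set 'rV[C]_n) : P `<=` Q -> generic P -> generic Q.
Proof. by move=> PQ [U [oU dU UP]]; exists U; split=> // z /UP/PQ. Qed.

Lemma is_multiplicity_ext h k m : (\forall z \near (0 : 'rV[C]_n), h z = 0 <-> k z = 0) ->
  is_multiplicity h m -> is_multiplicity k m.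
Proof.
move=> /nbhs_ballP[r /= r0 hk]; apply: generic_sub => v /= H vn0.
have [e1 e10 H1] := H vn0; have [e0 [e00 ee1 er]] := pos_min e10 r0.
exists e0 => // e e_gt0 ee0; have [d d0 D] := H1 e e_gt0 (le_trans ee0 ee1).
exists d => //; apply: generic_sub D => z /= Hz bz nl.
rewrite (_ : _ `&` _ `&` _ = line z v `&` zero_locus h `&` ball (0 : 'rV[C]_n) e).
  exact: Hz.
have br y : ball (0 : 'rV[C]_n) e y -> ball (0 : 'rV[C]_n) r y.
  by apply: le_ball; exact: le_trans er.
by apply/seteqP; split=> y [[ly hy] be]; split=> //; split=> //; apply/(hk _ (br _ be)).
Qed.

Lemma multiplicity_ext h k : (\forall z \near (0 : 'rV[C]_n), h z = 0 <-> k z = 0) ->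
  multiplicity h = multiplicity k.
Proof.
move=> hk; rewrite /multiplicity; congr xget; apply/seteqP; split=> m /=.
  exact: is_multiplicity_ext.
by apply: is_multiplicity_ext; apply: filterS hk => z [a b]; split.
Qed.

(** * Germs composed with a local biholomorphism *)

Section LocalIso.
Variables (phi psi : 'rV[C]_n -> 'rV[C]_n).
Hypothesis hphi : forall i, holomorphic_at (fun z => phi z 0 i) 0.
Hypothesis hpsi : forall i, holomorphic_at (fun z => psi z 0 i) 0.
Hypothesis phi0 : phi 0 = 0.
Hypothesis psi0 : psi 0 = 0.
Hypothesis phiK : \forall z \near (0 : 'rV[C]_n), psi (phi z) = z.
Hypothesis psiK : \forall z \near (0 : 'rV[C]_n), phi (psi z) = z.

Lemma near_phi (P : set 'rV[C]_n) : (\forall z \near (0 : 'rV[C]_n), P z) ->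
  \forall z \near (0 : 'rV[C]_n), P (phi z).
Proof. by move=> H; apply: near_comp => //; rewrite phi0. Qed.

Lemma near_psi (P : set 'rV[C]_n) : (\forall z \near (0 : 'rV[C]_n), P z) ->
  \forall z \near (0 : 'rV[C]_n), P (psi z).
Proof. by move=> H; apply: near_comp => //; rewrite psi0. Qed.

Lemma hol_phi h : holomorphic_at h 0 -> holomorphic_at (h \o phi) 0.
Proof. by move=> hh; apply: holomorphic_comp => //; rewrite phi0. Qed.

Lemma hol_psi h : holomorphic_at h 0 -> holomorphic_at (h \o psi) 0.
Proof. by move=> hh; apply: holomorphic_comp => //; rewrite psi0. Qed.

(** By [germ_unitP] units are the germs that do not vanish at 0, a property preserved by
    substitution. *)
Lemma irreducible_comp p : germ_irreducible p -> germ_irreducible (p \o psi).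
Proof.
move=> [hp pn pu irr]; split.
- exact: hol_psi.
- move=> p0; apply: pn; apply: filterS2 phiK (near_phi p0) => z /= -> //.
- rewrite (germ_unitP cptC j0 (hol_psi hp))/= psi0 => pz.
  by apply: pu; exact/(germ_unitP cptC j0 hp).
- move=> q u hq hu E.
  have [] := irr (q \o phi) (u \o phi) (hol_phi hq) (hol_phi hu).
  + by apply: filterS2 phiK (near_phi E) => z /= ->.
  + rewrite (germ_unitP cptC j0 (hol_phi hq))/= phi0 => qz.
    by left; exact/(germ_unitP cptC j0 hq).
  + rewrite (germ_unitP cptC j0 (hol_phi hu))/= phi0 => uz.
    by right; exact/(germ_unitP cptC j0 hu).
Qed.

Lemma reduced_comp h : reduced_germ h -> reduced_germ (h \o phi).
Proof.
move=> [hh h0 hn0 red]; split.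
- exact: hol_phi.
- by rewrite /= phi0.
- move=> E; apply: hn0; apply: filterS2 psiK (near_psi E) => z /= -> //.
- move=> p pirr [q hq E]; apply: (red _ (irreducible_comp pirr)).
  exists (q \o psi); first exact: hol_psi.
  by apply: filterS2 psiK (near_psi E) => z /= ->.
Qed.

Lemma order_comp h m l : has_order h m -> has_order (h \o phi) l -> l = m.
Proof.
move=> hm hl; apply/eqP; rewrite eqn_leq; apply/andP; split; last first.
  exact: (growth_order cptC hl (growth_comp hphi phi0 (has_order_growth hm))).
have := growth_comp hpsi psi0 (has_order_growth hl).
apply: (growth_order cptC); apply: has_order_ext hm.
by apply: filterS psiK => z /= ->.
Qed.

Lemma multiplicity_comp h : reduced_germ h -> multiplicity (h \o phi) = multiplicity h.
Proof.
move=> red; have [hh h0 hn0 _] := red; have red' := reduced_comp red.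
have [hh' _ hn0' _] := red'.
have [m hm] := order_exists hh hn0; have [l hl] := order_exists hh' hn0'.
by rewrite (multiplicityE red hm) (multiplicityE red' hl); exact: order_comp hm hl.
Qed.

End LocalIso.

(** A biholomorphism does not preserve lines, so [h] and [h \o phi] are compared through their
    orders; [h \o phi] and [k] have the same zeros near 0 and are compared through the count of
    points. *)
Lemma equivalent_multiplicity h k : reduced_germ h -> reduced_germ k ->
  analytically_equivalent h k -> multiplicity h = multiplicity k.
Proof.
move=> rh rk [phi [psi [U [W [[oU U0] [oW W0] [[hphi hpsi] phiU psiW phiK psiK] phi0 img]]]]].
have psi0 : psi 0 = 0 by rewrite -{1}phi0 phiK// inE.
have nU : \forall z \near (0 : 'rV[C]_n), U z by exact: open_nbhs_nbhs.
have nW : \forall z \near (0 : 'rV[C]_n), W z by exact: open_nbhs_nbhs.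
have nphiK : \forall z \near (0 : 'rV[C]_n), psi (phi z) = z.
  by apply: filterS nU => z Uz; rewrite phiK// inE.
have npsiK : \forall z \near (0 : 'rV[C]_n), phi (psi z) = z.
  by apply: filterS nW => z Wz; rewrite psiK// inE.
rewrite -(multiplicity_comp (hphi 0 U0) (hpsi 0 W0) phi0 psi0 nphiK npsiK rh).
apply: multiplicity_ext; apply: filterS nU => z Uz /=; split=> [hz|kz].
  have : (zero_locus h `&` W) (phi z) by split=> //; apply: phiU; exists z.
  rewrite -img => -[y [ky Uy] /(congr1 psi)].
  by rewrite !phiK ?inE// => <-.
have : (phi @` (zero_locus k `&` U)) (phi z) by exists z.
by rewrite img => -[].
Qed.

Lemma has_pseries_uniq h c d : has_pseries h 0 c -> has_pseries h 0 d -> c = d.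
Proof.
move=> /has_pseriesP[r [M [r0 Hc]]] /has_pseriesP[s [N [s0 Hd]]].
have [t [t0 tr ts]] := pos_min r0 s0.
have H := serD (ser_shrink (pd_cst_le n (ltW t0) tr) Hc)
  (serZ (-1) (ser_shrink (pd_cst_le n (ltW t0) ts) Hd)).
apply/funext => a; apply/eqP; rewrite -subr_eq0 -mulN1r; apply/eqP.
apply: (ser_uniq cptC t0 H).
by apply: filterE => z; rewrite mulN1r subrr.
Qed.

Lemma ser_pseries r c M h : 0 < r -> ser (cvec n r) c M h -> has_pseries h 0 c.
Proof.
move=> r0 H; apply/has_pseriesP; exists r, M; split=> //.
by apply: ser_ext H => z _; rewrite add0r.
Qed.

Lemma tangent_coneP h m r c M v : reduced_germ h -> has_order h m -> 0 < r ->
  ser (cvec n r) c M h -> tangent_cone h v <-> hpart c m v = 0.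
Proof.
move=> red hm r0 ch; have ps := ser_pseries r0 ch; split=> [[d pd']|cv].
  by rewrite (has_pseries_uniq pd' ps) (multiplicityE red hm) homogeneous_partE.
by exists c => //; rewrite (multiplicityE red hm) homogeneous_partE.
Qed.

Lemma rouche_multiplicity h k : reduced_germ h -> reduced_germ k ->
  rouche_satellite h k -> multiplicity h = multiplicity k.
Proof.
move=> rh rk [H [OH [K [OK [v [r [[_ hH Hh] [_ hK Kk] [vn0 nl r0 sub zer] lt]]]]]]].
have [hh h0 hn0 _] := rh; have [hk k0 kn0 _] := rk.
have [m hm] := order_exists hh hn0; have [l kl] := order_exists hk kn0.
rewrite (multiplicityE rh hm) (multiplicityE rk kl).
have [rc [c [M [rc0 ch c0 _]]]] := hm; have [rd [d [N [rd0 dk d0 _]]]] := kl.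
(* The line is outside the union of the cones, so a single point of it avoids both; homogeneity
   carries this over to [v]. *)
have [t tc] : exists t, ~ (tangent_cone h (t *: v) \/ tangent_cone k (t *: v)).
  apply: contrapT => nt; apply: nl => _ [t _ <-]; rewrite add0r.
  by apply: contrapT => tc; apply: nt; exists t.
have [ct dt] : hpart c m (t *: v) != 0 /\ hpart d l (t *: v) != 0.
  split; apply/eqP => E; apply: tc; [left|right].
    exact/(tangent_coneP _ rh hm rc0 ch).
  exact/(tangent_coneP _ rk kl rd0 dk).
have cv : hpart c m v != 0 by move: ct; rewrite hpartZ mulf_eq0 => /norP[].
have dv : hpart d l v != 0 by move: dt; rewrite hpartZ mulf_eq0 => /norP[].
have sw (f g : 'rV[C]_n -> C) : germ_eq f g -> germ_eq g f by move=> E; apply: filterS E => z ->.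
have LH := lead_ext (sw _ _ Hh) (lead_of_ser cptC v rc0 ch c0).
have LK := lead_ext (sw _ _ Kk) (lead_of_ser cptC v rd0 dk d0).
have dom s : `|s| <= r -> OH (s *: v) /\ OK (s *: v).
  by move=> sr; apply: sub; exists s.
have an (f : 'rV[C]_n -> C) s : holomorphic_at f (s *: v) -> an1 (fun t => f (t *: v)) s.
  move=> fs; have := @holomorphic_line _ cptC n f 0 s v; rewrite add0r => /(_ fs).
  by under eq_fun do rewrite add0r.
apply: (@rouche_order _ cptC (fun t => H (t *: v)) (fun t => K (t *: v)) r m l _ _ r0 _ _ _ cv dv LH LK).
- by move=> s sr; apply: an; apply: hH; have [] := dom s sr.
- by move=> s sr; apply: an; apply: hK; have [] := dom s sr.
- move=> s s0 sr; have sv0 : s *: v != 0.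
    by rewrite scaler_eq0 negb_or vn0 andbT -normr_gt0.
  have nz : ~ (zero_locus H `|` zero_locus K) (s *: v).
    move=> zs; have : (closed_disc v r `&` (zero_locus H `|` zero_locus K)) (s *: v).
      by split=> //; exists s.
    by rewrite (zer r r0 (lexx _)) => /eqP; rewrite (negbTE sv0).
  by split; apply/eqP => E; apply: nz; [left|right].
- by move=> s sr; apply: lt; exists s.
Qed.

Lemma germ_dvd_scale b p h : b != 0 -> germ_dvd p (fun z => b * h z) -> germ_dvd p h.
Proof.
move=> b0 [q hq E]; exists (fun z => b^-1 * q z).
  by apply: holomorphicM => //; exact: holomorphic_cst.
apply: filterS E => z E; rewrite mulrCA -E mulKf//.
Qed.

Lemma reduced_scale b h : b != 0 -> reduced_germ h -> reduced_germ (fun z => b * h z).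
Proof.
move=> b0 [hh h0 hn0 red]; split.
- by apply: holomorphicM => //; exact: holomorphic_cst.
- by rewrite h0 mulr0.
- move=> E; apply: hn0; apply: filterS E => z /eqP.
  by rewrite mulf_eq0 (negbTE b0) => /eqP.
- by move=> p pirr /(germ_dvd_scale b0); exact: red.
Qed.

Lemma equivalent_zero h k : zero_locus h = zero_locus k -> analytically_equivalent h k.
Proof.
move=> hk; exists id, id, setT, setT.
have oT : open_nbhs (0 : 'rV[C]_n) setT by split=> //; exact: openT.
have hid : holomorphic_map setT (id : 'rV[C]_n -> _).
  by move=> z _ i; exact: holomorphic_coord.
by split=> //; rewrite image_id hk.
Qed.

Lemma representative_id h : holomorphic_at h 0 -> exists2 r, 0 < r &
  representative h h (ball (0 : 'rV[C]_n) r).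
Proof.
move=> hh; have /nbhs_ballP[r /= r0 Hr] := holomorphic_near cptC hh.
exists r => //; split.
- by split; [exact: ball_open|exact: ballxx].
- by move=> z /Hr.
- exact: filterE.
Qed.

Lemma satellite_exists h k m : reduced_germ h -> reduced_germ k ->
  has_order h m -> has_order k m -> exists b, b != 0 /\ rouche_satellite h (fun z => b * k z).
Proof.
move=> rh rk hm km; have [hh h0 _ _] := rh; have [hk k0 _ _] := rk.
have [rc [c [M [rc0 ch c0 [v1 cv1]]]]] := hm; have [rd [d [N [rd0 dk d0 [v2 dv2]]]]] := km.
have [v cv dv] := entire_common cptC (@holomorphic_hpart _ cptC _ c m) (@holomorphic_hpart _ cptC _ d m) cv1 dv2.
have m0 : (0 < m)%N by rewrite lt0n (order0 cptC hm) h0 eqxx.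
have vn0 : v != 0.
  by apply: contraNneq cv => ->; rewrite -(scale0r 0) hpartZ expr0n gtn_eqF// mul0r.
(* This [b] equalises the leading coefficients on the line, so the difference of the germs is
   [O(t ^ (m + 1))]. *)
pose b := hpart c m v / hpart d m v.
have b0 : b != 0 by rewrite mulf_neq0 ?invr_neq0.
exists b; split=> //; set k' := fun z => b * k z.
have rk' : reduced_germ k' by exact: reduced_scale.
have k'm : has_order k' m.
  exists rd, (fun a => b * d a), (`|b| * N); split=> //; first exact: serZ.
    by move=> a am; rewrite d0// mulr0.
  exists v; rewrite /hpart; under eq_bigr do rewrite -mulrA.
  by rewrite -mulr_sumr mulf_neq0.
have k'S : ser (cvec n rd) (fun a => b * d a) (`|b| * N) k' by exact: serZ.
have bd : hpart (fun a => b * d a) m v = hpart c m v.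
  rewrite /hpart; under eq_bigr do rewrite -mulrA.
  by rewrite -mulr_sumr -/(hpart d m v) divfK.
have Lh := lead_of_ser cptC v rc0 ch c0.
have Lk : lead k' m v (hpart c m v).
  by rewrite -bd; apply: lead_of_ser k'S _ => // a am; rewrite d0// mulr0.
have [r1 r10 Rh] := representative_id hh.
have [r2 r20 Rk] : exists2 r, 0 < r & representative k' k' (ball (0 : 'rV[C]_n) r).
  by apply: representative_id; have [] := rk'.
have [K1 [e1 [K10 e10 H1]]] := Lh; have [K2 [e2 [K20 e20 H2]]] := Lk.
set A := hpart c m v in cv bd Lh Lk H1 H2.
have A40 : 0 < `|A| / 2 by rewrite divr_gt0 ?normr_gt0.
(* [K1 + K2] bounds the difference of the two germs, and the other [K1] is the loss in the lower
   bound for [h]. *)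
have [s [s0 s1 sK]] := small_radius (@ltr01 C) (addr_ge0 K10 (addr_ge0 K10 K20)) A40.
rewrite divr1 in sK.
have [r3 [r30 r31 r32]] := pos_min r10 r20.
have r320 : 0 < r3 / 2 by rewrite divr_gt0.
have [u [u0 uv]] := vec_scale v r320.
have [x1 [x10 x1e1 x1e2]] := pos_min e10 e20; have [x2 [x20 x2s x2u]] := pos_min s0 u0.
have [r [r0 rx1 rx2]] := pos_min x10 x20.
have A2 : `|A| / 2 < `|A| by rewrite ltr_pdivrMr// ltr_pMr ?normr_gt0// ltr1n.
have near t : `|t| <= r -> ball (0 : 'rV[C]_n) r3 (t *: v).
  move=> tr; apply: (@pd_ball _ _ _ _ (r3 / 2)) => //.
    by rewrite ltr_pdivrMr// ltr_pMr// ltr1n.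
  rewrite subr0 => i; apply: le_trans (uv i); rewrite !mxE !normrM ler_wpM2r//.
  by rewrite (gtr0_norm u0) (le_trans tr)// (le_trans rx2).
have key t : 0 < `|t| -> `|t| <= r ->
    [/\ h (t *: v) != 0, k' (t *: v) != 0 & `|h (t *: v) - k' (t *: v)| < `|h (t *: v)|].
  move=> t0 tr.
  have B1 := H1 t (le_trans tr (le_trans rx1 x1e1)).
  have B2 := H2 t (le_trans tr (le_trans rx1 x1e2)).
  have tm : 0 < `|t| ^+ m by rewrite exprn_gt0.
  have tK : `|t| * (K1 + (K1 + K2)) < `|A|.
    apply: le_lt_trans A2; apply: le_trans sK; rewrite ler_wpM2r ?addr_ge0//.
    by rewrite (le_trans tr)// (le_trans rx2).
  have low (f : 'rV[C]_n -> C) L : `|f (t *: v) - A * t ^+ m| <= L * `|t| ^+ m.+1 ->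
      (`|A| - `|t| * L) * `|t| ^+ m <= `|f (t *: v)|.
    move=> B; have : `|A * t ^+ m| <= `|A * t ^+ m - f (t *: v)| + `|f (t *: v)|.
      by rewrite -{1}(subrK (f (t *: v)) (A * t ^+ m)) ler_normD.
    rewrite distrC -lerBlDl; apply: le_trans; rewrite normrM normrX mulrBl lerD2l lerN2.
    apply: (le_trans B); rewrite (_ : L * _ = `|t| * L * `|t| ^+ m)//.
    by rewrite exprS; ring.
  have l1 := low _ _ B1; have l2 := low _ _ B2.
  have LL L : L <= K1 + (K1 + K2) -> 0 < `|A| - `|t| * L.
    by move=> LK; rewrite subr_gt0 (le_lt_trans _ tK)// ler_wpM2l.
  have p1 : 0 < `|A| - `|t| * K1 by apply: LL; rewrite lerDl addr_ge0.
  have p2 : 0 < `|A| - `|t| * K2 by apply: LL; rewrite addrA lerDr addr_ge0.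
  split.
  - by rewrite -normr_gt0 (lt_le_trans _ l1)// mulr_gt0.
  - by rewrite -normr_gt0 (lt_le_trans _ l2)// mulr_gt0.
  - apply: lt_le_trans l1.
    have -> : h (t *: v) - k' (t *: v) = (h (t *: v) - A * t ^+ m) - (k' (t *: v) - A * t ^+ m) by ring.
    apply: (le_lt_trans (ler_normB _ _)); apply: (le_lt_trans (lerD B1 B2)).
    rewrite -mulrDl exprS mulrA ltr_pM2r// ltrBrDr.
    by rewrite (_ : _ + _ = `|t| * (K1 + (K1 + K2)))//; ring.
have cone_h : ~ tangent_cone h v.
  by move=> /(tangent_coneP _ rh hm rc0 ch) /eqP; rewrite (negbTE cv).
have cone_k : ~ tangent_cone k' v.
  by move=> /(tangent_coneP _ rk' k'm rd0 k'S); rewrite bd => /eqP; rewrite (negbTE cv).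
exists h, (ball (0 : 'rV[C]_n) r1), k', (ball (0 : 'rV[C]_n) r2), v, r; split=> //.
- split=> //.
  + move=> /(_ v) H; have : (tangent_cone h `|` tangent_cone k') v.
      by apply: H; exists 1 => //; rewrite add0r scale1r.
    by case.
  + move=> _ [t tr <-]; split; [apply: (le_ball r31)|apply: (le_ball r32)]; exact: near.
  + move=> q q0 qr; apply/seteqP; split=> [_ [[t tq <-] zt]|_ ->] /=.
      have [->|tn0] := eqVneq t 0; first by rewrite scale0r.
      have tp : 0 < `|t| by rewrite normr_gt0.
      have [hz kz _] := key t tp (le_trans tq qr).
      by case: zt => zt; [move/eqP: hz|move/eqP: kz].
    split; first by exists 0; rewrite ?scale0r//= normr0 ltW.
    by left.
- move=> _ [t /= tr <-]; have tp : 0 < `|t| by rewrite tr.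
  by have [] := key t tp; rewrite ?tr.
Qed.

Lemma multiplicity_rouche f g : reduced_germ f -> reduced_germ g ->
  multiplicity f = multiplicity g <->
  exists f' g' : 'rV[C]_n -> C,
    [/\ reduced_germ f', reduced_germ g',
        analytically_equivalent f' f, analytically_equivalent g' g &
        rouche_satellite f' g'].
Proof.
move=> rf rg; split=> [fg|[f' [g' [rf' rg' ff gg sat]]]]; last first.
  rewrite -(equivalent_multiplicity rf' rf ff) -(equivalent_multiplicity rg' rg gg).
  exact: rouche_multiplicity.
have [hf f0 fn0 _] := rf; have [hg g0 gn0 _] := rg.
have [m fm] := order_exists hf fn0; have [l gl] := order_exists hg gn0.
move: fg; rewrite (multiplicityE rf fm) (multiplicityE rg gl) => ml; rewrite -ml in gl.
have [b [b0 sat]] := satellite_exists rf rg fm gl.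
exists f, (fun z => b * g z); split=> //.
- exact: reduced_scale.
- exact: equivalent_zero.
- apply: equivalent_zero; apply/seteqP; split=> z; rewrite /zero_locus/=.
    by move/eqP; rewrite mulf_eq0 (negbTE b0) => /eqP.
  by move=> ->; rewrite mulr0.
Qed.

End Transfer.

(** * The complex numbers *)

Local Open Scope complex_scope.

Section ComplexDisc.
Variable R : realType.
Let C : numClosedFieldType := R[i].
Let pair_to_complex (u : R * R) : C := u.1 +i* u.2.

Lemma complex_normD (x y : R) : `|pair_to_complex (x, y)| <= (`|x| + `|y|)%:C :> R[i].
Proof.
have -> : pair_to_complex (x, y) = (x +i* 0) + (0 +i* y) :> R[i].
  by apply/eqP; rewrite eq_complex/= addr0 add0r !eqxx.
rewrite (le_trans (ler_normD _ _))// rmorphD/=.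
by rewrite !normc_def/= !expr0n/= add0r addr0 !sqrtr_sqr.
Qed.

Lemma toC_continuous : continuous pair_to_complex.
Proof.
move=> [x y]; apply/cvgrPdist_lt => e e0.
have [b eb] : exists b : R, e = b%:C.
  by exists (complex.Re e); move: (ltW e0); case: (e) => p q; rewrite lecE/= => /andP[/eqP -> _].
move: e0; rewrite eb ltcR => b0.
have b2 : 0 < b / 2 by rewrite divr_gt0.
exists (ball x (b / 2), ball y (b / 2)) => /=; first by split; exact: nbhsx_ballx.
move=> [x' y'] /= [].
rewrite -!ball_normE/= => xx yy.
have -> : pair_to_complex (x, y) - pair_to_complex (x', y') = pair_to_complex (x - x', y - y') by [].
apply: le_lt_trans (complex_normD _ _) _; rewrite ltcR (splitr b) ltrD//.
Qed.

(** The disc is a closed subset of the image of a compact square of the real plane. *)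
Lemma complex_disc_compact : disc_compact C.
Proof.
(* A radius that is negative or not real gives the empty disc. *)
move=> r; case: (pselect (0 <= r)) => [r0|nr]; last first.
  rewrite (_ : [set t | _] = set0); first exact: compact0.
  by apply/seteqP; split=> t //= tr; apply: nr; exact: le_trans tr.
have [a ra] : exists a : R, r = a%:C.
  by exists (complex.Re r); move: r0; case: (r) => x y; rewrite lecE/= => /andP[/eqP -> _].
have cK : compact (pair_to_complex @` (`[- a, a]%classic `*` `[- a, a]%classic)).
  apply: continuous_compact; last by apply: compact_setX; exact: segment_compact.
  exact/continuous_subspaceT/toC_continuous.
rewrite (_ : [set t | _] = (pair_to_complex @` (`[- a, a]%classic `*` `[- a, a]%classic)) `&` [set t | `|t| <= r]).
  apply: compact_closedI => //.
  move=> t clt /=; apply/ler_addgt0Pr => e e0.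
  have [s [/= sr ts]] := clt _ (nbhsx_ballx t e e0).
  rewrite -[t](subrK s) (le_trans (ler_normD _ _))// addrC lerD//.
  by move: ts; rewrite -ball_normE/= => /ltW.
apply/seteqP; split=> [z /= zr|z [] //].
split=> //; exists (complex.Re z, complex.Im z); last by case: (z).
have zi (x : R) : x%:C <= r -> x <= a by rewrite ra lecR.
split; rewrite /= in_itv/= -ler_norml; apply: zi; apply: le_trans zr.
  exact: normc_ge_Re.
by case: (z) => p q; rewrite normc_def lecR/= -sqrtr_sqr ler_wsqrtr// lerDr sqr_ge0.
Qed.

End ComplexDisc.

Theorem theorem2p6 (R : realType) (n : nat) (f g : 'rV[R[i]]_n -> R[i])
    (hn : (2 <= n)%N) (hf : reduced_germ f) (hg : reduced_germ g) :
  multiplicity f = multiplicity g <->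
  exists f' g' : 'rV[R[i]]_n -> R[i],
    [/\ reduced_germ f', reduced_germ g',
        analytically_equivalent f' f, analytically_equivalent g' g &
        rouche_satellite f' g'].
Proof. exact: (multiplicity_rouche (@complex_disc_compact R) hn hf hg). Qed.
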